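(* Let $W:H\to H$ be a unitary operator. The continuous spectrum of the selfadjoint extension $L_W$ of $L_0$ is $$\sigma_c(L_W)=\mathbb{R}.$$
   Context: Setting. $H\neq\{0\}$ is a separable complex Hilbert space (inner products are linear in the first argument), $a<b$ are real numbers, and $A:D(A)\subset H\to H$ is a linear selfadjoint (possibly unbounded) operator. Put $L^2:=L^2(H,(-\infty,a))\oplus L^2(H,(b,+\infty))$ (direct sum of spaces of square-integrable $H$-valued functions). Let $H_+=D(A)$ with inner product $(f,g)_+=(Af,Ag)_H+(f,g)_H$, let $H_-$ be the corresponding negative-norm space (the dual of $H_+$ with respect to $H$), and let $\tilde A:H\to H_-$ be the continuous extension of $A$ (the adjoint of the continuous operator $A:H_+\to H$). Consider the differential expression $$\tilde l(u)=(\tilde l_1(u_1),\tilde l_2(u_2))=(iu_1'+\tilde A u_1,\ iu_2'+\tilde A u_2),\quad u=(u_1,u_2).$$ Minimal and maximal operators. On $I_1=(-\infty,a)$ and $I_2=(b,+\infty)$ let $\mathcal T_k$ be the set of finite sums of functions $\varphi(t)f$ with $\varphi\in C_0^\infty(I_k)$, $f\in D(A)$. The minimal operator $L_{k0}$ is the closure in $L^2(H,I_k)$ of the operator $\phi\mapsto i\phi'+A\phi$ on $\mathcal T_k$. The maximal operator is $L_k=L_{k0}^*$: $u\in D(L_k)$ with $L_ku=g$ iff $u,g\in L^2(H,I_k)$ and $\int_{I_k}(u,i\phi'+A\phi)_H\,dt=\int_{I_k}(g,\phi)_H\,dt$ for all $\phi\in\mathcal T_k$ (i.e. $i u'+\tilde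 A u=g$ in the weak sense). Set $L_0=L_{10}\oplus L_{20}$ and $L=L_1\oplus L_2$ in $L^2$; $L_0$ is closed symmetric and $L_0^*=L$. Each $u=(u_1,u_2)\in D(L)$ has a representative with $u_1$ continuous from $(-\infty,a]$ to $H$ and $u_2$ continuous from $[b,+\infty)$ to $H$; $u_1(a)$ and $u_2(b)$ denote the values of this representative. For a unitary operator $W:H\to H$, $L_W$ is the restriction of $L$ to $D(L_W)=\{u=(u_1,u_2)\in D(L):\ u_2(b)=Wu_1(a)\}$; it is a selfadjoint extension of $L_0$ in $L^2$. The continuous spectrum $\sigma_c(T)$ is the set of $\lambda$ in the spectrum of $T$ for which $T-\lambda$ is injective with dense but not full range. *)

(* Defs.v *)
From HB Require Import structures.
From mathcomp Require Import all_boot all_order all_algebra.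
From mathcomp Require Import sesquilinear complex.
From mathcomp Require Import all_classical all_reals all_analysis.
From mathcomp Require Import measurable_realfun.
From mathcomp Require Import ring lra.

Set Implicit Arguments.
Unset Strict Implicit.
Unset Printing Implicit Defensive.

Import Order.TTheory GRing.Theory Num.Theory.
Import numFieldNormedType.Exports.

Local Open Scope classical_set_scope.
Local Open Scope ring_scope.
Local Open Scope complex_scope.

Local Notation Re := (@complex.Re _).
Local Notation Im := (@complex.Im _).

(* The form [{dot V for Num.conj}] is linear in its first argument. *)
HB.mixin Record hasInner (R : realType) V & GRing.Lmodule R[i] V := {
  inner : {dot V for Num.conj} }.

#[short(type="preHilbertType")]
HB.structure Definition PreHilbert (R : realType) :=
  {V of hasInner R V & GRing.Lmodule R[i] V}.

HB.mixin Record isSeparableHilbert (R : realType) V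
    & PreHilbert R V & CompleteNormedModule R[i] V := {
  normr_inner : forall x : V, `|x| ^+ 2 = inner x x;
  separable_space : exists2 S : set V, countable S & dense S }.

#[short(type="sepHilbertType")]
HB.structure Definition SeparableHilbert (R : realType) :=
  {H of isSeparableHilbert R H & PreHilbert R H & CompleteNormedModule R[i] H}.

Section PreHilbertTheory.
Context (R : realType) (V : preHilbertType R).
Implicit Types u v w : V.

Definition inorm u : R := Num.sqrt (Re (inner u u)).

Lemma conjE (z : R[i]) : Num.conj z = (Re z -i* Im z).
Proof. by case: z. Qed.

Lemma innerDl w : {morph inner^~ w : u v / u + v}.
Proof. by move=> u v; rewrite linearDl. Qed.

Lemma innerDr w : {morph inner w : u v / u + v}.
Proof. by move=> u v; rewrite linearDr. Qed.

Lemma innerZl a u v : inner (a *: u) v = a * inner u v.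
Proof. by rewrite linearZl_LR. Qed.

Lemma innerZr a u v : inner u (a *: v) = Num.conj a * inner u v.
Proof. by rewrite linearZr_LR. Qed.

Lemma innerC u v : inner u v = Num.conj (inner v u).
Proof. by rewrite hermC expr0 mul1r. Qed.

Lemma inner_real u : inner u u = (Re (inner u u))%:C.
Proof.
have := dnorm_ge0 (@inner R V) u; case: (inner u u) => x y.
by rewrite lecE /= => /andP[/eqP -> _].
Qed.

Lemma Re_inner_ge0 u : 0 <= Re (inner u u).
Proof. by rewrite -lecR -inner_real; exact: dnorm_ge0. Qed.

Lemma inner_eq0 u : Re (inner u u) = 0 -> u = 0.
Proof.
by move=> u0; apply/eqP; rewrite -(dnorm_eq0 (@inner R V)) inner_real u0.
Qed.

Lemma Re_innerC u v : Re (inner u v) = Re (inner v u).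
Proof. by rewrite innerC conjE. Qed.

Lemma Im_innerE u v : Im (inner u v) = - Re (inner ('i *: u) v).
Proof. by rewrite innerZl; case: (inner u v) => x y /=; ring. Qed.

Lemma Re_innerD u v : Re (inner (u + v) (u + v)) =
  Re (inner u u) + Re (inner v v) + 2 * Re (inner u v).
Proof.
rewrite innerDl !innerDr !raddfD /= (Re_innerC v u); ring.
Qed.

Lemma Re_innerN u v : Re (inner (- u) v) = - Re (inner u v).
Proof. by rewrite -scaleN1r innerZl mulN1r; case: (inner u v). Qed.

Lemma Re_inner_polar u v : Re (inner u v) =
  (Re (inner (u + v) (u + v)) - Re (inner u u) - Re (inner v v)) / 2.
Proof.
rewrite Re_innerD; move: (Re (inner u u)) (Re (inner v v)) (Re _) => x y z.
by field.
Qed.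

Lemma Re_inner_le u v :
  `|Re (inner u v)| <= Re (inner u u) + Re (inner v v).
Proof.
have := Re_inner_ge0 (u + v); have := Re_inner_ge0 (- u + v).
rewrite !Re_innerD (Re_innerN u v) (Re_innerN u (- u)) (Re_innerC u (- u)).
rewrite (Re_innerN u u).
have := Re_inner_ge0 u; have := Re_inner_ge0 v.
move: (Re (inner u u)) (Re (inner v v)) (Re _) => x y z h1 h2 h3 h4.
by rewrite ler_norml; apply/andP; split; lra.
Qed.

Lemma Re_innerZ a u : Re (inner (a *: u) (a *: u)) =
  (Re a ^+ 2 + Im a ^+ 2) * Re (inner u u).
Proof.
rewrite innerZl innerZr conjE [inner u u]inner_real.
by case: a => x y /=; ring.
Qed.

End PreHilbertTheory.

(* [T] with its Borel sigma-algebra. *)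
Definition borel (T : topologicalType) : Type := g_sigma_algebraType (@open T).
HB.instance Definition _ (T : ptopologicalType) := Measurable.on (borel T).

Section BorelMeasurability.
Context (R : realType) (H : sepHilbertType R) d (T : measurableType d).
Local Notation borel := (borel H).

Lemma normr_inorm (x : H) : `|x| = (inorm x)%:C.
Proof.
apply/eqP; rewrite -(@eqrXn2 _ 2) //; last first.
  by rewrite lecR sqrtr_ge0.
by rewrite normr_inner inner_real -rmorphXn /= sqr_sqrtr // Re_inner_ge0.
Qed.

Lemma measurable_funB_open (D : set T) (f : T -> H) : measurable D ->
  (forall U : set H, open U -> measurable (D `&` f @^-1` U)) ->
  measurable_fun D (f : T -> borel).
Proof.
move=> mD mf; apply: (@measurability _ _ _ borel D f (@open H)) => //.
by move=> _ [U oU <-]; exact: mf.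
Qed.

Lemma measurable_funB_preimage (D : set T) (f : T -> H) (U : set H) :
  measurable D -> measurable_fun D (f : T -> borel) -> open U ->
  measurable (D `&` f @^-1` U).
Proof. by move=> mD mf oU; apply: mf => //; exact: sub_sigma_algebra. Qed.

Lemma measurable_funB_sq (D : set T) (f : T -> H) : measurable D ->
  measurable_fun D (f : T -> borel) ->
  measurable_fun D (fun t => Re (inner (f t) (f t))).
Proof.
move=> mD mf; apply: (measurability _ (RGenInftyO.measurableE R)).
move=> _ [_ [c ->] <-].
rewrite (_ : _ @^-1` _ = f @^-1` (ball 0 (Num.sqrt c)%:C)).
  by apply: measurable_funB_preimage => //; exact: ball_open.
apply/seteqP; split=> t /=; rewrite in_itv/= -ball_normE /= sub0r normrN.
  by move=> h; rewrite normr_inorm ltcR ltr_sqrt // (le_lt_trans _ h) //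
    Re_inner_ge0.
rewrite normr_inorm ltcR => h.
have c0 : 0 < c by rewrite -sqrtr_gt0 (le_lt_trans _ h) // sqrtr_ge0.
by move: h; rewrite ltr_sqrt.
Qed.

Lemma measurable_funBZ (D : set T) (a : R[i]) (f : T -> H) : measurable D ->
  measurable_fun D (f : T -> borel) ->
  measurable_fun D ((fun t => a *: f t) : T -> borel).
Proof.
move=> mD mf; apply: measurable_funB_open => // U oU.
rewrite (_ : _ @^-1` _ = f @^-1` ((fun x => a *: x) @^-1` U)) //.
apply: measurable_funB_preimage => //.
by apply: open_comp => // x _; exact: scaler_continuous.
Qed.

Lemma measurable_funBD (D : set T) (f g : T -> H) : measurable D ->
  measurable_fun D (f : T -> borel) -> measurable_fun D (g : T -> borel) ->
  measurable_fun D ((fun t => f t + g t) : T -> borel).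
Proof.
move=> mD mf mg; apply: measurable_funB_open => // U oU.
have [S cS dS] := @separable_space R H.
pose r n : R[i] := n.+1%:R^-1.
pose B (p : H * H * nat) := (D `&` f @^-1` (ball p.1.1 (r p.2))) `&`
  (D `&` g @^-1` (ball p.1.2 (r p.2))).
pose J := ((S `*` S) `*` [set: nat]) `&`
  [set p : H * H * nat | forall x y, ball p.1.1 (r p.2) x ->
     ball p.1.2 (r p.2) y -> U (x + y)].
rewrite (_ : _ `&` _ = \bigcup_(p in J) B p); last first.
  apply/seteqP; split=> t /=; last first.
    by move=> [[[x y] n] [_ /= J2] [[Dt fx] [_ gy]]]; split => //; exact: J2.
  move=> [Dt Ufg].
  have /nbhs_ballP[e /= e0 eU] : nbhs (f t + g t) U.
    by apply: open_nbhs_nbhs; split.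
  have [n rn] : exists n, r n < e / 4.
    have e0' : 0 < Re e / 4.
      by rewrite divr_gt0 //; move: e0; rewrite ltcE => /andP[].
    have [N _ /(_ N (leqnn N)) /= rN] := near_infty_natSinv_lt (PosNum e0').
    have e_real : e = (Re e)%:C.
      by move: e0; rewrite ltcE /=; case: (e) => x y /= /andP[/eqP -> _].
    have -> : e / 4 = (Re e / 4)%:C.
      by rewrite {1}e_real rmorphM /= fmorphV rmorph_nat.
    exists N; have -> : r N = (N.+1%:R^-1 : R)%:C.
      by rewrite fmorphV rmorph_nat.
    by rewrite ltcR.
  have near z : exists2 x, S x & ball x (r n) z.
    have [] := dS (ball z (r n)).
    - by exists z; apply: ballxx; rewrite invr_gt0 ltr0n.
    - exact: ball_open.
    - by move=> x [zx Sx]; exists x => //; exact: ball_sym.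
  have [x Sx xf] := near (f t); have [y Sy yg] := near (g t).
  exists (x, y, n); last by [].
  split => //= x' y'; rewrite -!ball_normE /= in xf yg * => xx' yy'.
  apply: eU; rewrite -ball_normE /=.
  have -> : f t + g t - (x' + y') =
      ((x - x') - (x - f t)) + ((y - y') - (y - g t)).
    have subBB (p q w : H) : (p - q) - (p - w) = w - q.
      by rewrite opprB addrC addrA subrK.
    by rewrite !subBB opprD addrACA.
  have -> : e = (e / 4 + e / 4) + (e / 4 + e / 4) by field.
  apply: le_lt_trans (ler_normD _ _) _.
  by apply: ltrD; apply: le_lt_trans (ler_normB _ _) _; apply: ltrD;
    exact: lt_trans rn.
have cJ : countable J.
  apply: (@sub_countable _ _ J ((S `*` S) `*` [set: nat])).
    by apply: subset_card_le; exact: subIsetl.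
  by apply: countableX => //; exact: countableX.
have /pfcard_geP[->|[h]] := cJ; first by rewrite bigcup_set0.
rewrite (_ : \bigcup_(p in J) B p = \bigcup_n B (h n)).
  apply: bigcupT_measurable => n; apply: measurableI;
    by apply: measurable_funB_preimage => //; exact: ball_open.
apply/seteqP; split=> t [].
  move=> p Jp Bp; have [n _ hn] := 'surj_h Jp.
  by exists n => //; rewrite hn.
by move=> n _ Bn; exists (h n) => //; exact: funS.
Qed.
End BorelMeasurability.

Local Open Scope quotient_scope.

Section SquareIntegrable.
Context (R : realType) (H : sepHilbertType R) (I : interval R).
Local Notation D := [set` I].
Local Notation mu := (@lebesgue_measure R).
Local Notation RT := (measurableTypeR R).

Let mD : measurable (D : set RT).
Proof. exact: measurable_itv. Qed.
Local Hint Resolve mD : core.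

(* Borel measurability is strong measurability here, [H] being separable.
   Functions are defined on all of [R]; only their values on [I] matter. *)
Definition sqint : {pred R -> H} := mem [set f : R -> H |
  measurable_fun D (f : RT -> borel H) /\
  (\int[mu]_(t in D) (Re (inner (f t) (f t)))%:E < +oo)%E].

Lemma sqintP (f : R -> H) : f \in sqint <->
  measurable_fun D (f : RT -> borel H) /\
  mu.-integrable D (EFin \o (fun t => Re (inner (f t) (f t)))).
Proof.
have absE : (fun t => `|(Re (inner (f t) (f t)))%:E|)%E =
    (fun t => (Re (inner (f t) (f t)))%:E).
  by apply/funext => t; rewrite gee0_abs ?lee_fin ?Re_inner_ge0.
split=> [/[!inE] -[mf intf]|[mf /integrableP[_]]]; last first.
  by rewrite /= absE inE.
split=> //; apply/integrableP; rewrite /= absE; split => //.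
by apply/measurable_EFinP; exact: measurable_funB_sq.
Qed.

Lemma measurable_fun_Re_inner (f g : R -> H) :
  measurable_fun D (f : RT -> borel H) -> measurable_fun D (g : RT -> borel H) ->
  measurable_fun D (fun t => Re (inner (f t) (g t))).
Proof.
move=> mf mg; rewrite (funext (fun t => Re_inner_polar (f t) (g t))).
apply: measurable_funM => //; apply: measurable_funB; last first.
  exact: measurable_funB_sq.
apply: measurable_funB; last exact: measurable_funB_sq.
exact: (measurable_funB_sq _ (measurable_funBD _ mf mg)).
Qed.

Lemma integrable_Re_inner (f g : R -> H) : f \in sqint -> g \in sqint ->
  mu.-integrable D (EFin \o (fun t => Re (inner (f t) (g t)))).
Proof.
move=> /sqintP[mf intf] /sqintP[mg intg].
apply: (le_integrable _ _ _ (integrableD _ intf intg)) => //.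
  by apply/measurable_EFinP; exact: measurable_fun_Re_inner.
move=> t _ /=; rewrite lee_fin (le_trans (Re_inner_le _ _)) //.
exact: ler_norm.
Qed.

Lemma sqintZ (a : R[i]) (f : R -> H) : f \in sqint -> a *: f \in sqint.
Proof.
move=> /sqintP[mf intf]; apply/sqintP; split; first exact: measurable_funBZ.
have := integrableZl mD (Re a ^+ 2 + Im a ^+ 2) intf.
apply: eq_integrable => // t _ /=; rewrite -EFinM; congr (_ %:E).
by rewrite -Re_innerZ.
Qed.

Lemma sqintD (f g : R -> H) : f \in sqint -> g \in sqint -> f + g \in sqint.
Proof.
move=> sf sg; have [mf intf] := (sqintP f).1 sf.
have [mg intg] := (sqintP g).1 sg.
apply/sqintP; split; first exact: measurable_funBD.
have intfg := integrable_Re_inner sf sg.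
have := integrableD mD (integrableD mD intf intg)
  (integrableZl mD 2 intfg).
by apply: eq_integrable => // t _ /=; rewrite -EFinM -!EFinD -Re_innerD.
Qed.

Lemma sqint_submod_closed : submod_closed sqint.
Proof.
split; last by move=> a f g sf sg; apply: sqintD => //; exact: sqintZ.
apply/sqintP; split; first exact: measurable_cst.
rewrite (_ : _ \o _ = cst 0%E); last first.
  by apply/funext => t; rewrite /= [inner _ _]linear0l.
exact: integrable0.
Qed.

HB.instance Definition _ :=
  GRing.isSubmodClosed.Build R[i] (R -> H) sqint sqint_submod_closed.

Record L2fun := L2Fun { L2fun_val :> R -> H; L2funP : L2fun_val \in sqint }.

HB.instance Definition _ := [isSub for L2fun_val].
HB.instance Definition _ := [Choice of L2fun by <:].
HB.instance Definition _ := [SubChoice_isSubLmodule of L2fun by <:].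

Definition L2fun_eq (f g : L2fun) := `[< ae_eq mu D f g >].

Lemma L2fun_eq_refl : reflexive L2fun_eq.
Proof. by move=> f; apply/asboolP; exact: ae_eq_refl. Qed.

Lemma L2fun_eq_sym : symmetric L2fun_eq.
Proof. by move=> f g; apply/asboolP/asboolP => /ae_eq_sym. Qed.

Lemma L2fun_eq_trans : transitive L2fun_eq.
Proof.
move=> g f h /asboolP fg /asboolP gh; apply/asboolP; exact: ae_eq_trans gh.
Qed.

Canonical L2fun_eq_equiv :=
  EquivRel L2fun_eq L2fun_eq_refl L2fun_eq_sym L2fun_eq_trans.


(* [L^2(H, I)] proper: classes modulo equality almost everywhere on [I]. *)
Definition L2 : Type := {eq_quot L2fun_eq}.
HB.instance Definition _ := Choice.on L2.
HB.instance Definition _ := EqQuotient.on L2.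

Implicit Types (u v w : L2) (f g h : L2fun).

Lemma L2_eqP f g : \pi_L2 f = \pi_L2 g <-> ae_eq mu D f g.
Proof. by split=> [/eqmodP/asboolP//|fg]; apply/eqmodP/asboolP. Qed.

Lemma repr_ae f : ae_eq mu D (repr (\pi_L2 f)) f.
Proof. by apply/L2_eqP; rewrite reprK. Qed.

Definition L2zero : L2 := \pi_L2 0.
Definition L2opp u : L2 := \pi_L2 (- repr u).
Definition L2add u v : L2 := \pi_L2 (repr u + repr v).
Definition L2scale (a : R[i]) u : L2 := \pi_L2 (a *: repr u).

Lemma L2funDE f g t : (f + g) t = f t + g t. Proof. by []. Qed.

Lemma L2funNE f t : (- f) t = - f t. Proof. by []. Qed.

Lemma L2funZE (a : R[i]) f t : (a *: f) t = a *: f t. Proof. by []. Qed.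

Lemma L2addE f g : L2add (\pi_L2 f) (\pi_L2 g) = \pi_L2 (f + g).
Proof.
apply/L2_eqP; apply: filterS2 (repr_ae f) (repr_ae g) => t ft gt Dt.
by rewrite !L2funDE ft // gt.
Qed.

Lemma L2oppE f : L2opp (\pi_L2 f) = \pi_L2 (- f).
Proof.
by apply/L2_eqP; apply: filterS (repr_ae f) => t ft Dt; rewrite !L2funNE ft.
Qed.

Lemma L2scaleE a f : L2scale a (\pi_L2 f) = \pi_L2 (a *: f).
Proof.
by apply/L2_eqP; apply: filterS (repr_ae f) => t ft Dt; rewrite !L2funZE ft.
Qed.

Lemma L2addA : associative L2add.
Proof.
move=> u v w; elim/quotW: u => f; elim/quotW: v => g; elim/quotW: w => h.
by rewrite (L2addE g h) (L2addE f) (L2addE f g) (L2addE _ h) addrA.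
Qed.

Lemma L2addC : commutative L2add.
Proof.
move=> u v; elim/quotW: u => f; elim/quotW: v => g.
by rewrite !L2addE addrC.
Qed.

Lemma L2add0 : left_id L2zero L2add.
Proof. by move=> u; elim/quotW: u => f; rewrite L2addE add0r. Qed.

Lemma L2addN : left_inverse L2zero L2opp L2add.
Proof. by move=> u; elim/quotW: u => f; rewrite L2oppE L2addE addNr. Qed.

HB.instance Definition _ := GRing.isZmodule.Build L2 L2addA L2addC L2add0 L2addN.

Lemma L2scaleA a b u : L2scale a (L2scale b u) = L2scale (a * b) u.
Proof.
elim/quotW: u => f.
by rewrite (L2scaleE b f) !L2scaleE scalerA.
Qed.

Lemma L2scale1 : left_id 1 L2scale.
Proof. by move=> u; elim/quotW: u => f; rewrite L2scaleE scale1r. Qed.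

Lemma L2scaleDr : right_distributive L2scale +%R.
Proof.
move=> a u v; elim/quotW: u => f; elim/quotW: v => g.
by rewrite [_ + _]L2addE (L2scaleE a f) (L2scaleE a g) L2scaleE [RHS]L2addE
  scalerDr.
Qed.

Lemma L2scaleDl u : {morph L2scale^~ u : a b / a + b}.
Proof.
by move=> a b; elim/quotW: u => f; rewrite !L2scaleE [RHS]L2addE scalerDl.
Qed.

HB.instance Definition _ := GRing.Zmodule_isLmodule.Build R[i] L2
  L2scaleA L2scale1 L2scaleDr L2scaleDl.

Definition L2inner u v : R[i] :=
  (\int[mu]_(t in D) Re (inner (repr u t) (repr v t))) +i*
  (\int[mu]_(t in D) Im (inner (repr u t) (repr v t))).

Definition fun_inner f g : R[i] :=
  (\int[mu]_(t in D) Re (inner (f t) (g t))) +i*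
  (\int[mu]_(t in D) Im (inner (f t) (g t))).

Lemma Re_int f g : mu.-integrable D (fun t => (Re (inner (f t) (g t)))%:E).
Proof. exact: (integrable_Re_inner (L2funP f) (L2funP g)). Qed.

Lemma Im_int f g : mu.-integrable D (fun t => (Im (inner (f t) (g t)))%:E).
Proof.
have := Re_int ((- 'i) *: f) g; apply: eq_integrable => // t _.
by rewrite /= innerZl; case: (inner (f t) (g t)) => x y /=; congr (_%:E); ring.
Qed.

Lemma ae_int f f' g g' (T : R[i] -> R) : ae_eq mu D f f' -> ae_eq mu D g g' ->
  mu.-integrable D (fun t => (T (inner (f t) (g t)))%:E) ->
  mu.-integrable D (fun t => (T (inner (f' t) (g' t)))%:E) ->
  \int[mu]_(t in D) T (inner (f t) (g t)) =
  \int[mu]_(t in D) T (inner (f' t) (g' t)).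
Proof.
move=> ff gg /measurable_int m1 /measurable_int m2.
rewrite /Rintegral; congr fine; apply: ae_eq_integral => //.
by apply: filterS2 ff gg => t /= ft gt Dt; rewrite ft ?gt.
Qed.

Lemma fun_inner_ae f f' g g' : ae_eq mu D f f' -> ae_eq mu D g g' ->
  fun_inner f g = fun_inner f' g'.
Proof.
move=> ff gg; rewrite /fun_inner; congr (_ +i* _); apply: ae_int => //;
  [exact: Re_int|exact: Re_int|exact: Im_int|exact: Im_int].
Qed.

Lemma L2innerE f g : L2inner (\pi_L2 f) (\pi_L2 g) = fun_inner f g.
Proof. by apply: fun_inner_ae; exact: repr_ae. Qed.

Lemma L2innerC u v : L2inner u v = Num.conj (L2inner v u).
Proof.
rewrite /L2inner conjE /=; congr (_ +i* _).
  by apply: eq_Rintegral => t _; rewrite Re_innerC.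
rewrite -mulN1r -RintegralZl //; last exact: Im_int.
by apply: eq_Rintegral => t _; rewrite innerC conjE mulN1r.
Qed.

Lemma Rint_lin (F G : RT -> R) (x y : R) :
  mu.-integrable D (EFin \o F) -> mu.-integrable D (EFin \o G) ->
  mu.-integrable D (EFin \o (fun t => x * F t + y * G t)) /\
  \int[mu]_(t in D) (x * F t + y * G t) =
    x * \int[mu]_(t in D) F t + y * \int[mu]_(t in D) G t.
Proof.
move=> iF iG.
have iFx : mu.-integrable D (EFin \o (fun t => x * F t)).
  by apply: eq_integrable (integrableZl mD x iF).
have iGy : mu.-integrable D (EFin \o (fun t => y * G t)).
  by apply: eq_integrable (integrableZl mD y iG).
split; first by apply: eq_integrable (integrableD mD iFx iGy).
by rewrite RintegralD // !RintegralZl.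
Qed.

Lemma L2inner_linear v a u w :
  L2inner (a *: u + w) v = a * L2inner u v + L2inner w v.
Proof.
elim/quotW: u => f; elim/quotW: w => g; elim/quotW: v => h.
rewrite [_ *: _]L2scaleE [\pi_L2 _ + _]L2addE !L2innerE /fun_inner.
case: a => x y.
have [i1 e1] := Rint_lin x (- y) (Re_int f h) (Im_int f h).
have [_ e1'] := Rint_lin 1 1 i1 (Re_int g h).
have [i2 e2] := Rint_lin x y (Im_int f h) (Re_int f h).
have [_ e2'] := Rint_lin 1 1 i2 (Im_int g h).
apply/eqP; rewrite eq_complex /=; apply/andP; split; apply/eqP.
  move: e1'; rewrite e1 !mul1r mulNr => <-; apply: eq_Rintegral => t _ /=.
  rewrite innerDl innerZl.
  case: (inner (f t) (h t)) (inner (g t) (h t)) => p q [p' q'] /=; ring.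
move: e2'; rewrite e2 !mul1r => <-; apply: eq_Rintegral => t _ /=.
rewrite innerDl innerZl.
case: (inner (f t) (h t)) (inner (g t) (h t)) => p q [p' q'] /=; ring.
Qed.

Lemma L2inner_bilinear : bilinear_for *%R (Num.conj \; *%R) L2inner.
Proof.
split=> [v a u w|u a v w] /=; first exact: L2inner_linear.
rewrite L2innerC L2inner_linear rmorphD rmorphM /=.
by rewrite -(L2innerC u v) -(L2innerC u w).
Qed.

HB.instance Definition _ := bilinear_isBilinear.Build R[i] L2 L2 R[i]
  *%R (Num.conj \; *%R) L2inner L2inner_bilinear.

Lemma L2inner_herm u v :
  L2inner u v = (-1) ^+ false * Num.conj (L2inner v u).
Proof. by rewrite expr0 mul1r -L2innerC. Qed.

HB.instance Definition _ := isHermitianSesquilinear.Build R[i] L2 false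
  Num.conj L2inner L2inner_herm.

Lemma L2inner_gt0 u : u != 0 -> 0 < L2inner u u.
Proof.
elim/quotW: u => f f0; rewrite L2innerE /fun_inner.
rewrite ltcE /=; apply/andP; split.
  rewrite /Rintegral integral0_eq // => t _.
  by rewrite inner_real.
rewrite lt_neqAle Rintegral_ge0 ?andbT; last by move=> t _; exact: Re_inner_ge0.
apply: contra f0 => /eqP int0; apply/eqP/L2_eqP.
have int0' : (\int[mu]_(t in D) (Re (inner (f t) (f t)))%:E = 0)%E.
  rewrite -[LHS]fineK; first by congr (_ %:E); exact: esym int0.
  exact: integrable_fin_num (Re_int f f).
have absE : (fun t => `|(Re (inner (f t) (f t)))%:E|)%E =
    (fun t => (Re (inner (f t) (f t)))%:E).
  by apply/funext => t; rewrite gee0_abs ?lee_fin ?Re_inner_ge0.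
have mf := measurable_int _ (Re_int f f).
have := (ae_eq_integral_abs mu mD mf).1; rewrite absE => /(_ int0').
by apply: filterS => t /= ft Dt; apply: inner_eq0; case: (ft Dt).
Qed.

HB.instance Definition _ := isDotProduct.Build R[i] L2 L2inner L2inner_gt0.

HB.instance Definition _ := hasInner.Build R L2 (L2inner : {dot L2 for Num.conj}).

End SquareIntegrable.

Section PreHilbertProduct.
Context (R : realType) (U V : preHilbertType R).
Implicit Types p q : (U * V)%type.

Definition pair_inner p q : R[i] := inner p.1 q.1 + inner p.2 q.2.

Lemma pair_innerC p q : pair_inner p q = Num.conj (pair_inner q p).
Proof. by rewrite rmorphD /= -!innerC. Qed.

Lemma pair_inner_linear q a p p' :
  pair_inner (a *: p + p') q = a * pair_inner p q + pair_inner p' q.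
Proof. by rewrite /pair_inner /= !innerDl !innerZl mulrDr addrACA. Qed.

Lemma pair_inner_bilinear : bilinear_for *%R (Num.conj \; *%R) pair_inner.
Proof.
split=> [q a p p'|p a q q'] /=; first exact: pair_inner_linear.
by rewrite pair_innerC pair_inner_linear rmorphD rmorphM /= -!pair_innerC.
Qed.

HB.instance Definition _ := bilinear_isBilinear.Build R[i] (U * V)%type
  (U * V)%type R[i] *%R (Num.conj \; *%R) pair_inner pair_inner_bilinear.

Lemma pair_inner_herm p q :
  pair_inner p q = (-1) ^+ false * Num.conj (pair_inner q p).
Proof. by rewrite expr0 mul1r -pair_innerC. Qed.

HB.instance Definition _ := isHermitianSesquilinear.Build R[i] (U * V)%type
  false Num.conj pair_inner pair_inner_herm.

Lemma pair_inner_gt0 p : p != 0 -> 0 < pair_inner p p.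
Proof.
rewrite -pair_eqE /= negb_and /pair_inner => /orP[] p0.
  by apply: ltr_wpDr; [exact: dnorm_ge0|rewrite dnorm_gt0].
by apply: ltr_wpDl; [exact: dnorm_ge0|rewrite dnorm_gt0].
Qed.

HB.instance Definition _ := isDotProduct.Build R[i] (U * V)%type
  pair_inner pair_inner_gt0.

HB.instance Definition _ := hasInner.Build R (U * V)%type
  (pair_inner : {dot (U * V)%type for Num.conj}).

End PreHilbertProduct.

(* Unbounded operators are represented by their graphs. *)
Section Operators.
Context (R : realType) (V : preHilbertType R).
Implicit Types (T : set (V * V)) (S : set V) (lambda : R[i]).

Definition op_dom T : set V := [set u | exists g, T (u, g)].

Definition op_range T : set V := [set g | exists u, T (u, g)].

Definition op_injective T := forall u v g, T (u, g) -> T (v, g) -> u = v.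

Definition linear_op T := [/\ T 0,
  forall (a : R[i]) p q, T p -> T q -> T (a *: p + q) &
  forall u g h, T (u, g) -> T (u, h) -> g = h].

Definition inorm_dense S :=
  forall u (e : R), 0 < e -> exists2 v, S v & inorm (u - v) < e.

Definition op_closure T : set (V * V) :=
  [set p | forall e : R, 0 < e ->
     exists q, [/\ T q, inorm (p.1 - q.1) < e & inorm (p.2 - q.2) < e]].

Definition op_adjoint T : set (V * V) :=
  [set p | forall q, T q -> inner p.1 q.2 = inner p.2 q.1].

Definition selfadjoint T :=
  [/\ linear_op T, inorm_dense (op_dom T) & op_adjoint T = T].

(* The graph of [T - lambda]. *)
Definition op_shift T lambda : set (V * V) :=
  [set p | T (p.1, p.2 + lambda *: p.1)].

Definition resolvent_set T : set R[i] :=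
  [set lambda | [/\ op_injective (op_shift T lambda),
    op_range (op_shift T lambda) = setT &
    exists M : R, forall u g, op_shift T lambda (u, g) ->
      inorm u <= M * inorm g]].

Definition spectrum T : set R[i] := ~` resolvent_set T.

Definition continuous_spectrum T : set R[i] :=
  [set lambda | [/\ spectrum T lambda,
    op_injective (op_shift T lambda),
    inorm_dense (op_range (op_shift T lambda)) &
    op_range (op_shift T lambda) <> setT]].

Definition unitary (W : {linear V -> V}) :=
  (forall x y, inner (W x) (W y) = inner x y) /\ (forall y, exists x, W x = y).

End Operators.

Definition op_sum (R : realType) (U V : preHilbertType R)
    (S : set (U * U)) (T : set (V * V)) : set ((U * V) * (U * V)) :=
  [set p | S (p.1.1, p.2.1) /\ T (p.1.2, p.2.2)].

Section TestFunctions.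
Context (R : realType).
Implicit Types (f : R -> R) (phi : R -> R[i]).

Definition smooth f := forall n t, derivable (derive1n n f) t 1.

Definition cderive phi (t : R) : R[i] :=
  derive1 (Re \o phi) t +i* derive1 (Im \o phi) t.

(* [phi \in C_0^oo(I)], complex-valued, for an open interval [I]. *)
Definition test_function (I : interval R) phi :=
  [/\ smooth (Re \o phi), smooth (Im \o phi),
      compact (closure [set t | phi t != 0]) &
      closure [set t | phi t != 0] `<=` [set` I]].

End TestFunctions.

Section DifferentialOperators.
Context (R : realType) (H : sepHilbertType R).

Definition represents (I : interval R) (u : L2 H I) (f : R -> H) :=
  {ae (@lebesgue_measure R), forall t, t \in I -> repr u t = f t}.

(* The graph of [phi |-> i phi' + A phi] on the finite sums of functions
   [phi_k(t) x_k], with [phi_k] a test function on [I] and [x_k] in the domain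
   of [A]; [y_k] stands for [A x_k]. *)
Definition L_test (A : set (H * H)) (I : interval R) :
    set (L2 H I * L2 H I) :=
  [set p | exists n (phi : 'I_n -> R -> R[i]) (x y : 'I_n -> H),
    [/\ forall k, test_function I (phi k), forall k, A (x k, y k),
        represents p.1 (fun t => \sum_(k < n) phi k t *: x k) &
        represents p.2 (fun t => 'i *: (\sum_(k < n) cderive (phi k) t *: x k) +
                                 \sum_(k < n) phi k t *: y k)]].

Arguments L_test : clear implicits.

Definition L_min (A : set (H * H)) (I : interval R) := op_closure (L_test A I).

Arguments L_min : clear implicits.

(* [(u, g) \in L_max A I] iff [i u' + \tilde A u = g] weakly, i.e. against the
   test functions above. *)
Definition L_max (A : set (H * H)) (I : interval R) := op_adjoint (L_min A I).

Arguments L_max : clear implicits.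

(* [u_1(a)] and [u_2(b)] are the values at the endpoints of the (unique)
   representatives continuous up to the endpoints. *)
Definition L_ext (A : set (H * H)) (a b : R) (W : H -> H) :
    set ((L2 H `]-oo, a[ * L2 H `]b, +oo[) * (L2 H `]-oo, a[ * L2 H `]b, +oo[)) :=
  [set p | op_sum (L_max A `]-oo, a[) (L_max A `]b, +oo[) p /\
    exists v1 v2 : R -> H,
      [/\ {within `]-oo, a], continuous v1}, represents p.1.1 v1,
          {within `[b, +oo[, continuous v2}, represents p.1.2 v2 &
          v2 b = W (v1 a)]].

End DifferentialOperators.

Arguments L_test {R H} A I.
Arguments L_min {R H} A I.
Arguments L_max {R H} A I.
Arguments L_ext {R H} A a b W.

(* Main.v *)
(* The extension T is closed and symmetric.  Green's formula
   |u(t)|^2 - |u(s)|^2 = 2 int_s^t Re (-i g, u) for i u' + A u = g, obtained by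
   convolving u in time so that A acts on the averages, bounds the boundary values
   by the graph norm, and W being isometric, the two boundary terms cancel.  Hence
   for nonreal lambda the range of T - lambda is closed, and it is everything as
   soon as it is dense.
   Let lambda be real.  A solution of i u' + A u = lambda u has constant norm in
   time, so it is zero if it is square integrable on a half-line.  This gives
   injectivity, and also density of the range, since both components of a vector
   orthogonal to the range are such solutions.  The range is not everything
   because there are quasi-modes phi(t) exp(i (m - lambda) t) x supported away
   from the boundary, with x an approximate eigenvector of A for m and phi a wide
   bump: if (T - lambda) v = g, the pairing of g with a unit quasi-mode u is that
   of v with (T - lambda) u, whereas a gliding hump produces g whose pairings decay
   more slowly. *)

Require Import Defs.
From mathcomp Require Import all_boot all_order all_algebra.
From mathcomp Require Import complex.
From mathcomp Require Import all_classical all_reals all_analysis.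
From mathcomp Require Import measurable_realfun.
From mathcomp Require Import ring lra.

Set Implicit Arguments.
Unset Strict Implicit.
Unset Printing Implicit Defensive.

Import Order.TTheory GRing.Theory Num.Theory.
Import numFieldNormedType.Exports.

Local Open Scope classical_set_scope.
Local Open Scope ring_scope.
Local Open Scope complex_scope.

Local Notation Re := (@complex.Re _).
Local Notation Im := (@complex.Im _).
Local Notation rin u v := (Re (inner u v)).

(** * Hilbert spaces *)

(** No vector-valued integral and no functional calculus appears. All integrals are of real
    functions: a complex identity is recovered from [Re (inner u v)] and [Re (inner u ('i *: v))],
    and the integral of [phi u] is the vector that Riesz's theorem attaches to the functional x |->
    Re (u, phi x). The obstacle is that u(t) need not lie in the domain of [A], so that Re (i A u,
    u) = 0 has no pointwise meaning; averages of [u] do lie there, because [A] equals its adjoint.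
    Derivatives always fall on the kernel of the average, never on [u]. The boundary term at
    infinity is removed by choosing far points where |u(t)|^2 is small, which exist by
    integrability; the resulting bound is uniform in t, so continuous representatives converge
    uniformly along graph-norm limits. Non-surjectivity is shown by a concrete right-hand side: the
    residual of the n-th quasi-mode may be prescribed, and 9^-n against humps of size 3^-n is
    enough, without any orthogonality between the quasi-modes. *)

Section RealInner.
Context (R : realType) (V : preHilbertType R).
Implicit Types (u v w : V) (r : R).

Lemma rinDl u v w : rin (u + v) w = rin u w + rin v w.
Proof. by rewrite innerDl raddfD. Qed.

Lemma rinDr u v w : rin w (u + v) = rin w u + rin w v.
Proof. by rewrite innerDr raddfD. Qed.

Lemma rinNl u v : rin (- u) v = - rin u v.
Proof. exact: Re_innerN. Qed.

Lemma rinNr u v : rin u (- v) = - rin u v.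
Proof. by rewrite Re_innerC rinNl Re_innerC. Qed.

Lemma rinBl u v w : rin (u - v) w = rin u w - rin v w.
Proof. by rewrite rinDl rinNl. Qed.

Lemma rinBr u v w : rin w (u - v) = rin w u - rin w v.
Proof. by rewrite rinDr rinNr. Qed.

Lemma rinZl r u v : rin (r%:C *: u) v = r * rin u v.
Proof. by rewrite innerZl; case: (inner u v) => x y /=; ring. Qed.

Lemma rinZr r u v : rin u (r%:C *: v) = r * rin u v.
Proof. by rewrite Re_innerC rinZl Re_innerC. Qed.

Lemma rin0l u : rin 0 u = 0.
Proof. by rewrite -(subrr 0) rinBl subrr. Qed.

Lemma rin0r u : rin u 0 = 0.
Proof. by rewrite Re_innerC rin0l. Qed.

Lemma rin_il u v : rin ('i *: u) v = - Im (inner u v).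
Proof. by rewrite Im_innerE opprK. Qed.

Lemma rin_ir u v : rin u ('i *: v) = Im (inner u v).
Proof. by rewrite innerZr conjE; case: (inner u v) => x y /=; ring. Qed.

Lemma rin_ii u v : rin ('i *: u) ('i *: v) = rin u v.
Proof. by rewrite rin_il innerZr conjE; case: (inner u v) => x y /=; ring. Qed.

Lemma rin_iC u v : rin ('i *: u) v = - rin u ('i *: v).
Proof. by rewrite rin_il rin_ir. Qed.

Lemma rin_iu u : rin ('i *: u) u = 0.
Proof. by rewrite rin_il inner_real /= oppr0. Qed.

(** The form is conjugate-linear on the right, so the second real part is the imaginary part.
    Complex identities thus follow from real ones applied to [v] and to ['i *: v]. *)
Lemma innerE u v : inner u v = rin u v +i* rin u ('i *: v).
Proof. by rewrite rin_ir; case: (inner u v). Qed.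

Lemma inorm_ge0 u : 0 <= inorm u. Proof. exact: sqrtr_ge0. Qed.

Lemma sqr_inorm u : inorm u ^+ 2 = rin u u.
Proof. by rewrite sqr_sqrtr // Re_inner_ge0. Qed.

Lemma inorm0 : inorm (0 : V) = 0.
Proof. by rewrite /inorm rin0l sqrtr0. Qed.

Lemma inorm_eq0 u : inorm u = 0 -> u = 0.
Proof. by move=> u0; apply: inner_eq0; rewrite -sqr_inorm u0 expr0n. Qed.

Lemma inormN u : inorm (- u) = inorm u.
Proof. by rewrite /inorm rinNl rinNr opprK. Qed.

Lemma inormC u v : inorm (u - v) = inorm (v - u).
Proof. by rewrite -inormN opprB. Qed.

Lemma inormZ r u : inorm (r%:C *: u) = `|r| * inorm u.
Proof.
by rewrite /inorm rinZl rinZr mulrA -expr2 sqrtrM ?sqr_ge0 // sqrtr_sqr.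
Qed.

Lemma inorm_i u : inorm ('i *: u) = inorm u.
Proof. by rewrite /inorm rin_ii. Qed.

Lemma rin_CS u v : rin u v <= inorm u * inorm v.
Proof.
have [u0|u0] := eqVneq (inorm u) 0.
  by rewrite (inorm_eq0 u0) rin0l inorm0 mul0r.
have [v0|v0] := eqVneq (inorm v) 0.
  by rewrite (inorm_eq0 v0) rin0r inorm0 mulr0.
have a0 : 0 < inorm u by rewrite lt_neqAle eq_sym u0 inorm_ge0.
have b0 : 0 < inorm v by rewrite lt_neqAle eq_sym v0 inorm_ge0.
(* With p = Re (u, v), the square of this vector is 2 |u| |v| (|u| |v| - p). *)
have := Re_inner_ge0 ((inorm v)%:C *: u - (inorm u)%:C *: v).
rewrite rinBl !rinBr !rinZl !rinZr (Re_innerC v u) -!sqr_inorm.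
set p := rin u v => h.
have : 0 <= (inorm u * inorm v) * (inorm u * inorm v - p) by nra.
by rewrite pmulr_rge0 ?mulr_gt0 // subr_ge0.
Qed.

Lemma rin_CS_abs u v : `|rin u v| <= inorm u * inorm v.
Proof.
rewrite ler_norml rin_CS andbT lerNl -rinNl -(inormN u).
exact: rin_CS.
Qed.

Lemma inormD u v : inorm (u + v) <= inorm u + inorm v.
Proof.
rewrite -(@ler_pXn2r _ 2) // ?nnegrE ?addr_ge0 ?inorm_ge0 //.
rewrite sqr_inorm Re_innerD -!sqr_inorm.
have := rin_CS u v; nra.
Qed.

Lemma inorm_dist w u v : inorm (u - v) <= inorm (u - w) + inorm (w - v).
Proof. by rewrite -[u - v](subrKA w) inormD. Qed.

Lemma inorm_lerB u v : inorm u - inorm v <= inorm (u - v).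
Proof. by rewrite lerBlDr -{1}(subrK v u) inormD. Qed.

Lemma parallelogram u v :
  inorm (u + v) ^+ 2 + inorm (u - v) ^+ 2 = 2 * inorm u ^+ 2 + 2 * inorm v ^+ 2.
Proof. by rewrite !sqr_inorm rinDl rinBl !rinDr !rinNr; ring. Qed.

Lemma rin_ext u v : (forall w, rin u w = rin v w) -> u = v.
Proof.
move=> h; apply/eqP; rewrite -subr_eq0; apply/eqP/inner_eq0.
by rewrite rinBl h subrr.
Qed.

(** First-order optimality: the choice r = p / q, with p = Re (z, w) and q = |w|^2, would lower the
    square by p^2 / q. *)
Lemma dist_sqr_min w z : (forall r, inorm z <= inorm (z - r%:C *: w)) ->
  rin z w = 0.
Proof.
move=> h; apply/eqP; apply: contraT => zw0.
have w0 : 0 < rin w w.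
  rewrite lt_neqAle Re_inner_ge0 andbT; apply: contra zw0 => /eqP/esym/inner_eq0.
  by move=> ->; rewrite rin0r.
have := h (rin z w / rin w w).
rewrite -(@ler_pXn2r _ 2) // ?nnegrE ?inorm_ge0 // !sqr_inorm.
rewrite rinBl !rinBr !rinZl !rinZr (Re_innerC w z).
set p := rin z w in zw0 *; set q := rin w w in w0 *.
have -> : rin z z - p / q * p - (p / q * p - p / q * (p / q * q)) =
  rin z z - p ^+ 2 / q by field; exact: lt0r_neq0.
have : 0 < p ^+ 2 / q by rewrite divr_gt0 // exprn_even_gt0.
lra.
Qed.

End RealInner.

Lemma inner_rinP (R : realType) (V V' : preHilbertType R) (u v : V) (u' v' : V') :
  rin u v = rin u' v' -> rin u ('i *: v) = rin u' ('i *: v') ->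
  inner u v = inner u' v'.
Proof. by rewrite (innerE u) (innerE u') => -> ->. Qed.

(** * Density by orthogonality and the Riesz representation *)

Section Completeness.
Context (R : realType).

Definition icvg (V : preHilbertType R) (u : nat -> V) (l : V) :=
  forall e : R, 0 < e ->
    exists N, forall n, (N <= n)%N -> inorm (u n - l) < e.

Definition icauchy (V : preHilbertType R) (u : nat -> V) :=
  forall e : R, 0 < e ->
    exists N, forall m n, (N <= m)%N -> (N <= n)%N -> inorm (u m - u n) < e.

Definition icomplete (V : preHilbertType R) :=
  forall u : nat -> V, icauchy u -> exists l, icvg u l.

Lemma natSinv_lt (e : R) : 0 < e ->
  exists N, forall n, (N <= n)%N -> n.+1%:R^-1 < e.
Proof.
move=> e0; have [N _ h] := near_infty_natSinv_lt (PosNum e0).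
by exists N => n Nn; exact: h.
Qed.

Lemma icvg_cauchy (V : preHilbertType R) (u : nat -> V) l :
  icvg u l -> icauchy u.
Proof.
move=> ul e e0; have [N h] := ul _ (divr_gt0 e0 (ltr0n R 2)).
exists N => m n Nm Nn; apply: le_lt_trans (inorm_dist l _ _) _.
rewrite (inormC l) (splitr e); apply: ltrD; exact: h.
Qed.

Lemma icvg_unique (V : preHilbertType R) (u : nat -> V) l l' :
  icvg u l -> icvg u l' -> l = l'.
Proof.
move=> ul ul'; apply/eqP; rewrite -subr_eq0; apply/eqP/inorm_eq0.
apply/eqP; rewrite eq_le inorm_ge0 andbT; apply/ler_addgt0Pr => e e0.
rewrite add0r; have e2 := divr_gt0 e0 (ltr0n R 2).
have [N h] := ul _ e2; have [N' h'] := ul' _ e2.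
apply: le_trans (inorm_dist (u (maxn N N')) _ _) _.
rewrite (inormC l) (splitr e); apply: ltW; apply: ltrD.
  by apply: h; rewrite leq_maxl.
by apply: h'; rewrite leq_maxr.
Qed.

Definition linear_subspace (V : preHilbertType R) (S : set V) :=
  S 0 /\ forall (c : R[i]) u v, S u -> S v -> S (c *: u + v).

(** The projection argument for a subspace that need not be closed: near-minimisers of the distance
    from [x] to [S] are Cauchy by the parallelogram law, their limit [l] realises the distance, and
    [x - l] is orthogonal to [S], hence zero. The near-minimisers themselves then approximate
    [x]. *)
Lemma dense_of_orth (V : preHilbertType R) (S : set V) : icomplete V ->
  linear_subspace S -> (forall w, (forall s, S s -> inner w s = 0) -> w = 0) ->
  inorm_dense S.
Proof.
move=> cV [S0 SP] orth x e e0.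
pose D := [set inorm (x - s) | s in S].
have [d dE] : exists d, d = inf D by exists (inf D).
have D0 : D !=set0 by exists (inorm (x - 0)), 0.
have Dlb : lbound D 0 by move=> _ [s _ <-]; exact: inorm_ge0.
have hD : has_inf D by split => //; exists 0.
have dD s : S s -> d <= inorm (x - s).
  by move=> Ss; rewrite dE; apply: ge_inf; [exists 0|exists s].
have d0 : 0 <= d by rewrite dE; exact: lb_le_inf.
have /choice[s hs] : forall n, exists s, S s /\ inorm (x - s) < d + n.+1%:R^-1.
  move=> n; have n0 : 0 < n.+1%:R^-1 :> R by rewrite invr_gt0 ltr0n.
  by rewrite dE; have [_ [s Ss <-] h] := inf_adherent n0 hD; exists s.
have par m n : inorm (s m - s n) ^+ 2 <=
    2 * inorm (x - s m) ^+ 2 + 2 * inorm (x - s n) ^+ 2 - 4 * d ^+ 2.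
  have := parallelogram (x - s n) (x - s m).
  have -> : x - s n - (x - s m) = s m - s n by rewrite opprB addrC subrKA.
  (* The midpoint of the two approximants is again in [S], so this vector has norm at least 2 d. *)
  have -> : x - s n + (x - s m) =
      (2%:R : R)%:C *: (x - (2^-1 : R)%:C *: (s n + s m)).
    rewrite scalerBr scalerA -rmorphM /= divff // scale1r.
    by rewrite rmorph_nat scaler_nat opprD addrACA.
  have Ssum : S ((2^-1 : R)%:C *: (s n + s m)).
    rewrite -[_ *: _]addr0; apply: (SP) => //; rewrite -[s n]scale1r.
    by apply: (SP); [exact: (hs n).1|exact: (hs m).1].
  have := dD _ Ssum; rewrite inormZ; set a := inorm (x - _ *: _).
  by rewrite exprMn real_normK ?num_real // => da; nra.
have cs : icauchy s.
  (* [g] is small enough for (d + g)^2 < d^2 + f^2 / 4, which turns [par] into a bound below f^2. *)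
  move=> f f0; pose g := Num.min 1 (f ^+ 2 / (12 * (d + 1))).
  have d1 : 0 < 12 * (d + 1) by lra.
  have g0 : 0 < g by rewrite lt_min ltr01 divr_gt0 ?exprn_gt0.
  have [N hN] := natSinv_lt g0; exists N => m n Nm Nn.
  rewrite -(@ltr_pXn2r _ 2) // ?nnegrE ?inorm_ge0 // ?ltW //.
  apply: le_lt_trans (par m n) _.
  have hm k : (N <= k)%N -> inorm (x - s k) ^+ 2 < d ^+ 2 + f ^+ 2 / 4.
    move=> Nk; have h1 := (hs k).2; have h2 := hN _ Nk.
    have h3 : inorm (x - s k) < d + g by rewrite (lt_trans h1) // ltrD2l.
    have [g1 gf] : g <= 1 /\ g * (12 * (d + 1)) <= f ^+ 2.
      split; first by rewrite ge_min lexx.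
      by rewrite -ler_pdivlMr // ge_min lexx orbT.
    have : inorm (x - s k) ^+ 2 < (d + g) ^+ 2.
      by rewrite ltr_pXn2r // ?nnegrE ?inorm_ge0 //; nra.
    have : 0 < f ^+ 2 by exact: exprn_gt0.
    by nra.
  by have := hm _ Nm; have := hm _ Nn; nra.
have [l sl] := cV _ cs.
have xl : inorm (x - l) <= d.
  apply/ler_addgt0Pr => f f0; have f2 := divr_gt0 f0 (ltr0n R 2).
  have [N hN] := sl _ f2; have [N' hN'] := natSinv_lt f2.
  pose k := maxn N N'; have h1 := hN k (leq_maxl _ _).
  have h2 := hN' k (leq_maxr _ _); have h3 := (hs k).2.
  have := inorm_dist (s k) x l; move: (_^-1) h2 h3 => q; lra.
have dl y : S y -> d <= inorm (x - l - y).
  move=> Sy; apply/ler_addgt0Pr => f f0; have [N /(_ N (leqnn N)) hN] := sl _ f0.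
  have Sy' : S (y + s N) by rewrite -[y]scale1r; apply: (SP) => //; exact: (hs N).1.
  have := dD _ Sy'; have := inormD (x - l - y) (l - s N).
  have -> : x - l - y + (l - s N) = x - (y + s N).
    by rewrite addrAC subrKA opprD addrA [LHS]addrAC.
  by rewrite (inormC l); lra.
have wS y : S y -> rin (x - l) y = 0.
  move=> Sy; apply: dist_sqr_min => r; apply: le_trans xl _.
  by apply: dl; rewrite -[_ *: _]addr0; apply: (SP).
have xl0 : x - l = 0.
  apply: orth => y Sy; rewrite innerE wS // wS // -[_ *: _]addr0; exact: SP.
have [N hN] := sl _ e0; exists (s N); first exact: (hs N).1.
by rewrite (subr0_eq xl0) inormC; exact: hN.
Qed.

(** Two cases avoid asking whether the kernel [K] of the complexified functional is closed. If only
    0 is orthogonal to [K], then [K] is dense and the bound forces [F] to vanish; otherwise a vector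
    [w] that is orthogonal to [K] and nonzero represents [F] after scaling. *)
Lemma riesz (V : preHilbertType R) (F : V -> R) (C : R) : icomplete V ->
  (forall u v, F (u + v) = F u + F v) -> (forall r u, F (r%:C *: u) = r * F u) ->
  (forall u, `|F u| <= C * inorm u) -> exists v, forall u, rin v u = F u.
Proof.
move=> cV FD FZ Fb.
pose K : set V := [set u | F u = 0 /\ F ('i *: u) = 0].
have FN u : F (- u) = - F u.
  have -> : - u = (-1 : R)%:C *: u by rewrite rmorphN1 scaleN1r.
  by rewrite FZ mulN1r.
have F0 : F 0 = 0 by have := FD 0 0; rewrite addr0; lra.
have FC (c : R[i]) u : F (c *: u) = Re c * F u + Im c * F ('i *: u).
  case: c => a b /=; rewrite (_ : a +i* b = a%:C + b%:C * 'i); last first.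
    by apply/eqP; rewrite eq_complex /=; apply/andP; split; apply/eqP; ring.
  by rewrite scalerDl FD -scalerA !FZ.
have Kiff u c : K u -> F (c *: u) = 0 by move=> [a b]; rewrite FC a b !mulr0 addr0.
have Ksub : linear_subspace K.
  split; first by split; rewrite ?scaler0.
  move=> c u v Ku Kv; split; rewrite ?scalerDr FD.
    by rewrite Kiff // Kv.1 addr0.
  by rewrite scalerA Kiff // Kv.2 addr0.
have [orth|] := pselect (forall w, (forall s, K s -> inner w s = 0) -> w = 0).
  exists 0 => u; rewrite rin0l; apply/esym/eqP; rewrite -normr_le0.
  apply/ler_addgt0Pr => e e0; rewrite add0r.
  have e1 : 0 < e / (`|C| + 1) by rewrite divr_gt0 // ltr_wpDl.
  have [v Kv uv] := dense_of_orth cV Ksub orth u e1.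
  have -> : F u = F (u - v) by rewrite FD FN Kv.1 subr0.
  apply: le_trans (Fb _) _; have := ler_norm C.
  move: uv; rewrite ltr_pdivlMr ?ltr_wpDl // => uv Cb.
  have := inorm_ge0 (u - v); nra.
move=> /existsNP[w /not_implyP[wK w0]].
(* the complex functional [u |-> F u - i F (i u)] has kernel [K] *)
pose z := F w +i* F ('i *: w).
pose c := z / (rin w w)%:C.
have ww0 : rin w w != 0 by apply/eqP => /inner_eq0 /w0.
exists (c *: w) => u.
have z0 : z != 0.
  apply/eqP => -[z1 z2]; apply: w0; apply: inner_eq0.
  by rewrite wK.
pose d := (F u -i* F ('i *: u)) / (F w -i* F ('i *: w)).
have zc0 : F w -i* F ('i *: w) != 0.
  move: z0; rewrite !eq_complex /= !negb_and => /orP[->//|].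
  by rewrite oppr_eq0 => ->; rewrite orbT.
have Fi v : F ('i *: ('i *: v)) = - F v.
  by rewrite scalerA -expr2 sqr_i scaleN1r FN.
(* [d] is the ratio of the values of the complex functional at [u] and at [w]; being complex-linear,
   it kills [u - d *: w]. *)
have Kd : K (u - d *: w).
  have hd : d * (F w -i* F ('i *: w)) = F u -i* F ('i *: u) by rewrite divfK.
  move: hd; case: (d) => p q hd; case: hd => h1 h2.
  split; rewrite ?scalerBr FD FN.
    by rewrite FC /=; apply/eqP; rewrite subr_eq0; apply/eqP; rewrite -h1; ring.
  rewrite scalerA mulrC -scalerA (FC (p +i* q)) /= Fi; lra.
have := wK _ Kd; rewrite [inner w (_ - _)]linearBr /= innerZr => /eqP.
rewrite subr_eq0 => /eqP wu.
rewrite innerZl wu conjE /c -inner_real.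
have hd : d * (F w -i* F ('i *: w)) = F u -i* F ('i *: u) by rewrite divfK.
rewrite (_ : z / _ * _ = z * (Re d -i* Im d)); last first.
  rewrite -mulrA (mulrC _^-1) -mulrA mulfV ?mulr1 //.
  by apply: contra ww0 => /eqP ->.
move: hd; case: (d) => p q [h1 h2] /=; rewrite -h1; ring.
Qed.

End Completeness.

(** * Limits, adjoints and the gliding hump *)

Section Limits.
Context (R : realType).
Implicit Type V : preHilbertType R.

Lemma icvg_le V (u : nat -> V) l x (c : R) N : icvg u l ->
  (forall n, (N <= n)%N -> inorm (u n - x) <= c) -> inorm (l - x) <= c.
Proof.
move=> ul h; apply/ler_addgt0Pr => e e0; have [M hM] := ul _ e0.
have := hM _ (leq_maxr N M); have := h _ (leq_maxl N M).
have := inorm_dist (u (maxn N M)) l x; rewrite (inormC l (u _)); lra.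
Qed.

Lemma eq0_small (r : R) : (forall e, 0 < e -> `|r| <= e) -> r = 0.
Proof.
move=> h; apply/eqP; rewrite -normr_le0; apply/ler_addgt0Pr => e e0.
by rewrite add0r; exact: h.
Qed.

Lemma icvg_rin V (u : nat -> V) l v (e : R) : icvg u l -> 0 < e ->
  exists N, forall n, (N <= n)%N -> `|rin (u n) v - rin l v| < e.
Proof.
move=> ul e0.
have v1 : 0 < inorm v + 1 by have := inorm_ge0 v; lra.
have [N hN] := ul _ (divr_gt0 e0 v1); exists N => n /hN; rewrite -rinBl => h.
apply: le_lt_trans (rin_CS_abs _ _) _; move: h; rewrite ltr_pdivlMr // => h.
by have := inorm_ge0 (u n - l); nra.
Qed.

Lemma op_adjoint_closed V (T : set (V * V)) (u g : nat -> V) l h :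
  (forall n, op_adjoint T (u n, g n)) -> icvg u l -> icvg g h ->
  op_adjoint T (l, h).
Proof.
move=> Tn ul gh [x y] Txy /=.
suff eqr v w : (forall n, rin (u n) v = rin (g n) w) -> rin l v = rin h w.
  apply: inner_rinP; apply: eqr => n; have /= := Tn n _ Txy.
    by move=> ->.
  by rewrite !rin_ir => ->.
move=> e; apply/eqP; rewrite -subr_eq0; apply/eqP/eq0_small => d d0.
have d2 := divr_gt0 d0 (ltr0n R 2).
have [N hN] := icvg_rin v ul d2; have [M hM] := icvg_rin w gh d2.
pose k := maxn N M; have := hN k (leq_maxl _ _); have := hM k (leq_maxr _ _).
rewrite e !ltr_norml => /andP[a b] /andP[a' b'].
rewrite ler_norml; apply/andP; split; lra.
Qed.

Lemma op_adjoint_linear V (T : set (V * V)) (a : R[i]) p q :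
  op_adjoint T p -> op_adjoint T q -> op_adjoint T (a *: p + q).
Proof.
move=> Tp Tq [x y] Txy /=.
by rewrite !innerDl !innerZl (Tp _ Txy) (Tq _ Txy).
Qed.

Lemma op_adjoint_closure V (T : set (V * V)) :
  op_adjoint (op_closure T) = op_adjoint T.
Proof.
apply/seteqP; split=> -[u g] Tug [x y] /= Txy.
  apply: (Tug (x, y)) => e e0; exists (x, y).
  by rewrite !subrr !inorm0.
have /choice[q hq] : forall n, exists q, [/\ T q,
    inorm (x - q.1) < n.+1%:R^-1 & inorm (y - q.2) < n.+1%:R^-1].
  by move=> n; apply: Txy; rewrite invr_gt0 ltr0n.
have c1 : icvg (fst \o q) x.
  move=> e /natSinv_lt[N hN]; exists N => n Nn; rewrite inormC /=.
  by have [_ h _] := hq n; apply: lt_trans h _; exact: hN.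
have c2 : icvg (snd \o q) y.
  move=> e /natSinv_lt[N hN]; exists N => n Nn; rewrite inormC /=.
  by have [_ _ h] := hq n; apply: lt_trans h _; exact: hN.
(* The limit is taken in the second argument of the form, so the roles are swapped: the adjoint of
   the singleton (g, u) is closed and contains the transposed approximants. *)
have : op_adjoint [set (g, u)] (y, x).
  apply: (@op_adjoint_closed _ _ (snd \o q) (fst \o q)) => // n _ -> /=.
  have [Tq _ _] := hq n; have /= e := Tug _ Tq.
  by rewrite innerC e -innerC.
by move=> /(_ (g, u) erefl) /= e; rewrite innerC e -innerC.
Qed.

(* [g] is a sum of [+- 3^-k u_k], the [k]-th sign being that of the pairing of
   [u_k] with the preceding partial sum. *)
Lemma gliding_hump V (u : nat -> V) : icomplete V ->
  (forall k, inorm (u k) = 1) ->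
  exists g, forall k, 3^-1 ^+ k / 2 <= `|rin (u k) g|.
Proof.
move=> cV u1.
pose s k x : R := if 0 <= rin (u k) x then 3^-1 ^+ k else - 3^-1 ^+ k.
pose g := fix g k := if k is j.+1 then g j + (s j (g j))%:C *: u j else 0.
have p3 k : 0 < 3^-1 ^+ k :> R by rewrite exprn_gt0 // invr_gt0.
have abs_s k x : `|s k x| = 3^-1 ^+ k.
  by rewrite /s; case: ifP => _; rewrite ?normrN ger0_norm // ltW.
(* Partial sums of the geometric series with ratio 1/3: everything added after the k-th term has
   norm at most 3^-k / 2, half of what the k-th term secures. *)
have step k j : inorm (g (k.+1 + j)%N - g k.+1) <=
    (3^-1 ^+ k - 3^-1 ^+ (k + j)) / 2.
  elim: j => [|j IH]; first by rewrite !addn0 !subrr inorm0 mul0r.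
  rewrite !addnS; apply: le_trans (inorm_dist (g (k.+1 + j)%N) _ _) _.
  rewrite [g (k.+1 + j).+1]/= addrAC subrr add0r inormZ u1 abs_s mulr1 addSn.
  rewrite addSn in IH; rewrite !exprS.
  move: (3^-1 ^+ (k + j)) (3^-1 ^+ k) IH => p q; lra.
have step' k n : (k < n)%N -> inorm (g n - g k.+1) <= 3^-1 ^+ k / 2.
  move=> kn; have := step k (n - k.+1)%N; rewrite subnKC // => /le_trans; apply.
  by have := p3 (k + (n - k.+1))%N; lra.
have cg : icauchy g.
  move=> e e0.
  have /cvgrPdist_lt/(_ _ e0)[K _ /(_ K (leqnn K)) hK] :=
    @cvg_expr R 3^-1 (ltac:(by rewrite ger0_norm ?invr_ge0 // invf_lt1 // ltr1n)).
  exists K.+1 => m n Km Kn; apply: le_lt_trans (inorm_dist (g K.+1) _ _) _.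
  have := step' _ _ Km; have := step' _ _ Kn; rewrite (inormC (g K.+1)).
  move: hK; rewrite sub0r normrN (ger0_norm (ltW (p3 K))).
  by move: (3^-1 ^+ K) => q; lra.
have [l gl] := cV _ cg; exists l => k.
have h1 : inorm (l - g k.+1) <= 3^-1 ^+ k / 2 := icvg_le gl (@step' k).
have h2 : 3^-1 ^+ k <= `|rin (u k) (g k.+1)|.
  rewrite /= rinDr rinZr -sqr_inorm u1 expr1n mulr1 /s; have := p3 k.
  by case: ifPn => [a|]; [move: a|rewrite -ltNge]; move=> a b;
    [rewrite ger0_norm|rewrite ler0_norm]; lra.
have := rin_CS_abs (u k) (g k.+1 - l); rewrite u1 mul1r inormC rinBr.
have := ler_normD (rin (u k) (g k.+1) - rin (u k) l) (rin (u k) l).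
by rewrite subrK; lra.
Qed.

End Limits.

(** * Approximate eigenvalues *)

Section ApproximateEigenvalue.
Context (R : realType) (V : preHilbertType R) (A : set (V * V)).
Hypotheses (cV : icomplete V) (V_neq0 : exists x : V, x != 0).
Hypothesis A_sa : selfadjoint A.

Lemma sa_lin (a : R[i]) x y x' y' : A (x, y) -> A (x', y') ->
  A (a *: x + x', a *: y + y').
Proof. by case: A_sa => -[_ h _] _ _; exact: h. Qed.

Lemma saZ (a : R[i]) x y : A (x, y) -> A (a *: x, a *: y).
Proof.
move=> h; rewrite -[a *: x]addr0 -[a *: y]addr0; apply: sa_lin => //.
by case: A_sa => -[].
Qed.

Lemma saD x y x' y' : A (x, y) -> A (x', y') -> A (x + x', y + y').
Proof. by move=> h; rewrite -[x]scale1r -[y]scale1r; exact: sa_lin. Qed.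

Lemma saB x y x' y' : A (x, y) -> A (x', y') -> A (x - x', y - y').
Proof.
by move=> h h'; apply: saD => //; rewrite -(scaleN1r x') -(scaleN1r y'); exact: saZ.
Qed.

Lemma sa_sym x y x' y' : A (x, y) -> A (x', y') -> inner x y' = inner y x'.
Proof. by case: A_sa => _ _ {1}<- h h'; exact: (h (x', y')). Qed.

Lemma sa_max x y : (forall x' y', A (x', y') -> inner x y' = inner y x') ->
  A (x, y).
Proof. by move=> h; case: A_sa => _ _ <- [x' y'] /= /h. Qed.

(* Let [B] be the inverse of [A] and [m] its norm.  As [B^2 <= m^2] almost
   attains its bound, [(B - m) (B + m)] is not bounded below, so that [1/m] or
   [-1/m] is an approximate eigenvalue of [A]. *)
Let bounded_inverse (c : R) : 0 < c ->
  (forall x y, A (x, y) -> c * inorm x <= inorm y) ->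
  exists mu : R, forall e : R, 0 < e ->
    exists x y, [/\ A (x, y), inorm x = 1 & inorm (y - mu%:C *: x) <= e].
Proof.
move=> c0 Ac.
have inj x x' y : A (x, y) -> A (x', y) -> x = x'.
  move=> a b; apply/eqP; rewrite -subr_eq0; apply/eqP/inorm_eq0.
  have := Ac _ _ (saB a b); rewrite subrr inorm0 => h.
  by have := inorm_ge0 (x - x'); nra.
(* The range is dense, since a vector orthogonal to it lies in the kernel of the adjoint, which is
   [A]. It is closed, since the lower bound makes preimages Cauchy and the graph of an adjoint is
   closed. *)
have /choice[B AB] : forall y, exists x, A (x, y).
  move=> y; pose S := op_range A.
  have Ssub : linear_subspace S.
    split; first by exists 0; case: A_sa => -[].
    by move=> a u v [x xu] [x' xv]; exists (a *: x + x'); exact: sa_lin.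
  have orth w : (forall s, S s -> inner w s = 0) -> w = 0.
    move=> h; apply/inorm_eq0; have /Ac : A (w, 0).
      by apply: sa_max => x' y' a; rewrite [RHS]linear0l h //; exists x'.
    by rewrite inorm0; have := inorm_ge0 w; nra.
  have /choice[p hp] : forall n, exists p, A p /\ inorm (y - p.2) < n.+1%:R^-1.
    move=> n; have [|s [x Ax] h] := dense_of_orth cV Ssub orth y (e := n.+1%:R^-1).
      by rewrite invr_gt0 ltr0n.
    by exists (x, s).
  have c2 : icvg (snd \o p) y.
    move=> e /natSinv_lt[N hN]; exists N => n Nn; rewrite inormC /=.
    by apply: lt_trans (hp n).2 _; exact: hN.
  have [x px] : exists x, icvg (fst \o p) x.
    apply: cV => e e0; have [N hN] := icvg_cauchy c2 (mulr_gt0 c0 e0).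
    exists N => m n Nm Nn; have := hN _ _ Nm Nn => /=.
    have := hp m; have := hp n; case: (p m) (p n) => a b [a' b'] [h1 _] [h2 _] /=.
    by have := Ac _ _ (saB h2 h1) => /le_lt_trans h /h; rewrite ltr_pM2l.
  exists x; case: A_sa => _ _ <-.
  apply: (op_adjoint_closed _ px c2) => n; case: A_sa => _ _ ->.
  by have [] := hp n; rewrite /comp; case: (p n).
have BD u v : B (u + v) = B u + B v.
  by apply: inj (AB _) _; exact: saD.
have BZ (a : R[i]) u : B (a *: u) = a *: B u.
  by apply: inj (AB _) _; exact: saZ.
have Bsym u v : rin (B u) v = rin u (B v) by rewrite (sa_sym (AB u) (AB v)).
have [x0 x0n] : exists x : V, inorm x = 1.
  have [x xn] := V_neq0; exists ((inorm x)^-1%:C *: x).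
  have x0 : 0 < inorm x.
    rewrite lt_neqAle inorm_ge0 andbT eq_sym; apply: contra xn => /eqP h.
    by rewrite (inorm_eq0 h).
  by rewrite inormZ ger0_norm ?invr_ge0 ?ltW // mulVf // gt_eqF.
pose D := [set inorm (B x) | x in [set x | inorm x = 1]].
have hD : has_sup D.
  split; first by exists (inorm (B x0)), x0.
  exists c^-1 => _ [x x1 <-]; have := Ac _ _ (AB x); rewrite x1.
  by rewrite -ler_pdivlMl // mulr1.
have [m mE] : exists m, m = sup D by exists (sup D).
have Bm1 x : inorm x = 1 -> inorm (B x) <= m.
  by move=> x1; rewrite mE; apply: sup_ubound; [case: hD|exists x].
have Bm x : inorm (B x) <= m * inorm x.
  have [x00|xn0] := eqVneq (inorm x) 0.
    rewrite (inorm_eq0 x00) -(scale0r (0 : V)) BZ !scale0r inorm0 mulr0 //.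
  have xp : 0 < inorm x by rewrite lt_neqAle eq_sym xn0 inorm_ge0.
  have := Bm1 ((inorm x)^-1%:C *: x); rewrite BZ !inormZ.
  rewrite ger0_norm ?invr_ge0 ?inorm_ge0 // mulVf // => /(_ erefl).
  by rewrite ler_pdivrMl // mulrC.
have m0 : 0 < m.
  apply: lt_le_trans (Bm1 _ x0n); rewrite lt_neqAle inorm_ge0 andbT eq_sym.
  apply/eqP => /inorm_eq0 B0; have := AB x0; rewrite B0 => A0.
  case: A_sa => -[A00 _ /(_ _ _ _ A0 A00)] x00 _ _.
  by move: x0n; rewrite x00 inorm0 => /eqP; rewrite eq_sym oner_eq0.
(* For a unit [x], |B^2 x - m^2 x|^2 is at most m^2 (m^2 - |B x|^2), because |B^2 x| <= m |B x|. If
   |B x| > m - d, this is at most 2 d m^3, which is e^2 for the chosen [d]. *)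
have sq (e : R) : 0 < e ->
    exists x, inorm x = 1 /\ inorm (B (B x) - (m ^+ 2)%:C *: x) <= e.
  move=> e0; pose d := e ^+ 2 / (2 * m ^+ 3).
  have m3 : 0 < 2 * m ^+ 3 by rewrite mulr_gt0 // exprn_gt0.
  have d0 : 0 < d by rewrite divr_gt0 // exprn_gt0.
  have [_ [x /= x1 <-]] := sup_adherent d0 hD; rewrite -mE => h.
  exists x; split => //.
  rewrite -(@ler_pXn2r _ 2) // ?nnegrE ?inorm_ge0 ?(ltW e0) //.
  rewrite sqr_inorm rinBl !rinBr !rinZl !rinZr (Re_innerC x (B (B x))).
  rewrite (Bsym (B x) x) -!sqr_inorm x1 expr1n.
  have := Bm (B x); have := Bm1 _ x1; have := inorm_ge0 (B x).
  have := inorm_ge0 (B (B x)).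
  move: (inorm (B (B x))) (inorm (B x)) h => q p h q0 p0 pm qmp.
  have dm : d * (2 * m ^+ 3) = e ^+ 2 by rewrite /d divfK // gt_eqF.
  have qq : q ^+ 2 <= m ^+ 2 * p ^+ 2.
    by rewrite -exprMn ler_pXn2r // nnegrE ?mulr_ge0 // (ltW m0).
  rewrite -dm; have : m ^+ 2 * (m ^+ 2 - p ^+ 2) <= d * (2 * m ^+ 3).
    have -> : d * (2 * m ^+ 3) = m ^+ 2 * (2 * d * m) by ring.
    by rewrite ler_pM2l ?exprn_gt0 //; clearbody d; nra.
  lra.
(* If [m] is not an approximate eigenvalue of [B], then [B - m] is bounded below; applied to (B + m)
   x this makes (B + m) x small whenever (B^2 - m^2) x is, and [- m] works. *)
have [nu nu0 hnu] : exists2 nu : R, nu != 0 & forall e : R, 0 < e ->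
    exists y, inorm y = 1 /\ inorm (B y - nu%:C *: y) <= e.
  have [h|] := pselect (forall e : R, 0 < e ->
    exists y, inorm y = 1 /\ inorm (B y - m%:C *: y) <= e).
    by exists m => //; rewrite gt_eqF.
  move=> /existsNP[d /not_implyP[d0 /forallNP hd]].
  have low y : d * inorm y <= inorm (B y - m%:C *: y).
    have [y0|yn0] := eqVneq (inorm y) 0; first by rewrite y0 mulr0 inorm_ge0.
    have yp : 0 < inorm y by rewrite lt_neqAle eq_sym yn0 inorm_ge0.
    rewrite leNgt; apply/negP => h; apply: (hd ((inorm y)^-1%:C *: y)).
    have yi : 0 <= (inorm y)^-1 by rewrite invr_ge0 ltW.
    split; first by rewrite inormZ ger0_norm // mulVf.
    rewrite BZ scalerA mulrC -scalerA -scalerBr inormZ ger0_norm //.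
    by rewrite ler_pdivrMl // mulrC ltW.
  exists (- m); first by rewrite oppr_eq0 gt_eqF.
  move=> e e0; have [x [x1 hx]] := sq _ (mulr_gt0 d0 e0).
  exists x; split=> //; rewrite rmorphN scaleNr opprK.
  have := low (B x + m%:C *: x); rewrite BD BZ scalerDr scalerA -rmorphM -expr2.
  rewrite opprD addrA addrK.
  move=> /le_trans/(_ hx); rewrite ler_pM2l //.
(* If B y is close to nu y, then [A] sends B y to y, which is close to nu^-1 B y. The first bound on
   [d] keeps |B y| >= |nu| / 2, so that B y can be normalised; the second makes the normalised error
   2 d / nu^2 at most [e]. *)
exists nu^-1 => e e0; have n0 : 0 < `|nu| by rewrite normr_gt0.
pose d := Num.min (`|nu| / 2) (e * `|nu| ^+ 2 / 2).
have d0 : 0 < d.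
  by rewrite lt_min !divr_gt0 // mulr_gt0 // exprn_gt0.
have [y [y1 hy]] := hnu _ d0.
have [d1 d2] : d <= `|nu| / 2 /\ d <= e * `|nu| ^+ 2 / 2.
  by split; rewrite ge_min lexx ?orbT.
have By : `|nu| / 2 <= inorm (B y).
  have := inorm_lerB (nu%:C *: y) (nu%:C *: y - B y).
  rewrite subKr inormZ y1 mulr1 (inormC _ (B y)) => h.
  by clearbody d; lra.
have By0 : 0 < inorm (B y) by apply: lt_le_trans By; rewrite divr_gt0.
exists ((inorm (B y))^-1%:C *: B y), ((inorm (B y))^-1%:C *: y).
have yi : 0 <= (inorm (B y))^-1 by rewrite invr_ge0 ltW.
split; first exact: saZ.
  by rewrite inormZ ger0_norm // mulVf // gt_eqF.
rewrite scalerA mulrC -scalerA -scalerBr inormZ ger0_norm // ler_pdivrMl //.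
have -> : y - nu^-1%:C *: B y = (- nu^-1)%:C *: (B y - nu%:C *: y).
  rewrite scalerBr scalerA -rmorphM mulNr mulVf // rmorphN1 scaleN1r opprK.
  by rewrite rmorphN scaleNr addrC.
rewrite inormZ normrN normfV ler_pdivrMl //.
apply: le_trans hy _; apply: le_trans d2 _.
have -> : e * `|nu| ^+ 2 / 2 = `|nu| * (`|nu| / 2 * e) by field.
by rewrite ler_pM2l // ler_pM2r.
Qed.

(** Either 0 is itself an approximate eigenvalue, or [A] is bounded below and its bounded inverse
    supplies one. *)
Lemma selfadjoint_approx_eigenvalue : exists mu : R, forall e : R, 0 < e ->
  exists x y, [/\ A (x, y), inorm x = 1 & inorm (y - mu%:C *: x) <= e].
Proof.
have [h|] := pselect (forall e : R, 0 < e ->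
    exists x y, [/\ A (x, y), inorm x = 1 & inorm (y - 0%:C *: x) <= e]).
  by exists 0.
move=> /existsNP[c /not_implyP[c0 hc]]; apply: (bounded_inverse c0) => x y Axy.
have [x0|xn0] := eqVneq (inorm x) 0; first by rewrite x0 mulr0 inorm_ge0.
have xp : 0 < inorm x by rewrite lt_neqAle eq_sym xn0 inorm_ge0.
rewrite leNgt; apply/negP => h; apply: hc.
have xi : 0 <= (inorm x)^-1 by rewrite invr_ge0 ltW.
exists ((inorm x)^-1%:C *: x), ((inorm x)^-1%:C *: y); split.
- exact: saZ.
- by rewrite inormZ ger0_norm // mulVf.
- rewrite scale0r subr0 inormZ ger0_norm // ler_pdivrMl // mulrC.
  exact: ltW.
Qed.

End ApproximateEigenvalue.

(** * Smooth steps and bumps *)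

Section Smooth.
Context (R : realType).
Implicit Types (f g : R -> R) (n k : nat) (x t c d : R).

Lemma derive1_val f g : (forall t, is_derive t 1 f (g t)) -> (derive1 f) = g.
Proof. by move=> h; apply/funext => t; rewrite derive1E derive_val. Qed.

(** A coinduction principle: it suffices to place a function in a class stable under
    differentiation, and no formula for iterated derivatives is needed. *)
Lemma smooth_coind (C : (R -> R) -> Prop) :
  (forall f, C f -> exists2 g, forall t, is_derive t 1 f (g t) & C g) ->
  forall f, C f -> smooth f.
Proof.
move=> h f Cf n; elim: n f Cf => [|n IH] f Cf t; have [g fg Cg] := h _ Cf.
  exact: (@ex_derive _ _ _ _ _ _ _ (fg t)).
by rewrite derive1Sn (derive1_val fg); exact: IH.
Qed.

Lemma smooth_is_derive f : smooth f -> forall t, is_derive t 1 f ((derive1 f) t).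
Proof. by move=> sf t; rewrite derive1E; apply/derivableP; exact: (sf 0). Qed.

Lemma smooth_derive1 f : smooth f -> smooth (derive1 f).
Proof. by move=> sf n t; rewrite -derive1Sn; exact: sf. Qed.

Lemma smooth_continuous f : smooth f -> continuous f.
Proof.
by move=> sf t; apply/differentiable_continuous/derivable1_diffP; exact: (sf 0).
Qed.

(** Products and reciprocals alone are not stable under differentiation, as (f g)' is a sum and
    (1/f)' is - (1/f)^2 f'. Closing under all three operations at once gives a class to which
    [smooth_coind] applies. *)
Inductive smooth_closure : (R -> R) -> Prop :=
  | smooth_closure_base f : smooth f -> smooth_closure f
  | smooth_closureD f g : smooth_closure f -> smooth_closure g ->
      smooth_closure (f + g)
  | smooth_closureM f g : smooth_closure f -> smooth_closure g ->
      smooth_closure (f * g)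
  | smooth_closureV f : (forall x, f x != 0) -> smooth_closure f ->
      smooth_closure (fun x => (f x)^-1).

Lemma smooth_cst c : smooth (cst c).
Proof.
apply: (@smooth_coind (fun f => exists c, f = cst c)); last by exists c.
by move=> _ [r ->]; exists (cst 0); [move=> t; exact: is_derive_cst|exists 0].
Qed.

Lemma smooth_closure_smooth f : smooth_closure f -> smooth f.
Proof.
apply: smooth_coind => {}f; elim=> {f} [f sf|f g Cf [f' df Cf'] Cg [g' dg Cg']|
    f g Cf [f' df Cf'] Cg [g' dg Cg']|f f0 Cf [f' df Cf']].
- exists (derive1 f); first exact: smooth_is_derive.
  exact/smooth_closure_base/smooth_derive1.
- by exists (f' + g'); [move=> t; exact: is_deriveD|exact: smooth_closureD].
- exists (f * g' + g * f'); first by move=> t; exact: is_deriveM.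
  by apply: smooth_closureD; exact: smooth_closureM.
- pose v x := (f x)^-1; exists (cst (-1) * (v * v) * f').
    move=> t; have h := is_deriveV (f0 t) (df t); apply: is_derive_eq h _.
    rewrite /v /GRing.mul /= /GRing.scale /=; congr (_ * _).
    by rewrite mulN1r expr2 invfM.
  apply: smooth_closureM => //; apply: smooth_closureM.
    exact/smooth_closure_base/smooth_cst.
  by apply: smooth_closureM; exact: smooth_closureV.
Qed.

Lemma smoothD f g : smooth f -> smooth g -> smooth (fun x => f x + g x).
Proof.
move=> sf sg; apply: smooth_closure_smooth.
by apply: (@smooth_closureD f g); exact: smooth_closure_base.
Qed.

Lemma smoothM f g : smooth f -> smooth g -> smooth (fun x => f x * g x).
Proof.
move=> sf sg; apply: smooth_closure_smooth.
by apply: (@smooth_closureM f g); exact: smooth_closure_base.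
Qed.

Lemma smoothV f : (forall x, f x != 0) -> smooth f ->
  smooth (fun x => (f x)^-1).
Proof.
move=> f0 sf; apply: smooth_closure_smooth.
by apply: smooth_closureV => //; exact: smooth_closure_base.
Qed.

Lemma is_derive_affine f c d t (f' : R) : is_derive (c * t + d) 1 f f' ->
  is_derive t 1 (fun x => f (c * x + d)) (c * f').
Proof.
move=> ff'; have aff : is_derive t 1 (fun x : R => c * x + d) c.
  have h := is_deriveD (is_deriveZ c (is_derive_id t (1 : R))) (is_derive_cst d t (1 : R)).
  by apply: is_derive_eq h _; rewrite addr0 /GRing.scale /= mulr1.
have h := @is_derive1_comp R f _ t _ _ ff' aff.
by apply: is_derive_eq h _; rewrite mulrC.
Qed.

Lemma smooth_affine f c d : smooth f -> smooth (fun x => f (c * x + d)).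
Proof.
(* The factor [k] absorbs the powers of [c] produced by the chain rule. *)
move=> sf; apply: (@smooth_coind (fun h => exists2 k : R, True &
  exists2 g, smooth g & h = fun x => k * g (c * x + d))); last first.
  by exists 1 => //; exists f => //; apply/funext => x; rewrite mul1r.
move=> _ [k _ [g sg ->]]; exists (fun x => k * c * (derive1 g) (c * x + d)).
  move=> t; have := is_derive_affine (smooth_is_derive sg (c * t + d)).
  move=> /(@is_deriveZ _ _ _ _ k) h; apply: is_derive_eq h _.
  by rewrite /GRing.scale /= mulrA.
exists (k * c); first by [].
by exists (derive1 g); first exact: smooth_derive1.
Qed.

Lemma smooth_trig (p q c : R) : smooth (fun x => p * cos (c * x) + q * sin (c * x)).
Proof.
apply: (@smooth_coind (fun h => exists p q : R,
  h = fun x => p * cos (c * x) + q * sin (c * x))); last by exists p, q.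
move=> _ [a [b ->]].
exists (fun x => (b * c) * cos (c * x) + (- a * c) * sin (c * x)); last first.
  by exists (b * c), (- a * c).
move=> t; have e0 (f : R -> R) : (fun x => f (c * x)) = (fun x => f (c * x + 0)).
  by apply/funext => x; rewrite addr0.
have hc : is_derive t 1 (fun x => cos (c * x)) (c * - sin (c * t)).
  rewrite (e0 cos); apply: (@is_derive_affine cos c 0); rewrite addr0.
  exact: is_derive_cos.
have hs : is_derive t 1 (fun x => sin (c * x)) (c * cos (c * t)).
  rewrite (e0 sin); apply: (@is_derive_affine sin c 0); rewrite addr0.
  exact: is_derive_sin.
have := is_deriveD (is_deriveZ a hc) (is_deriveZ b hs).
by move=> h; apply: is_derive_eq h _; rewrite /GRing.scale /=; ring.
Qed.

(* The functions [x^-k exp (-1/x)], extended by [0] to [x <= 0]; their span is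
   closed under differentiation. *)
Definition flat k x := if 0 < x then x^-1 ^+ k * expR (- x^-1) else 0.

Lemma flat_le0 k x : x <= 0 -> flat k x = 0.
Proof. by rewrite /flat leNgt => /negbTE ->. Qed.

Lemma flat_ge0 k x : 0 <= flat k x.
Proof.
rewrite /flat; case: ifPn => // x0.
by rewrite mulr_ge0 ?expR_ge0 // exprn_ge0 // invr_ge0 ltW.
Qed.

Lemma flat_gt0 k x : 0 < x -> 0 < flat k x.
Proof.
by move=> x0; rewrite /flat x0 mulr_gt0 ?expR_gt0 // exprn_gt0 // invr_gt0.
Qed.

(** From exp y >= y^(k+2) / (k+2)! at y = 1/x. The exponent 2 is what makes the difference quotient
    at 0 tend to 0. *)
Lemma flat_bound k : exists C : R, forall x, flat k x <= C * x ^+ 2.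
Proof.
pose C : R := k.+2`!%:R; exists C => x; rewrite /flat; case: ifPn => x0.
  have xi : 0 < x^-1 by rewrite invr_gt0.
  have := expR_ge1Dxn k.+1 (ltW xi); rewrite expRN => h.
  rewrite ler_pdivrMr ?expR_gt0 //.
  have C0 : 0 < C by rewrite ltr0n fact_gt0.
  have e1 : x^-1 ^+ k = C * x ^+ 2 * (x^-1 ^+ k.+2 / C).
    by rewrite !exprS; field; rewrite !gt_eqF.
  rewrite {1}e1; apply: ler_wpM2l; last by apply: le_trans h; lra.
  by rewrite mulr_ge0 ?sqr_ge0 ?ltW.
by rewrite mulr_ge0 ?sqr_ge0 // ler0n.
Qed.

Lemma is_derive_flat k t :
  is_derive t 1 (flat k) (- k%:R * flat k.+1 t + flat k.+2 t).
Proof.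
have [t0|t0|->] := ltgtP t 0.
- rewrite !(flat_le0 _ (ltW t0)) mulr0 addr0.
  apply: near_eq_is_derive (is_derive_cst 0 t 1).
  by near=> x; rewrite flat_le0 //; apply: ltW; near: x; exact: lt_nbhsl.
- pose h x : R := x^-1 ^+ k * expR (- x^-1).
  apply: (@near_eq_is_derive _ _ _ h).
    near=> x; rewrite /flat ifT //; near: x.
    exact: lt_nbhsr.
  have tn : t != 0 by rewrite gt_eqF.
  have dV : is_derive t 1 (fun x : R => x^-1) (- t ^- 2).
    have h1 := @is_deriveV R id t 1 1 tn (is_derive_id t 1).
    by apply: is_derive_eq h1 _; rewrite /GRing.scale /= mulr1.
  have dP := is_deriveX k dV.
  have dE := @is_derive1_comp R expR _ t _ _ (is_derive_expR (- t^-1))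
    (is_deriveN dV).
  have := is_deriveM dP dE; move=> dh.
  rewrite (_ : _ ^+ k * _ = h) in dh; last first.
    by apply/funext => x; rewrite /h !fctE.
  apply: is_derive_eq dh _; rewrite !fctE /flat t0 /GRing.scale /=.
  case: k {h dP} => [|k]; rewrite [_.-1]/= ?(expr0, exprS); field;
    by rewrite ?tn.
- rewrite !flat_le0 // mulr0 addr0.
  have [C hC] := flat_bound k.
  have lim0 : h^-1 *: ((flat k \o shift 0) (h *: 1) - flat k 0) @[h --> 0^'] --> (0 : R).
    apply/cvgrPdist_le => /= e e0.
    have C1 : 0 < `|C| + 1 by have := normr_ge0 C; lra.
    near=> h.
    have h0 : h != 0 by near: h; exact: nbhs_dnbhs_neq.
    have he : `|h| < e / (`|C| + 1).
      by near: h; apply: dnbhs0_lt; rewrite divr_gt0.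
    rewrite sub0r normrN (flat_le0 k (lexx 0)) subr0 /= addr0 /GRing.scale /= mulr1.
    rewrite normrM normfV (ger0_norm (flat_ge0 _ _)) ler_pdivrMl ?normr_gt0 //.
    apply: le_trans (hC h) _; rewrite -(real_normK (num_real h)) expr2 mulrA mulrC.
    rewrite ler_pM2l ?normr_gt0 //.
    move: he; rewrite ltr_pdivlMr // => he.
    by have := ler_norm C; have := normr_ge0 h; nra.
  by apply: DeriveDef; [apply/cvg_ex; exists 0|apply: cvg_lim].
Unshelve. all: by end_near. Qed.

Lemma smooth_flat k : smooth (flat k).
Proof.
(* [C n] describes sums of [n] multiples of functions [flat k]; differentiation doubles the number
   of terms. *)
pose C := fix C n : (R -> R) -> Prop := fun f =>
  if n is m.+1 then exists k (a : R) g, f = (fun x => a * flat k x + g x) /\ C m g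
  else f = cst 0.
have CD m n f g : C m f -> C n g -> C (m + n)%N (fun x => f x + g x).
  elim: m f => [|m IH] f; first by move=> -> Cg; under eq_fun do rewrite add0r.
  move=> [k' [a [f' [-> Cf']]]] Cg; exists k', a, (fun x => f' x + g x).
  by split; [apply/funext => x; rewrite addrA|exact: IH].
apply: (@smooth_coind (fun f => exists n, C n f)); last first.
  by exists 1%N, k, 1, (cst 0); split => //; apply/funext => x; rewrite mul1r addr0.
move=> f [n]; elim: n f => [|n IH] f.
  move=> ->; exists (cst 0); first by move=> t; exact: is_derive_cst.
  by exists 0%N.
move=> [k' [a [g [-> /IH[g' dg [m Cg']]]]]].
exists (fun x => (a * - k'%:R) * flat k'.+1 x + (a * flat k'.+2 x + g' x)).
  move=> t; have := is_deriveD (is_deriveZ a (is_derive_flat k' t)) (dg t).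
  by move=> h; apply: is_derive_eq h _; rewrite /GRing.scale /=; ring.
exists m.+2, k'.+1, (a * - k'%:R), (fun x => a * flat k'.+2 x + g' x).
by split => //; exists k'.+2, a, g'.
Qed.

Definition step x := flat 0 x / (flat 0 x + flat 0 (1 - x)).

(** The derivative of [step] in closed form, where the sign and the support can be read off. Its
    integral is 1 without normalisation, since [step] rises from 0 to 1. *)
Definition mollifier x := (flat 2 x * flat 0 (1 - x) + flat 0 x * flat 2 (1 - x)) /
  (flat 0 x + flat 0 (1 - x)) ^+ 2.

Lemma step_den_gt0 x : 0 < flat 0 x + flat 0 (1 - x).
Proof.
have [x0|x0] := leP x 0.
  by rewrite ltr_wpDl ?flat_ge0 // flat_gt0 //; lra.
by rewrite ltr_wpDr ?flat_ge0 // flat_gt0.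
Qed.

Lemma smooth_step : smooth step.
Proof.
have s1 : smooth (fun x => flat 0 (1 - x)).
  have := @smooth_affine _ (-1) 1 (@smooth_flat 0).
  by congr smooth; apply/funext => x; congr flat; ring.
apply: smoothM; first exact: smooth_flat.
apply: smoothV; first by move=> x; rewrite gt_eqF // step_den_gt0.
exact: (smoothD (@smooth_flat 0) s1).
Qed.

Lemma is_derive_step t : is_derive t 1 step (mollifier t).
Proof.
have d1 : is_derive t 1 (fun x => flat 0 (1 - x)) (- flat 2 (1 - t)).
  have -> : (fun x => flat 0 (1 - x)) = (fun x => flat 0 (-1 * x + 1)).
    by apply/funext => x; congr flat; ring.
  have := @is_derive_affine _ (-1) 1 t _ (is_derive_flat 0 (-1 * t + 1)).
  move=> h; apply: is_derive_eq h _; rewrite (_ : -1 * t + 1 = 1 - t); ring.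
have d0 := is_derive_flat 0 t.
have den0 : flat 0 t + flat 0 (1 - t) != 0 by rewrite gt_eqF // step_den_gt0.
have h := is_deriveM d0 (@is_deriveV R (fun x => flat 0 x + flat 0 (1 - x)) _ _ _
  den0 (is_deriveD d0 d1)).
apply: is_derive_eq h _; rewrite /GRing.scale /mollifier /=.
by move: (flat 0 t) (flat 0 (1 - t)) (flat 1 t) den0 => p q r den0; field.
Qed.

Lemma derive1_step : derive1 step = mollifier.
Proof. exact: derive1_val is_derive_step. Qed.

Lemma smooth_mollifier : smooth mollifier.
Proof. rewrite -derive1_step; exact/smooth_derive1/smooth_step. Qed.

Lemma step_le0 x : x <= 0 -> step x = 0.
Proof. by move=> x0; rewrite /step (flat_le0 _ x0) mul0r. Qed.

Lemma step_ge1 x : 1 <= x -> step x = 1.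
Proof.
move=> x1; rewrite /step (@flat_le0 _ (1 - x)) ?addr0; last by lra.
by rewrite divff // gt_eqF // flat_gt0 //; lra.
Qed.

Lemma step_ge0 x : 0 <= step x.
Proof. by rewrite divr_ge0 ?flat_ge0 // ltW // step_den_gt0. Qed.

Lemma step_le1 x : step x <= 1.
Proof.
by rewrite ler_pdivrMr ?step_den_gt0 // mul1r lerDl flat_ge0.
Qed.

Lemma mollifier_ge0 x : 0 <= mollifier x.
Proof. by rewrite divr_ge0 ?sqr_ge0 // addr_ge0 // mulr_ge0 // flat_ge0. Qed.

Lemma mollifier_out x : x \notin `[0, 1] -> mollifier x = 0.
Proof.
rewrite in_itv /= negb_and -!ltNge => /orP[x0|x1]; rewrite /mollifier.
  by rewrite !(@flat_le0 _ x) ?ltW // !mul0r addr0 mul0r.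
by rewrite !(@flat_le0 _ (1 - x)) ?mulr0 ?addr0 ?mul0r //; lra.
Qed.

Lemma smooth_bounded f c d : smooth f -> (forall x, x \notin `[c, d] -> f x = 0) ->
  exists2 M : R, 0 <= M & forall x, `|f x| <= M.
Proof.
move=> sf f0; have [cd|dc] := leP c d; last first.
  exists 0 => // x; rewrite f0 ?normr0 // in_itv /= negb_and -!ltNge.
  by have [//|h] := ltP x c; rewrite (lt_le_trans dc).
have cn : {within `[c, d], continuous (fun x => `|f x|)}.
  apply: continuous_subspaceT => x; apply: continuous_comp.
    exact: smooth_continuous.
  exact: norm_continuous.
have [m _ hm] := EVT_max cd cn; exists `|f m| => // x.
have [xcd|xcd] := boolP (x \in `[c, d]); first exact: hm.
by rewrite f0 // normr0.
Qed.

Lemma derive1_out f c d : smooth f -> (forall x, x \notin `[c, d] -> f x = 0) ->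
  forall x, x \notin `[c, d] -> derive1 f x = 0.
Proof.
move=> sf f0 x xcd; rewrite derive1E.
rewrite (@near_eq_derive _ _ _ _ (cst 0)) ?derive_cst //.
have : open (~` `[c, d]%classic) by rewrite openC; exact: itv_closed.
move=> /(_ x); rewrite nbhsE /= => h.
have nx : ~ `[c, d]%classic x by move=> /= /idP; rewrite (negbTE xcd).
by near=> y; apply: f0; apply/negP; near: y; apply: open_nbhs_nbhs; split;
  [rewrite openC; exact: itv_closed|].
Unshelve. all: by end_near. Qed.

Lemma test_function_real (I : interval R) f c d : smooth f ->
  (forall x, x \notin `[c, d] -> f x = 0) -> `[c, d] `<=` [set` I] ->
  test_function I (fun t => (f t)%:C).
Proof.
move=> sf f0 cdI.
have sub : closure [set t | (f t)%:C != 0] `<=` `[c, d].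
  have /closure_id -> : closed `[c, d]%classic by exact: itv_closed.
  by apply: closureS => t /=; apply: contraR => /f0 ->.
split=> //; first exact: smooth_cst.
  apply: subclosed_compact sub; [exact: closed_closure|exact: segment_compact].
exact: subset_trans sub cdI.
Qed.

Lemma cderive_real f t : cderive (fun t => (f t)%:C) t = (derive1 f t)%:C.
Proof.
rewrite /cderive; congr (_ +i* _).
by rewrite (_ : _ \o _ = cst 0) // derive1E derive_cst.
Qed.

End Smooth.

Arguments step {R} x.
Arguments mollifier {R} x.

(** * The space of square-integrable functions *)

Section HilbertTopology.
Context (R : realType) (H : sepHilbertType R).

Lemma posC_real (e : R[i]) : 0 < e -> 0 < Re e /\ e = (Re e)%:C.
Proof. by rewrite ltcE /=; case: e => x y /= /andP[/eqP -> ->]. Qed.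

Lemma inorm_cvgP (T : Type) (F : set_system T) (FF : Filter F) (f : T -> H) (l : H) :
  f @ F --> l <-> forall e : R, 0 < e -> \forall t \near F, inorm (f t - l) < e.
Proof.
split=> [/cvgrPdist_lt h e e0|h].
  have e0' : 0 < e%:C by rewrite ltcR.
  by apply: filterS (h _ e0') => t; rewrite normr_inorm ltcR inormC.
apply/cvgrPdist_lt => e /posC_real[e0 ->].
by apply: filterS (h _ e0) => t; rewrite normr_inorm ltcR inormC.
Qed.

Lemma hilbert_complete : icomplete H.
Proof.
move=> u cu; have cF : cauchy (u @ \oo).
  apply/cauchy_ballP => e /posC_real[e0 ->].
  have [N hN] := cu _ e0; exists (u @` [set n | (N <= n)%N], u @` [set n | (N <= n)%N]).
    by split; exists N => // n Nn /=; exists n.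
  move=> [x y] /= [[m Nm <-] [n Nn <-]].
  by rewrite -ball_normE /= normr_inorm ltcR; exact: hN.
have /cvg_ex[l ul] : cvg (u @ \oo) by exact: cauchy_cvg.
have h := (inorm_cvgP _ _ _).1 ul.
by exists l => e /h[N _ hN]; exists N.
Qed.

End HilbertTopology.

Section ProductComplete.
Context (R : realType) (U V : preHilbertType R).
Implicit Types p q : (U * V)%type.

Lemma rin_pair p q : rin p q = rin p.1 q.1 + rin p.2 q.2.
Proof. by rewrite raddfD. Qed.

Lemma inorm_fst p : inorm p.1 <= inorm p.
Proof.
rewrite -(@ler_pXn2r _ 2) // ?nnegrE ?inorm_ge0 // !sqr_inorm rin_pair.
by rewrite lerDl Re_inner_ge0.
Qed.

Lemma inorm_snd p : inorm p.2 <= inorm p.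
Proof.
rewrite -(@ler_pXn2r _ 2) // ?nnegrE ?inorm_ge0 // !sqr_inorm rin_pair.
by rewrite lerDr Re_inner_ge0.
Qed.

Lemma inorm_pair p : inorm p <= inorm p.1 + inorm p.2.
Proof.
rewrite -(@ler_pXn2r _ 2) // ?nnegrE ?addr_ge0 ?inorm_ge0 // sqr_inorm rin_pair.
rewrite -!sqr_inorm; have := inorm_ge0 p.1; have := inorm_ge0 p.2; nra.
Qed.

Lemma icvg_fst (u : nat -> (U * V)%type) l : icvg u l -> icvg (fst \o u) l.1.
Proof.
move=> ul e /ul[N hN]; exists N => n /hN; apply: le_lt_trans.
exact: (inorm_fst (u n - l)).
Qed.

Lemma icvg_snd (u : nat -> (U * V)%type) l : icvg u l -> icvg (snd \o u) l.2.
Proof.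
move=> ul e /ul[N hN]; exists N => n /hN; apply: le_lt_trans.
exact: (inorm_snd (u n - l)).
Qed.

Lemma product_complete : icomplete U -> icomplete V -> icomplete (U * V)%type.
Proof.
move=> cU cV u cu.
have [l1 h1] : exists l, icvg (fst \o u) l.
  apply: cU => e /cu[N hN]; exists N => m n Nm Nn; apply: le_lt_trans (hN _ _ Nm Nn).
  exact: (inorm_fst (u m - u n)).
have [l2 h2] : exists l, icvg (snd \o u) l.
  apply: cV => e /cu[N hN]; exists N => m n Nm Nn; apply: le_lt_trans (hN _ _ Nm Nn).
  exact: (inorm_snd (u m - u n)).
exists (l1, l2) => e e0; have e2 := divr_gt0 e0 (ltr0n R 2).
have [N hN] := h1 _ e2; have [M hM] := h2 _ e2; exists (maxn N M) => n.
rewrite geq_max => /andP[Nn Mn]; apply: le_lt_trans (inorm_pair _) _.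
by rewrite (splitr e); apply: ltrD; [exact: hN|exact: hM].
Qed.

End ProductComplete.

Section ScalarIntegrals.
Context (R : realType).
Local Notation mu := (@lebesgue_measure R).
Local Notation RT := (measurableTypeR R).
Implicit Types (f g : R -> R) (D E : set R).

Definition csupp f := continuous f /\
  exists c d : R, forall x, x \notin `[c, d] -> f x = 0.

Lemma csupp_smooth f c d : smooth f -> (forall x, x \notin `[c, d] -> f x = 0) ->
  csupp f.
Proof. by move=> sf f0; split; [exact: smooth_continuous|exists c, d]. Qed.

Lemma csuppM f g : csupp f -> csupp g -> csupp (fun x => f x * g x).
Proof.
move=> [cf [c [d f0]]] [cg _]; split; first by move=> x; apply: cvgM; [exact: cf|exact: cg].
by exists c, d => x /f0 ->; rewrite mul0r.
Qed.

Lemma csuppZ (r : R) f : csupp f -> csupp (fun x => r * f x).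
Proof.
move=> [cf [c [d f0]]]; split; first by move=> x; apply: cvgM; [exact: cvg_cst|exact: cf].
by exists c, d => x /f0 ->; rewrite mulr0.
Qed.

Lemma csuppD f g : csupp f -> csupp g -> csupp (fun x => f x + g x).
Proof.
move=> [cf [c [d f0]]] [cg [c' [d' g0]]]; split.
  by move=> x; apply: cvgD; [exact: cf|exact: cg].
exists (Num.min c c'), (Num.max d d') => x h.
have h1 : x \notin `[c, d].
  by apply: contra h; rewrite !in_itv /= ge_min le_max => /andP[-> ->].
have h2 : x \notin `[c', d'].
  by apply: contra h; rewrite !in_itv /= ge_min le_max => /andP[-> ->]; rewrite !orbT.
by rewrite f0 // g0 // addr0.
Qed.

Lemma Rintegral_restrict D E f : measurable (D : set RT) -> measurable (E : set RT) ->
  E `<=` D -> (forall x, D x -> ~ E x -> f x = 0) ->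
  \int[mu]_(x in D) f x = \int[mu]_(x in E) f x.
Proof.
move=> mD mE ED f0; rewrite [LHS]Rintegral_mkcond [RHS]Rintegral_mkcond.
apply: eq_Rintegral => x _; rewrite !patchE.
have [xE|xE] := boolP (x \in E); first by rewrite mem_set //; apply: ED; exact: set_mem.
case: ifPn => // xD; apply: f0; first exact: set_mem.
by move=> /mem_set; apply/negP.
Qed.

Lemma integrable_restrict_supp D E f : measurable (D : set RT) -> measurable (E : set RT) ->
  E `<=` D -> (forall x, D x -> ~ E x -> f x = 0) ->
  mu.-integrable E (EFin \o f) -> mu.-integrable D (EFin \o f).
Proof.
move=> mD mE ED f0; rewrite integrable_mkcond // [X in _ -> X]integrable_mkcond //.
congr (mu.-integrable _ _); apply/funext => x; rewrite !patchE.
have [xE|xE] := boolP (x \in E); first by rewrite mem_set //; apply: ED; exact: set_mem.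
case: ifPn => // xD; rewrite /= f0 //; first exact: set_mem.
by move=> /mem_set; apply/negP.
Qed.

Lemma csupp_integrable D f : measurable (D : set RT) -> csupp f ->
  mu.-integrable D (EFin \o f).
Proof.
move=> mD [cf [c [d f0]]]; apply: (@integrableS _ _ _ mu setT) => //.
apply: (@integrable_restrict_supp setT `[c, d]%classic) => //.
- by move=> x _ xcd; apply: f0; apply/negP.
- apply: continuous_compact_integrable; first exact: segment_compact.
  exact: continuous_subspaceT.
Qed.

Lemma Rintegral_norm_le D f (M c d : R) : measurable (D : set RT) -> c <= d ->
  mu.-integrable D (EFin \o f) -> (forall x, `|f x| <= M) ->
  (forall x, D x -> x \notin `[c, d] -> f x = 0) ->
  `|\int[mu]_(x in D) f x| <= M * (d - c).
Proof.
move=> mD cd intf fM f0.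
have mE : measurable (D `&` `[c, d] : set RT).
  by apply: measurableI => //; exact: measurable_itv.
rewrite (@Rintegral_restrict D (D `&` `[c, d])) //; last first.
  by move=> x Dx nE; apply: f0 => //; apply/negP => h; apply: nE.
have intE : mu.-integrable (D `&` `[c, d]) (EFin \o f) by exact: integrableS intf.
apply: le_trans (le_normr_Rintegral mE intE) _.
have M0 : 0 <= M by apply: le_trans (fM 0).
have mulE : (mu (D `&` `[c, d]) <= (d - c)%:E)%E.
  apply: (@le_trans _ _ (mu `[c, d]%classic)).
    by apply: le_measure; rewrite ?inE //; exact: measurable_itv.
  rewrite lebesgue_measure_itv /= lte_fin; case: ifPn => // _.
  by rewrite lee_fin subr_ge0.
have muf : mu (D `&` `[c, d]) \is a fin_num.
  by rewrite ge0_fin_numE // (le_lt_trans mulE) // ltry.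
apply: (@le_trans _ _ (\int[mu]_(x in D `&` `[c, d]) (cst M x))).
  apply: le_Rintegral => //.
    exact: (integrable_norm intE).
  apply: measurable_bounded_integrable => //; first by rewrite (le_lt_trans mulE) // ltry.
  exact: bounded_cst.
rewrite Rintegral_cst // ler_wpM2l // -lee_fin fineK //.
Qed.

End ScalarIntegrals.

(** * Elementary tensors in the space of square-integrable functions *)

Section Tensor.
Local Open Scope quotient_scope.
Context (R : realType) (H : sepHilbertType R) (I : interval R).
Local Notation D := [set` I].
Local Notation mu := (@lebesgue_measure R).
Local Notation RT := (measurableTypeR R).
Implicit Types (phi psi : R -> R) (x y : H) (u v : L2 H I).

Let mD : measurable (D : set RT).
Proof. exact: measurable_itv. Qed.
Local Hint Resolve mD : core.

Lemma rin_piE (f g : L2fun H I) :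
  rin (\pi_(L2 H I) f) (\pi_(L2 H I) g) = \int[mu]_(t in D) rin (f t) (g t).
Proof. by have := L2innerE f g => /(congr1 (@complex.Re R)). Qed.

Lemma continuous_measurable_borel (f : R -> H) : continuous f ->
  measurable_fun D (f : RT -> borel H).
Proof.
move=> cf; apply: measurable_funB_open => // U oU; apply: measurableI => //.
by apply: open_measurable; apply: open_comp => // t _; exact: cf.
Qed.

Definition tens_fun phi x (t : R) : H := (phi t)%:C *: x.

Lemma tens_continuous phi x : continuous phi -> continuous (tens_fun phi x).
Proof.
move=> cp t; apply/inorm_cvgP => e e0.
have x1 : 0 < inorm x + 1 by have := inorm_ge0 x; lra.
have /cvgrPdist_lt/(_ _ (divr_gt0 e0 x1)) := cp t.
apply: filterS => s; rewrite /tens_fun -scalerBl -rmorphB inormZ distrC.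
rewrite ltr_pdivlMr // => h; have := normr_ge0 (phi s - phi t).
by have := inorm_ge0 x; nra.
Qed.

Lemma tens_sqint phi x : csupp phi -> tens_fun phi x \in sqint I.
Proof.
move=> cp; apply/sqintP; split.
  by apply: continuous_measurable_borel; apply: tens_continuous; case: cp.
rewrite (_ : _ \o _ = EFin \o (fun t => rin x x * (phi t * phi t))); last first.
  by apply/funext => t /=; rewrite /tens_fun rinZl rinZr; congr EFin; ring.
by apply: csupp_integrable => //; apply: csuppZ; exact: csuppM.
Qed.

Lemma tens_exists phi x : exists T : L2 H I, csupp phi ->
  exists2 F : L2fun H I, T = \pi_(L2 H I) F & F =1 tens_fun phi x.
Proof.
exists (\pi_(L2 H I) (insubd 0 (tens_fun phi x))) => cp.
exists (insubd 0 (tens_fun phi x)) => // t.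
by have := @insubdK _ _ (L2fun H I) 0 _ (tens_sqint x cp) => /(congr1 (@^~ t)).
Qed.

(* A junk value unless [csupp phi]. *)
Definition tens phi x : L2 H I := projT1 (cid (tens_exists phi x)).

Lemma tens_repr phi x : csupp phi ->
  exists2 F : L2fun H I, tens phi x = \pi_(L2 H I) F & F =1 tens_fun phi x.
Proof. exact: (projT2 (cid (tens_exists phi x))). Qed.

Lemma rin_tens phi x u : csupp phi ->
  rin u (tens phi x) = \int[mu]_(t in D) (phi t * rin (repr u t) x).
Proof.
move=> cp; have [F -> FE] := tens_repr x cp; rewrite -{1}[u]reprK rin_piE.
by apply: eq_Rintegral => t _; rewrite FE rinZr.
Qed.

Lemma integrable_tens phi x u : csupp phi ->
  mu.-integrable D (EFin \o (fun t => phi t * rin (repr u t) x)).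
Proof.
move=> cp; have [F _ FE] := tens_repr x cp.
apply: eq_integrable (Re_int (repr u) F) => // t _ /=.
by rewrite FE rinZr.
Qed.

Lemma rin_tens2 phi psi x y : csupp phi -> csupp psi ->
  rin (tens phi x) (tens psi y) = (\int[mu]_(t in D) (phi t * psi t)) * rin x y.
Proof.
move=> cp cq; have [F -> FE] := tens_repr x cp; have [G -> GE] := tens_repr y cq.
rewrite rin_piE mulrC -RintegralZl //; last first.
  by apply: csupp_integrable => //; exact: csuppM.
by apply: eq_Rintegral => t _; rewrite FE GE rinZl rinZr; ring.
Qed.

Lemma tensDr phi x y : csupp phi -> tens phi (x + y) = tens phi x + tens phi y.
Proof.
move=> cp; have [F -> FE] := tens_repr x cp; have [G -> GE] := tens_repr y cp.
have [K -> KE] := tens_repr (x + y) cp.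
rewrite [RHS]L2addE; apply/L2_eqP; apply: aeW => t _.
by rewrite L2funDE KE FE GE /tens_fun scalerDr.
Qed.

Lemma tensZr phi (a : R[i]) x : csupp phi -> tens phi (a *: x) = a *: tens phi x.
Proof.
move=> cp; have [F -> FE] := tens_repr x cp; have [G -> GE] := tens_repr (a *: x) cp.
rewrite [RHS]L2scaleE; apply/L2_eqP; apply: aeW => t _.
by rewrite L2funZE GE FE /tens_fun !scalerA mulrC.
Qed.

Lemma tensDl phi psi x : csupp phi -> csupp psi ->
  tens (fun t => phi t + psi t) x = tens phi x + tens psi x.
Proof.
move=> cp cq; have [F -> FE] := tens_repr x cp; have [G -> GE] := tens_repr x cq.
have [K -> KE] := tens_repr x (csuppD cp cq).
rewrite [RHS]L2addE; apply/L2_eqP; apply: aeW => t _.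
by rewrite L2funDE KE FE GE /tens_fun rmorphD scalerDl.
Qed.

Lemma tensZl (r : R) phi x : csupp phi ->
  tens (fun t => r * phi t) x = r%:C *: tens phi x.
Proof.
move=> cp; have [F -> FE] := tens_repr x cp; have [G -> GE] := tens_repr x (csuppZ r cp).
rewrite [RHS]L2scaleE; apply/L2_eqP; apply: aeW => t _.
by rewrite L2funZE GE FE /tens_fun rmorphM scalerA.
Qed.

Lemma inorm_tens_le phi x (M c d : R) : csupp phi -> c <= d -> 0 <= M ->
  (forall t, `|phi t| <= M) -> (forall t, t \notin `[c, d] -> phi t = 0) ->
  inorm (tens phi x) <= M * Num.sqrt (d - c) * inorm x.
Proof.
move=> cp cd M0 pM p0.
rewrite -(@ler_pXn2r _ 2) // ?nnegrE ?mulr_ge0 ?sqrtr_ge0 ?inorm_ge0 //.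
rewrite sqr_inorm rin_tens2 // !exprMn sqr_sqrtr ?subr_ge0 // -sqr_inorm.
rewrite ler_wpM2r ?sqr_ge0 //; apply: le_trans (ler_norm _) _.
apply: Rintegral_norm_le => //.
- by apply: csupp_integrable => //; exact: csuppM.
- by move=> t; rewrite normrM expr2; apply: ler_pM.
- by move=> t _ /p0 ->; rewrite mul0r.
Qed.

End Tensor.

(** * Completeness and almost everywhere convergent subsequences *)

Section L2Complete.
Local Open Scope quotient_scope.
Context (R : realType) (H : sepHilbertType R) (I : interval R).
Local Notation D := [set` I].
Local Notation mu := (@lebesgue_measure R).
Local Notation RT := (measurableTypeR R).

Let mD : measurable (D : set RT).
Proof. exact: measurable_itv. Qed.
Local Hint Resolve mD : core.

(** An open [U] is exhausted by the closed sets [V m] of points all of whose neighbours within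
    1/(m+1) are in [U]; the limit is in [U] exactly when, for some m, the sequence is eventually in
    [V m]. *)
Lemma measurable_borel_limit (E : set R) (w : nat -> R -> H) (f : R -> H) :
  measurable (E : set RT) -> (forall n, measurable_fun E (w n : RT -> borel H)) ->
  (forall t, E t -> icvg (w ^~ t) (f t)) -> measurable_fun E (f : RT -> borel H).
Proof.
move=> mE mw wf; apply: measurable_funB_open => // U oU.
pose V m := [set x : H | forall y, inorm (y - x) < m.+1%:R^-1 -> U y].
have mV m : measurable (V m : set (borel H)).
  rewrite -[V m]setCK; apply: measurableC; apply: sub_sigma_algebra.
  rewrite (_ : ~` V m = \bigcup_(y in ~` U) ball y (m.+1%:R^-1 : R)%:C).
    by apply: bigcup_open => y _; exact: ball_open.
  apply/seteqP; split=> x /=.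
    move=> /existsNP[y /not_implyP[xy Uy]]; exists y => //.
    by rewrite -ball_normE /= normr_inorm ltcR.
  move=> [y Uy]; rewrite -ball_normE /= normr_inorm ltcR => xy h.
  by apply: Uy; exact: h.
rewrite (_ : E `&` f @^-1` U =
  \bigcup_m \bigcup_N \bigcap_(n in [set n | (N <= n)%N]) (E `&` w n @^-1` V m)).
  apply: bigcupT_measurable => m; apply: bigcupT_measurable => N.
  apply: bigcap_measurable => [|n _]; first by exists N => /=.
  exact: mw.
apply/seteqP; split=> t; last first.
  move=> [m _ [N _ h]]; have [Et _] := h N (leqnn N); split=> //=.
  have m0 : 0 < m.+1%:R^-1 :> R by rewrite invr_gt0.
  have [M hM] := wf t Et _ m0.
  have [_ Vw] := h (maxn N M) (leq_maxl _ _).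
  by apply: Vw; rewrite inormC; apply: hM; exact: leq_maxr.
move=> [Et Uft]; have : nbhs (f t) U by apply: open_nbhs_nbhs.
move=> /nbhs_ballP[e /= /posC_real[e0 eE] eU].
have e2 := divr_gt0 e0 (ltr0n R 2).
have [m /(_ m (leqnn m)) hm] := natSinv_lt e2.
have m0 : 0 < m.+1%:R^-1 :> R by rewrite invr_gt0.
have [N hN] := wf t Et _ m0.
exists m => //; exists N => // n /= Nn; split=> //= y yw.
apply: eU; rewrite eE -ball_normE /= normr_inorm ltcR inormC.
apply: le_lt_trans (inorm_dist (w n t) _ _) _.
have := hN _ Nn; rewrite (splitr (Re e)) => h.
by apply: ltrD; [exact: lt_trans hm|exact: lt_trans hm].
Qed.

Lemma geom_le (q : nat -> H) (C : R) :
  (forall n, inorm (q n.+1 - q n) <= C * 2^-1 ^+ n) ->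
  forall n j, inorm (q (n + j)%N - q n) <= 2 * C * 2^-1 ^+ n.
Proof.
move=> hq n j; have C0 : 0 <= C.
  by have := le_trans (inorm_ge0 _) (hq 0%N); rewrite expr0 mulr1.
suff : inorm (q (n + j)%N - q n) <= 2 * C * (2^-1 ^+ n - 2^-1 ^+ (n + j)).
  have : 0 <= 2^-1 ^+ (n + j) :> R by rewrite exprn_ge0 // invr_ge0.
  by move: (2^-1 ^+ (n + j)) (2^-1 ^+ n) => a b; nra.
elim: j => [|j IH]; first by rewrite addn0 !subrr inorm0 mulr0.
rewrite addnS; apply: le_trans (inorm_dist (q (n + j)%N) _ _) _.
have := hq (n + j)%N; rewrite (exprS _ (n + j)).
move: (2^-1 ^+ (n + j)) (2^-1 ^+ n) IH => a b IH h; lra.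
Qed.

Lemma geom_icauchy (q : nat -> H) (C : R) :
  (forall n j, inorm (q (n + j)%N - q n) <= C * 2^-1 ^+ n) -> icauchy q.
Proof.
move=> hq e e0; have C1 : 0 < 2 * (`|C| + 1) by have := normr_ge0 C; lra.
have /cvgrPdist_lt/(_ _ (divr_gt0 e0 C1))[N _ /(_ N (leqnn N)) hN] :=
  @cvg_expr R 2^-1 (ltac:(by rewrite ger0_norm ?invr_ge0 // invf_lt1 // ltr1n)).
exists N => m n Nm Nn; apply: le_lt_trans (inorm_dist (q N) _ _) _.
have := hq N (m - N)%N; have := hq N (n - N)%N; rewrite !subnKC // => h1 h2.
have p0 : 0 <= 2^-1 ^+ N :> R by rewrite exprn_ge0 // invr_ge0.
move: hN; rewrite sub0r normrN ger0_norm // ltr_pdivlMr // => hN.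
rewrite (inormC (q N)); have := ler_norm C; move: (2^-1 ^+ N) p0 hN h1 h2 => p; nra.
Qed.

Lemma rin_sum_le (V : preHilbertType R) (u v : V) :
  rin (u + v) (u + v) <= 2 * rin u u + 2 * rin v v.
Proof.
have := Re_inner_ge0 (u - v); rewrite rinBl !rinBr !Re_innerD (Re_innerC v u).
lra.
Qed.

Lemma icauchy_subseq (V : preHilbertType R) (u : nat -> V) (s : nat -> R) :
  icauchy u -> (forall n, 0 < s n) -> exists k : nat -> nat,
  (forall n, (n <= k n)%N) /\ forall n, inorm (u (k n.+1) - u (k n)) < s n.
Proof.
move=> cu s0; have /choice[N hN] := fun n => cu _ (s0 n).
pose k := fix k n := if n is m.+1 then maxn (k m).+1 (N n) else N 0%N.
exists k; have kN n : (N n <= k n)%N by case: n => //= n; rewrite leq_maxr.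
have kS n : (k n < k n.+1)%N by rewrite /= leq_maxl.
split; first by elim=> // n IH; exact: leq_ltn_trans IH (kS n).
by move=> n; apply: hN => //; apply: leq_trans (kN n) (ltnW (kS n)).
Qed.

Lemma icvg_subseq (V : preHilbertType R) (u : nat -> V) (k : nat -> nat) l :
  icauchy u -> (forall n, (n <= k n)%N) -> icvg (u \o k) l -> icvg u l.
Proof.
move=> cu kn ukl e e0; have e2 := divr_gt0 e0 (ltr0n R 2).
have [N hN] := cu _ e2; have [M hM] := ukl _ e2.
exists (maxn N M) => n; rewrite geq_max => /andP[Nn Mn].
apply: le_lt_trans (inorm_dist (u (k n)) _ _) _.
rewrite (splitr e); apply: ltrD; last exact: hM.
by apply: hN => //; exact: leq_trans Nn (kn n).
Qed.

Lemma ge0_integral_inorm (f : L2fun H I) :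
  (\int[mu]_(t in D) (rin (f t) (f t))%:E = (inorm (\pi_(L2 H I) f) ^+ 2)%:E)%E.
Proof.
rewrite sqr_inorm rin_piE /Rintegral fineK //.
exact: integrable_fin_num (Re_int f f).
Qed.

(** The Riesz-Fischer argument. The pointwise part of the conclusion is kept because [trace_limit]
    needs it to identify a uniform limit with the limit in the mean. *)
Theorem L2_complete_ae (u : nat -> L2 H I) : icauchy u ->
  exists (l : L2 H I) (k : nat -> nat), [/\ icvg u l, forall n, (n <= k n)%N &
    {ae mu, forall t, D t -> icvg (fun n => repr (u (k n)) t) (repr l t)}].
Proof.
move=> cu; have [k [kn ks]] := icauchy_subseq cu
  (s := fun n => 4^-1 ^+ n.+1) (ltac:(by move=> n; rewrite exprn_gt0 // invr_gt0)).
pose w n : L2fun H I := repr (u (k n)).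
pose dw n : L2fun H I := w n.+1 - w n.
(* The weight 4^n is affordable, as the integral of [q n] is at most 4^n 16^-(n+1); where the sum of
   the [q n] is finite, the increments are at most C(t) 2^-n. *)
pose q n t := 4 ^+ n * rin (dw n t) (dw n t).
have q0 n t : 0 <= q n t by rewrite mulr_ge0 ?exprn_ge0 ?Re_inner_ge0.
have mrin (f : L2fun H I) : measurable_fun D (fun t => rin (f t) (f t)).
  by apply: measurable_funB_sq => //; have /sqintP[] := L2funP f.
have mq n : measurable_fun D (fun t => (q n t)%:E).
  by apply/measurable_EFinP; apply: measurable_funM => //; exact: mrin.
have intq n : (\int[mu]_(t in D) (q n t)%:E <= (4^-1 ^+ n.+2)%:E)%E.
  rewrite /q; under eq_integral do rewrite EFinM.
  rewrite ge0_integralZl_EFin ?exprn_ge0 //; first last.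
  - by apply/measurable_EFinP; exact: mrin.
  - by move=> t _; rewrite lee_fin Re_inner_ge0.
  rewrite ge0_integral_inorm -EFinM lee_fin.
  have -> : \pi_(L2 H I) (dw n) = u (k n.+1) - u (k n).
    rewrite -[u (k n.+1)]reprK -[u (k n)]reprK [- _]L2oppE [RHS]L2addE.
    by [].
  have := ltW (ks n); set a := inorm _ => h.
  have h2 : a ^+ 2 <= (4^-1 ^+ n.+1) ^+ 2.
    by rewrite ler_pXn2r // nnegrE ?inorm_ge0 // exprn_ge0 // invr_ge0.
  have -> : 4^-1 ^+ n.+2 = 4 ^+ n * (4^-1 ^+ n.+1) ^+ 2 :> R.
    rewrite !exprS exprVn; have : (4 : R) ^+ n != 0 by rewrite expf_neq0.
    by move: (4 ^+ n) => z z0; field.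
  by rewrite ler_wpM2l // exprn_ge0.
pose h t := (\sum_(n <oo) (q n t)%:E)%E.
have h0 t : (0 <= h t)%E by apply: nneseries_ge0 => n _ _; rewrite lee_fin.
have mh : measurable_fun D h.
  by apply: ge0_emeasurable_sum => [n t _ _|n _]; rewrite ?lee_fin.
have inth : (\int[mu]_(t in D) h t <= 1)%E.
  rewrite integral_nneseries //; last by move=> n t _; rewrite lee_fin.
  apply: (@le_trans _ _ (\sum_(n <oo) (4^-1 ^+ n.+2 : R)%:E)%E).
    apply: lee_nneseries => [n _ _|n _]; last exact: intq.
    by apply: integral_ge0 => t _; rewrite lee_fin.
  apply: lime_le; first by apply: is_cvg_nneseries => n _ _;
    rewrite lee_fin exprn_ge0 // invr_ge0.
  apply: nearW => n; rewrite sumEFin lee_fin big_mkord.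
  suff : \sum_(i < n) 4^-1 ^+ i.+2 = (1 - 4^-1 ^+ n) / 12 :> R.
    move=> ->; have : 0 <= 4^-1 ^+ n :> R by rewrite exprn_ge0 // invr_ge0.
    by move: (4^-1 ^+ n) => z; lra.
  elim: n => [|n IH]; first by rewrite big_ord0 expr0 subrr mul0r.
  by rewrite big_ord_recr /= IH !exprS; move: (4^-1 ^+ n) => z; field.
have ih : mu.-integrable D h.
  apply/integrableP; split => //.
  under eq_integral do rewrite gee0_abs //.
  by apply: le_lt_trans inth _; rewrite ltry.
have [N1 [mN1 muN1 hN1]] := integrable_ae mD ih.
pose E := D `\` N1.
have mE : measurable (E : set RT) by exact: measurableD.
have Efin t : E t -> h t \is a fin_num.
  move=> [Dt Nt]; apply: contrapT => hf; apply: Nt; apply: hN1 => /=.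
  by move=> /(_ Dt).
pose C t := Num.sqrt (fine (h t)).
have dwC t n : E t -> inorm (w n.+1 t - w n t) <= C t * 2^-1 ^+ n.
  move=> Et; have qh : q n t <= fine (h t).
    rewrite -lee_fin fineK; last exact: Efin.
    apply: le_trans (nneseries_lim_ge n.+1 (P := xpredT) _); last first.
      by move=> m _ _; rewrite lee_fin.
    rewrite big_mkord big_ord_recr /= leeDr // sume_ge0 // => i _.
    by rewrite lee_fin.
  have f0 : 0 <= fine (h t) by rewrite fine_ge0.
  rewrite -(@ler_pXn2r _ 2) // ?nnegrE ?inorm_ge0 //; last first.
    by rewrite mulr_ge0 ?sqrtr_ge0 // exprn_ge0 // invr_ge0.
  rewrite sqr_inorm exprMn sqr_sqrtr //.
  have -> : (2^-1 ^+ n) ^+ 2 = (4 ^+ n)^-1 :> R.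
    by rewrite -exprM mulnC exprM -exprVn; congr (_ ^+ _); field.
  by rewrite ler_pdivlMr ?exprn_gt0 // mulrC; exact: qh.
have gl t n j : E t -> inorm (w (n + j)%N t - w n t) <= 2 * C t * 2^-1 ^+ n.
  by move=> Et; apply: (geom_le (q := w ^~ t)) => m; exact: dwC.
have /choice[f hf] : forall t, exists l, E t -> icvg (w ^~ t) l.
  move=> t; have [Et|nE] := pselect (E t); last by exists 0.
  have [l hl] : exists l, icvg (w ^~ t) l.
    by apply: hilbert_complete; apply: geom_icauchy => n j; exact: gl.
  by exists l.
(* The value 0 on the null part of [D] outside [E] keeps [W] measurable on all of [D]. *)
pose W t := if t \in E then f t else 0.
have WE t : E t -> W t = f t by move=> Et; rewrite /W mem_set.
have wW t : E t -> icvg (w ^~ t) (W t) by move=> Et; rewrite WE //; exact: hf.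
have Wle t n : E t -> inorm (W t - w n t) <= 2 * C t * 2^-1 ^+ n.
  move=> Et; apply: (icvg_le (wW t Et) (N := n)) => m nm.
  by have := gl t n (m - n)%N Et; rewrite subnKC.
have DE : D = E `|` (D `&` N1) by rewrite /E setUC setUIDK.
have mW : measurable_fun D (W : RT -> borel H).
  rewrite DE; apply/measurable_funU => //; first exact: measurableI.
  split; last first.
    have m0 : measurable_fun (D `&` N1) ((fun=> 0 : H) : RT -> borel H).
      exact: (@measurable_cst _ _ RT (borel H)).
    apply: eq_measurable_fun m0 => t; rewrite inE => -[_ Nt].
    by rewrite /W memNset // => -[].
  apply: (@measurable_borel_limit E (fun n => w n : R -> H) W) => // n.
  apply: (@measurable_funS _ _ _ _ D) => //; first exact: subDsetl.
  by have /sqintP[] := L2funP (w n).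
have aeE (P : R -> Prop) : (forall t, E t -> P t) -> {ae mu, forall t, D t -> P t}.
  move=> hP; exists N1; split => // t /= /not_implyP[Dt nP].
  by apply: contrapT => Nt; apply: nP; apply: hP; split.
(* The integrable function [h] dominates the squared error; integrating gives both the square
   integrability of [W] (at n = 0) and the convergence in the mean. *)
have Wle2 t n : E t -> ((rin (W t - w n t) (W t - w n t))%:E <=
    (4 * (4^-1 ^+ n))%:E * h t)%E.
  move=> Et; rewrite -[h t]fineK ?Efin // -EFinM lee_fin -sqr_inorm.
  apply: (@le_trans _ _ ((2 * C t * 2^-1 ^+ n) ^+ 2)).
    rewrite ler_pXn2r ?nnegrE ?inorm_ge0 //; first exact: Wle.
    by rewrite !mulr_ge0 ?sqrtr_ge0 // exprn_ge0 // invr_ge0.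
  rewrite !exprMn sqr_sqrtr ?fine_ge0 //.
  have -> : (2^-1 ^+ n) ^+ 2 = 4^-1 ^+ n :> R.
    by rewrite -exprM mulnC exprM; congr (_ ^+ _); field.
  by rewrite le_eqVlt; apply/orP; left; apply/eqP; move: (4^-1 ^+ n) => z; ring.
have mWw n : measurable_fun D (fun t => (rin (W t - w n t) (W t - w n t))%:E).
  apply/measurable_EFinP; apply: measurable_funB_sq => //.
  apply: (@measurable_funBD _ _ _ _ _ W (fun t => - w n t)) => //.
  have -> : (fun t => - w n t) = (fun t => (-1) *: w n t).
    by apply/funext => t; rewrite scaleN1r.
  by apply: measurable_funBZ => //; have /sqintP[] := L2funP (w n).
have intWw n : (\int[mu]_(t in D) (rin (W t - w n t) (W t - w n t))%:E <=
    (4 * 4^-1 ^+ n)%:E)%E.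
  have p0 : 0 <= 4 * 4^-1 ^+ n :> R by rewrite mulr_ge0 // exprn_ge0 // invr_ge0.
  apply: (@le_trans _ _ (\int[mu]_(t in D) ((4 * 4^-1 ^+ n)%:E * h t))%E).
    apply: ae_ge0_le_integral => //.
    - by move=> t _; rewrite lee_fin Re_inner_ge0.
    - exact: mWw.
    - by move=> t _; rewrite mule_ge0.
    - exact: measurable_funeM.
    - by apply: aeE => t Et; exact: Wle2.
  rewrite ge0_integralZl_EFin // -[leRHS]mule1.
  by apply: lee_wpmul2l; first by rewrite lee_fin.
have sW : W \in sqint I.
  rewrite inE; split=> //.
  apply: (@le_lt_trans _ _ (\int[mu]_(t in D)
    (2%:E * (rin (W t - w 0%N t) (W t - w 0%N t))%:E +
     2%:E * (rin (w 0%N t) (w 0%N t))%:E))%E).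
    apply: ge0_le_integral => //.
    - by move=> t _; rewrite lee_fin Re_inner_ge0.
    - by apply/measurable_EFinP; exact: measurable_funB_sq.
    - apply: emeasurable_funD; apply: measurable_funeM; first exact: mWw.
      by apply/measurable_EFinP; exact: mrin.
    - move=> t _; rewrite -!EFinM -EFinD lee_fin -{1 2}[W t](subrK (w 0%N t)).
      exact: rin_sum_le.
  rewrite ge0_integralD //; first last.
  - by apply: measurable_funeM; apply/measurable_EFinP; exact: mrin.
  - by move=> t _; rewrite -EFinM lee_fin mulr_ge0 // Re_inner_ge0.
  - by apply: measurable_funeM; exact: mWw.
  - by move=> t _; rewrite -EFinM lee_fin mulr_ge0 // Re_inner_ge0.
  rewrite !ge0_integralZl_EFin //; first last.
  - exact: mWw.
  - by move=> t _; rewrite lee_fin Re_inner_ge0.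
  - by apply/measurable_EFinP; exact: mrin.
  - by move=> t _; rewrite lee_fin Re_inner_ge0.
  rewrite ge0_integral_inorm; apply: lte_add_pinfty; last by rewrite -EFinM ltry.
  apply: (@le_lt_trans _ _ (2%:E * (4 * 4^-1 ^+ 0)%:E)%E).
    by apply: lee_wpmul2l => //; exact: intWw.
  by rewrite -EFinM ltry.
pose WL : L2fun H I := L2Fun sW.
have cvk : icvg (u \o k) (\pi_(L2 H I) WL).
  have hn n : inorm (u (k n) - \pi_(L2 H I) WL) <= 2 * 2^-1 ^+ n.
    rewrite inormC -(@ler_pXn2r _ 2) // ?nnegrE ?inorm_ge0 //.
    have -> : \pi_(L2 H I) WL - u (k n) = \pi_(L2 H I) (WL - w n).
      by rewrite -[u (k n)]reprK [- _]L2oppE [LHS]L2addE.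
    rewrite -lee_fin -ge0_integral_inorm exprMn.
    have -> : (2^-1 ^+ n) ^+ 2 = 4^-1 ^+ n :> R.
      by rewrite -exprM mulnC exprM; congr (_ ^+ _); field.
    have -> : 2 ^+ 2 = 4 :> R by ring.
    exact: intWw.
  move=> e e0; have e2 := divr_gt0 e0 (ltr0n R 2).
  have /cvgrPdist_lt/(_ _ e2)[N _ hN] :=
    @cvg_expr R 2^-1 (ltac:(by rewrite ger0_norm ?invr_ge0 // invf_lt1 // ltr1n)).
  exists N => n /hN; rewrite sub0r normrN ger0_norm ?exprn_ge0 ?invr_ge0 // => h'.
  by have := hn n; rewrite /comp; move: (2^-1 ^+ n) h' => z; lra.
exists (\pi_(L2 H I) WL), k; split => //; first exact: icvg_subseq cvk.
have aw := aeE _ wW; have ae_filter := ae_filter_ringOfSetsType mu.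
apply: filterS2 aw (repr_ae WL) => t h1 h2 Dt.
by rewrite h2 //; exact: h1.
Qed.

Lemma L2_complete : icomplete (L2 H I).
Proof. by move=> u /L2_complete_ae[l [k [ul _ _]]]; exists l. Qed.

End L2Complete.

(** * One-variable calculus *)

Section RealAnalysis.
Context (R : realType).
Local Notation mu := (@lebesgue_measure R).
Local Notation RT := (measurableTypeR R).
Implicit Types (f k : R -> R) (D : set R).

Lemma is_derive_quadratic f (t d C : R) :
  (forall h, `|h| <= 1 -> `|f (t + h) - f t - h * d| <= C * h ^+ 2) ->
  is_derive t 1 f d.
Proof.
move=> hf.
have lim : h^-1 *: ((f \o shift t) (h *: 1) - f t) @[h --> 0^'] --> d.
  apply/cvgrPdist_le => /= e e0.
  have C1 : 0 < `|C| + 1 by have := normr_ge0 C; lra.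
  near=> h.
  have h0 : h != 0 by near: h; exact: nbhs_dnbhs_neq.
  have he : `|h| < e / (`|C| + 1).
    by near: h; apply: dnbhs0_lt; rewrite divr_gt0.
  have h1 : `|h| <= 1 by near: h; exact: dnbhs0_le.
  have hp : 0 < `|h| by rewrite normr_gt0.
  have := hf h h1; rewrite /GRing.scale /= mulr1 (addrC h).
  have -> : d - h^-1 * (f (t + h) - f t) = - h^-1 * (f (t + h) - f t - h * d).
    by field.
  rewrite normrM normrN normfV ler_pdivrMl // -(real_normK (num_real h)).
  move: he; rewrite ltr_pdivlMr // => he /le_trans; apply.
  by have := ler_norm C; nra.
by apply: DeriveDef; [apply/cvg_ex; exists d|apply: cvg_lim].
Unshelve. all: by end_near. Qed.

Lemma mvt_between f (x y : R) : smooth f ->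
  exists2 xi, `|xi - x| <= `|y - x| & f y - f x = derive1 f xi * (y - x).
Proof.
move=> sf; have df := smooth_is_derive sf; have cf := smooth_continuous sf.
have [xy|yx|<-] := ltgtP x y; last by exists x; rewrite ?subrr ?mulr0.
  have [c] := MVT xy (fun z _ => df z) (continuous_subspaceT cf).
  rewrite in_itv /= => /andP[xc cy] e; exists c => //.
  by rewrite !ger0_norm ?subr_ge0 ?ltW //; lra.
have [c] := MVT yx (fun z _ => df z) (continuous_subspaceT cf).
rewrite in_itv /= => /andP[xc cy] e; exists c.
  by rewrite !ler0_norm ?subr_le0 ?ltW //; lra.
by rewrite -opprB e -mulrN opprB.
Qed.

(** Two applications of the mean value theorem, which give the constant M instead of M / 2. *)
Lemma taylor1 k (M r h : R) : smooth k ->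
  (forall x, `|derive1 (derive1 k) x| <= M) ->
  `|k (r + h) - k r - h * derive1 k r| <= M * h ^+ 2.
Proof.
move=> sk kM; have [xi] := mvt_between r (r + h) sk.
rewrite (addrC r) addrK => xih ->; rewrite mulrC -mulrBr normrM.
have [eta _ ->] := mvt_between r xi (smooth_derive1 sk).
rewrite normrM -(real_normK (num_real h)) expr2 mulrCA.
have M0 := le_trans (normr_ge0 _) (kM 0).
by rewrite ler_pM // ler_wpM2l.
Qed.

Lemma Rintegral_derive1 D f (c d : R) : measurable (D : set RT) -> smooth f ->
  c < d -> (forall x, x \notin `[c, d] -> derive1 f x = 0) ->
  `[c, d] `<=` D -> \int[mu]_(t in D) derive1 f t = f d - f c.
Proof.
move=> mD sf cd f0 cdD.
rewrite (@Rintegral_restrict _ D `[c, d]%classic) //; last first.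
  by move=> x _ xcd; apply: f0; apply/negP.
have cf := smooth_continuous sf.
rewrite /Rintegral (@continuous_FTC2 _ _ f) //.
- by apply: continuous_subspaceT; apply: smooth_continuous; exact: smooth_derive1.
- split; first by move=> x _; exact: (sf 0%N).
    by apply: cvg_at_right_filter; exact: cf.
  by apply: cvg_at_left_filter; exact: cf.
Qed.

End RealAnalysis.

(** * The maximal operator *)

Section MaximalOperator.
Local Open Scope quotient_scope.
Context (R : realType) (H : sepHilbertType R) (I : interval R).
Local Notation D := [set` I].
Local Notation mu := (@lebesgue_measure R).
Local Notation RT := (measurableTypeR R).
Implicit Types (u v g : L2 H I) (f : R -> H) (phi psi : R -> R) (x y : H).

Let mD : measurable (D : set RT).
Proof. exact: measurable_itv. Qed.
Local Hint Resolve mD : core.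

Lemma ae_imply2 (P Q S : R -> Prop) : (forall t, P t -> Q t -> S t) ->
  {ae mu, forall t, P t} -> {ae mu, forall t, Q t} -> {ae mu, forall t, S t}.
Proof.
move=> h; exact: (@filterS2 _ _ (ae_filter_ringOfSetsType mu) P Q S h).
Qed.

Lemma ae_imply (P S : R -> Prop) : (forall t, P t -> S t) ->
  {ae mu, forall t, P t} -> {ae mu, forall t, S t}.
Proof. by move=> h hP; exact: (ae_imply2 (fun t Pt _ => h t Pt) hP hP). Qed.

Lemma represents_pi (F : L2fun H I) f : F =1 f -> represents (\pi_(L2 H I) F) f.
Proof.
by move=> Ff; apply: ae_imply (repr_ae F) => t h It; rewrite -Ff; exact: h.
Qed.

Lemma represents_eq u v f : represents u f -> represents v f -> u = v.
Proof.
move=> uf vf; rewrite -[u]reprK -[v]reprK; apply/L2_eqP.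
by apply: ae_imply2 uf vf => t h1 h2 It; rewrite h1 // h2.
Qed.

Lemma represents_ext u f f' : (forall t, D t -> f t = f' t) ->
  represents u f -> represents u f'.
Proof. by move=> ff; apply: ae_imply => t h It; rewrite h //; exact: ff. Qed.

Lemma representsD u v f f' : represents u f -> represents v f' ->
  represents (u + v) (fun t => f t + f' t).
Proof.
move=> uf vf; rewrite -[u]reprK -[v]reprK [_ + _]L2addE.
apply: ae_imply2 (repr_ae (repr u + repr v)) (ae_imply2 (fun _ => @conj _ _) uf vf).
by move=> t h [h1 h2] It; rewrite h // L2funDE h1 // h2.
Qed.

Lemma representsZ (a : R[i]) u f : represents u f ->
  represents (a *: u) (fun t => a *: f t).
Proof.
move=> uf; rewrite -[u]reprK [_ *: _]L2scaleE.
apply: ae_imply2 (repr_ae (a *: repr u)) uf => t h h1 It.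
by rewrite h // L2funZE h1.
Qed.

Lemma represents0 : represents (0 : L2 H I) (fun=> 0).
Proof. exact: (@represents_pi 0). Qed.

Lemma represents_sum n (u : 'I_n -> L2 H I) (f : 'I_n -> R -> H) :
  (forall k, represents (u k) (f k)) ->
  represents (\sum_(k < n) u k) (fun t => \sum_(k < n) f k t).
Proof.
elim: n u f => [|n IH] u f uf.
  rewrite big_ord0; apply: represents_ext represents0 => t _.
  by rewrite big_ord0.
rewrite big_ord_recr /=.
have IH' := IH _ _ (fun k => uf (widen_ord (leqnSn n) k)).
apply: represents_ext (representsD IH' (uf ord_max)) => t _.
by rewrite big_ord_recr.
Qed.

Lemma represents_tens phi x : csupp phi -> represents (tens I phi x) (tens_fun phi x).
Proof. by move=> cp; have [F -> FE] := tens_repr I x cp; exact: represents_pi. Qed.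

(** The real-valued form of [test_function], with the compact support replaced by an enclosing
    segment. Real scalars are enough because a factor ['i] can be moved into the vector of a
    tensor. *)
Definition testfn phi := smooth phi /\ exists c d : R,
  (forall t, t \notin `[c, d] -> phi t = 0) /\ `[c, d] `<=` D.

Lemma testfn_csupp phi : testfn phi -> csupp phi.
Proof. by move=> [sp [c [d [p0 _]]]]; exact: csupp_smooth p0. Qed.

Lemma testfn_derive1 phi : testfn phi -> testfn (derive1 phi).
Proof.
move=> [sp [c [d [p0 cdD]]]]; split; first exact: smooth_derive1.
by exists c, d; split => //; exact: derive1_out.
Qed.

Lemma testfn_test phi : testfn phi -> test_function I (fun t => (phi t)%:C).
Proof. by move=> [sp [c [d [p0 cdD]]]]; exact: test_function_real p0 cdD. Qed.

Lemma test_function_testfn (phi : R -> R[i]) : test_function I phi ->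
  testfn (Re \o phi) /\ testfn (Im \o phi).
Proof.
move=> [sr si cK KD]; set K := closure _ in cK KD.
suff [c [d [K0 cdD]]] : exists c d : R, (forall t, t \notin `[c, d] -> phi t = 0) /\
    `[c, d] `<=` D.
  by split; split => //; exists c, d; split => // t /K0 /= ->.
have phiK t : ~ K t -> phi t = 0.
  by move=> nK; apply/eqP; apply: contraT => p0; exfalso; apply: nK; exact: subset_closure.
have [K0|K0] := eqVneq K set0.
  (* An empty support has no extreme points; the empty segment from 1 to 0 encloses it. *)
  exists 1, 0; split=> [t _|t]; first by apply: phiK; rewrite K0.
  by rewrite /= in_itv /= => /andP[]; lra.
have K0' : K !=set0 by exact/set0P.
have cid : {within K, continuous (id : R -> R)}.
  by apply: continuous_subspaceT => t; exact: cvg_id.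
have [c Kc cK'] := compact_EVT_min K0' cK cid.
have [d Kd dK'] := compact_EVT_max K0' cK cid.
exists c, d; split=> t.
  move=> tcd; apply: phiK => Kt; move/negP: tcd; apply.
  by rewrite in_itv /= cK' ?dK' // inE.
rewrite /= in_itv /= => tcd; apply: (interval_is_interval (i := I)) tcd.
  by apply: KD; exact: set_mem.
by apply: KD; exact: set_mem.
Qed.

Definition tens_op phi x y : L2 H I := 'i *: tens I (derive1 phi) x + tens I phi y.

Lemma L_test_tens (A : set (H * H)) phi x y : testfn phi -> A (x, y) ->
  L_test A I (tens I phi x, tens_op phi x y).
Proof.
move=> tp Axy; have cp := testfn_csupp tp.
have cp' := testfn_csupp (testfn_derive1 tp).
exists 1%N, (fun _ t => (phi t)%:C), (fun=> x), (fun=> y); split=> // [k||] /=.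
- exact: testfn_test.
- by apply: represents_ext (represents_tens x cp) => t _; rewrite big_ord1.
- apply: represents_ext (representsD (representsZ 'i (represents_tens x cp'))
    (represents_tens y cp)) => t _.
  by rewrite !big_ord1 cderive_real.
Qed.

(** Passing to the closure does not change the adjoint, and phi x = (Re phi) x + (Im phi) (i x) with
    A (i x) = i A x. So the weak equation need only be tested on single tensors with real [phi]. *)
Lemma L_maxP (A : set (H * H)) u g : selfadjoint A ->
  (L_max A I (u, g) <-> forall phi x y, testfn phi -> A (x, y) ->
    inner u (tens_op phi x y) = inner g (tens I phi x)).
Proof.
move=> sA; rewrite /L_max /L_min op_adjoint_closure; split.
  by move=> h phi x y tp Axy; exact: (h _ (L_test_tens tp Axy)).
move=> h [p q] /= [n [phi [x [y [tphi Axy rp rq]]]]].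
have tr k := (test_function_testfn (tphi k)).1.
have ti k := (test_function_testfn (tphi k)).2.
have e1 : p = \sum_(k < n) (tens I (Re \o phi k) (x k) +
                            tens I (Im \o phi k) ('i *: x k)).
  apply: represents_eq rp _; apply: represents_ext; last first.
    apply: represents_sum => k; apply: representsD;
      by apply: represents_tens; exact: testfn_csupp.
  move=> t _ /=; apply: eq_bigr => k _; rewrite /tens_fun /= scalerA -scalerDl.
  by congr (_ *: _); case: (phi k t) => a b /=; apply/eqP; rewrite eq_complex /=;
    apply/andP; split; apply/eqP; ring.
have e2 : q = \sum_(k < n) (tens_op (Re \o phi k) (x k) (y k) +
                            tens_op (Im \o phi k) ('i *: x k) ('i *: y k)).
  apply: represents_eq rq _; apply: represents_ext; last first.
    apply: represents_sum => k; apply: representsD; apply: representsD;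
      try apply: representsZ; apply: represents_tens; apply: testfn_csupp => //;
      exact: testfn_derive1.
  move=> t _ /=; rewrite scaler_sumr -big_split /=; apply: eq_bigr => k _.
  rewrite /tens_fun /= /cderive addrACA -scalerDr; congr (_ + _).
    rewrite scalerA -scalerDl; congr (_ *: (_ *: _)).
    by apply/eqP; rewrite eq_complex /=; apply/andP; split; apply/eqP; ring.
  rewrite scalerA -scalerDl; congr (_ *: _).
  by case: (phi k t) => a b /=; apply/eqP; rewrite eq_complex /=;
    apply/andP; split; apply/eqP; ring.
have inner_sum (w : L2 H I) (F : 'I_n -> L2 H I) :
    inner w (\sum_(k < n) F k) = \sum_(k < n) inner w (F k).
  by apply: (big_morph (inner w) (innerDr w)); rewrite innerE !(rin0r, scaler0).
rewrite e1 e2 !inner_sum; apply: eq_bigr => k _.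
rewrite (innerDr u) (innerDr g) (h _ _ _ (tr k) (Axy k)).
by rewrite (h _ _ _ (ti k) (saZ sA 'i (Axy k))).
Qed.

Lemma inner_tens2 phi psi x y : csupp phi -> csupp psi ->
  inner (tens I phi x) (tens I psi y) = (\int[mu]_(t in D) (phi t * psi t))%:C * inner x y.
Proof.
move=> cp cq; have e1 := rin_tens2 I x y cp cq.
have := rin_tens2 I x ('i *: y) cp cq; rewrite (tensZr _ _ _ cq) => e2.
rewrite (innerE (tens I phi x)) e1 e2 (innerE x y).
by apply/eqP; rewrite eq_complex /=; apply/andP; split; apply/eqP; ring.
Qed.

Lemma Rintegral_by_parts phi psi : testfn phi -> testfn psi ->
  \int[mu]_(t in D) (phi t * derive1 psi t) =
  - \int[mu]_(t in D) (derive1 phi t * psi t).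
Proof.
move=> tp tq; have [sp [c [d [p0 cdD]]]] := tp; have [sq _] := tq.
have cp := testfn_csupp tp; have cq := testfn_csupp tq.
have cp' := testfn_csupp (testfn_derive1 tp).
have cq' := testfn_csupp (testfn_derive1 tq).
pose f t := phi t * psi t; have sf : smooth f by exact: smoothM.
have f'E : derive1 f = fun t => phi t * derive1 psi t + derive1 phi t * psi t.
  apply: derive1_val => t.
  have h := is_deriveM (smooth_is_derive sp t) (smooth_is_derive sq t).
  by apply: is_derive_eq h _; rewrite /GRing.scale /= [psi t * _]mulrC.
apply/eqP; rewrite -subr_eq0 opprK -RintegralD //; last 2 first.
- by apply: csupp_integrable => //; exact: csuppM.
- by apply: csupp_integrable => //; exact: csuppM.
rewrite -f'E.
have f'0 t : t \notin `[c, d] -> derive1 f t = 0.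
  by apply: derive1_out => // s sn; rewrite /f p0 // mul0r.
(* [phi] is only known to vanish outside the segment, not at [c] and [d], and the segment may be
   degenerate. The larger segment may leave [D], which is harmless since the derivative vanishes
   outside the smaller one. *)
pose c' := Num.min c d - 1; pose d' := Num.max c d + 1.
have [cc dd cd' dc'] : [/\ c' < c, d < d', c' < d & c < d'].
  rewrite /c' /d'; have [a1 a2] : Num.min c d <= c /\ Num.min c d <= d.
    by split; rewrite ge_min lexx ?orbT.
  have [b1 b2] : c <= Num.max c d /\ d <= Num.max c d.
    by split; rewrite le_max lexx ?orbT.
  split; lra.
have fc : f c' = 0 by rewrite /f p0 ?mul0r // in_itv /= negb_and -ltNge cc.
have fd : f d' = 0 by rewrite /f p0 ?mul0r // in_itv /= negb_and -!ltNge dd orbT.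
have mI : measurable (`[c, d]%classic : set RT) by exact: measurable_itv.
have mI' : measurable (`[c', d']%classic : set RT) by exact: measurable_itv.
rewrite (@Rintegral_restrict _ D `[c, d]%classic) //; last first.
  by move=> t _ /negP; exact: f'0.
rewrite -(@Rintegral_restrict _ `[c', d']%classic `[c, d]%classic) //; first last.
- by move=> t _ /negP; exact: f'0.
- by apply: subset_itv; rewrite bnd_simp ltW.
rewrite (@Rintegral_derive1 _ _ _ c' d') ?fc ?fd ?subrr //.
- exact: lt_trans cd' dd.
- move=> t tn; apply: f'0; apply: contra tn; rewrite !in_itv /= => /andP[a b].
  by rewrite (le_trans (ltW cc)) // (le_trans b) // ltW.
Qed.

(** Integration by parts and the symmetry of [A]: the minimal operator is symmetric. This is what
    supplies concrete elements of the domain of the extension. *)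
Lemma L_max_tens (A : set (H * H)) phi x y : selfadjoint A -> testfn phi -> A (x, y) ->
  L_max A I (tens I phi x, tens_op phi x y).
Proof.
move=> sA tp Axy; apply/L_maxP => // psi x' y' tq Axy'.
have cp := testfn_csupp tp; have cq := testfn_csupp tq.
have cp' := testfn_csupp (testfn_derive1 tp).
have cq' := testfn_csupp (testfn_derive1 tq).
rewrite innerDl innerDr innerZl innerZr !inner_tens2 // (sa_sym sA Axy Axy').
rewrite Rintegral_by_parts // rmorphN conjE; congr (_ + _).
by apply/eqP; rewrite eq_complex; case: (inner x x') => a b /=; apply/andP; split;
  apply/eqP; ring.
Qed.

End MaximalOperator.

(** * Averages in time and their evolution *)

Section Average.
Local Open Scope quotient_scope.
Context (R : realType) (H : sepHilbertType R) (I : interval R).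
Local Notation D := [set` I].
Local Notation mu := (@lebesgue_measure R).
Local Notation RT := (measurableTypeR R).
Implicit Types (u g : L2 H I) (phi psi k : R -> R) (x y : H).

Let mD : measurable (D : set RT).
Proof. exact: measurable_itv. Qed.
Local Hint Resolve mD : core.

(** The functional x |-> Re (u, phi x) is bounded by |u| times the mean-square norm of [phi], so
    Riesz's theorem applies. The condition on [phi] is put under the existential quantifier to make
    [avg] total. *)
Lemma avg_exists phi u : exists v : H,
  csupp phi -> forall x, rin v x = rin u (tens I phi x).
Proof.
have [cp|ncp] := pselect (csupp phi); last by exists 0 => /ncp.
pose s := Num.sqrt (\int[mu]_(t in D) (phi t * phi t)).
have tn z : inorm (tens I phi z) = s * inorm z.
  have i0 : 0 <= \int[mu]_(t in D) (phi t * phi t).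
    by apply: Rintegral_ge0 => t _; rewrite -expr2 sqr_ge0.
  rewrite /inorm rin_tens2 // sqrtrM //.
suff [v hv] : exists v : H, forall x, rin v x = rin u (tens I phi x) by exists v.
apply: (@riesz _ _ _ (inorm u * s)); first exact: hilbert_complete.
- by move=> a b; rewrite tensDr // rinDr.
- by move=> r a; rewrite tensZr // rinZr.
- by move=> a; rewrite -mulrA -tn; exact: rin_CS_abs.
Qed.

(* The weak integral [\int phi u]. *)
Definition avg phi u : H := projT1 (cid (avg_exists phi u)).

Lemma avgE phi u x : csupp phi -> rin (avg phi u) x = rin u (tens I phi x).
Proof. by move=> cp; exact: (projT2 (cid (avg_exists phi u)) cp). Qed.

Lemma inner_avg phi u x : csupp phi -> inner (avg phi u) x = inner u (tens I phi x).
Proof.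
move=> cp; apply: inner_rinP; first exact: avgE.
by rewrite (avgE _ _ cp) (tensZr _ _ _ cp).
Qed.

Lemma avgDl phi psi u : csupp phi -> csupp psi ->
  avg (fun t => phi t + psi t) u = avg phi u + avg psi u.
Proof.
move=> cp cq; apply: rin_ext => x.
have e := avgE u x (csuppD cp cq); rewrite (tensDl I x cp cq) in e.
apply: (etrans e); apply: (etrans (rinDr _ _ _)).
apply: (etrans _ (esym (rinDl _ _ _))).
exact: (congr2 +%R (esym (avgE u x cp)) (esym (avgE u x cq))).
Qed.

Lemma avgZl (r : R) phi u : csupp phi -> avg (fun t => r * phi t) u = r%:C *: avg phi u.
Proof.
move=> cp; apply: rin_ext => x.
have e := avgE u x (csuppZ r cp); rewrite (tensZl I r x cp) in e.
apply: (etrans e); apply: (etrans (rinZr _ _ _)).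
apply: (etrans _ (esym (rinZl _ _ _))).
exact: (congr1 ( *%R r) (esym (avgE u x cp))).
Qed.

Lemma avgZr (a : R[i]) phi u : csupp phi -> avg phi (a *: u) = a *: avg phi u.
Proof.
move=> cp; apply: rin_ext => x; apply: (etrans (avgE _ _ cp)); congr Re.
apply: (etrans (innerZl _ _ _)); apply: (etrans _ (esym (innerZl _ _ _))).
exact: (congr1 ( *%R a) (esym (inner_avg u x cp))).
Qed.

Lemma inorm_avg_le phi u (M c d : R) : csupp phi -> c <= d -> 0 <= M ->
  (forall t, `|phi t| <= M) -> (forall t, t \notin `[c, d] -> phi t = 0) ->
  inorm (avg phi u) <= inorm u * (M * Num.sqrt (d - c)).
Proof.
move=> cp cd M0 pM p0; set v := avg phi u.
have [v0|vn0] := eqVneq (inorm v) 0.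
  by rewrite v0 !mulr_ge0 ?inorm_ge0 // sqrtr_ge0.
have vp : 0 < inorm v by rewrite lt_neqAle eq_sym vn0 inorm_ge0.
have e : inorm v * inorm v = rin u (tens I phi v).
  by rewrite -expr2 sqr_inorm; exact: (avgE u v cp).
rewrite -(ler_pM2r vp) e -mulrA; apply: le_trans (rin_CS _ _) _; rewrite ler_wpM2l ?inorm_ge0 //.
exact: inorm_tens_le.
Qed.

Lemma rin_avg_int phi u x : csupp phi ->
  rin (avg phi u) x = \int[mu]_(t in D) (phi t * rin (repr u t) x).
Proof. by move=> cp; apply: (etrans (avgE u x cp)); exact: rin_tens. Qed.

Section Evolution.
Variable A : set (H * H).
Hypothesis sA : selfadjoint A.

(** For y = A x, the weak equation computes the pairing of the average with [y] as the pairing of a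
    fixed vector with [x]. As [A] is its own adjoint, the average is in the domain and that vector
    is its image. *)
Lemma avg_graph u g phi : L_max A I (u, g) -> testfn I phi ->
  A (avg phi u, avg phi g + 'i *: avg (derive1 phi) u).
Proof.
move=> /(L_maxP _ _ sA) ug tp; have cp := testfn_csupp tp.
have cp' := testfn_csupp (testfn_derive1 tp).
apply: (sa_max sA) => x y Axy.
have e : Num.conj 'i * inner (avg (derive1 phi) u) x + inner (avg phi u) y =
    inner (avg phi g) x.
  apply: (etrans (congr2 +%R (congr1 ( *%R _) (inner_avg u x cp')) (inner_avg u y cp))).
  apply: (etrans _ (esym (inner_avg g x cp))).
  apply: (etrans _ (ug _ _ _ tp Axy)).
  apply: (etrans _ (esym (innerDr _ _ _))).
  exact: (congr2 +%R (esym (innerZr _ _ _)) erefl).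
rewrite innerDl innerZl -e conjE.
move: (inner (avg phi u) y) (inner _ x) => [p q] [p' q'].
by apply/eqP; rewrite eq_complex /=; apply/andP; split; apply/eqP; ring.
Qed.

(* The [A]-term drops out because [inner (A v) v] is real. *)
Lemma rin_avg_derive1 u g phi : L_max A I (u, g) -> testfn I phi ->
  rin (avg (derive1 phi) u) (avg phi u) = rin ('i *: avg phi g) (avg phi u).
Proof.
move=> ug tp; have h := avg_graph ug tp; have := sa_sym sA h h.
set v := avg phi u; set w := _ + _ => /(congr1 (@complex.Im R)) e.
have im0 : Im (inner w v) = 0.
  by have := congr1 (@complex.Im R) (innerC v w); rewrite conjE /= e; lra.
move: im0; rewrite innerDl innerZl !rin_il.
case: (inner (avg phi g) v) => p q; case: (inner _ v) => p' q' /=; lra.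
Qed.

End Evolution.

(* [k] is reflected so that [s |-> avg (reflect k s) u] is the convolution of
   [k] and [u]. *)
Definition reflect k (s t : R) := k (s - t).

Lemma smooth_reflect k s : smooth k -> smooth (reflect k s).
Proof.
move=> sk; have := @smooth_affine R k (-1) s sk.
by congr smooth; apply/funext => t; rewrite /reflect; congr k; ring.
Qed.

Lemma derive1_reflect k s : smooth k ->
  derive1 (reflect k s) = fun t => - reflect (derive1 k) s t.
Proof.
move=> sk; apply: derive1_val => t.
have := @is_derive_affine R k (-1) s t _ (smooth_is_derive sk (-1 * t + s)).
rewrite (_ : (fun r => k (-1 * r + s)) = reflect k s); last first.
  by apply/funext => r; rewrite /reflect; congr k; ring.
by move=> h; apply: is_derive_eq h _; rewrite mulN1r /reflect addrC mulN1r.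
Qed.

Lemma reflect_out k (c d s t : R) : (forall r, r \notin `[c, d] -> k r = 0) ->
  t \notin `[s - d, s - c] -> reflect k s t = 0.
Proof.
move=> k0 tn; apply: k0; apply: contra tn; rewrite !in_itv /= => /andP[a b].
by apply/andP; split; lra.
Qed.

Lemma csupp_reflect k (c d s : R) : smooth k -> (forall r, r \notin `[c, d] -> k r = 0) ->
  csupp (reflect k s).
Proof.
move=> sk k0; apply: (@csupp_smooth _ _ (s - d) (s - c)).
  exact: smooth_reflect.
by move=> t; exact: reflect_out.
Qed.

(** The hypothesis says that [w] is the derivative of [v] at [s], with a quadratic remainder; in
    this form no differentiation of vector-valued maps is required. *)
Lemma is_derive_sqnorm (V : preHilbertType R) (v : R -> V) (w : V) (s C : R) :
  (forall h : R, `|h| <= 1 -> inorm (v (s + h) - v s - h%:C *: w) <= C * h ^+ 2) ->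
  is_derive s 1 (fun r => rin (v r) (v r)) (2 * rin w (v s)).
Proof.
move=> hv; have C0 : 0 <= C.
  have := hv 1; rewrite normr1 expr1n mulr1 => /(_ (lexx 1)).
  exact: le_trans (inorm_ge0 _).
(* With increment dl = h w + e, what exceeds the linear term is |dl|^2 + 2 Re (e, v s), and |dl| <=
   (C + |w|) |h| because h^2 <= |h|. *)
apply: (@is_derive_quadratic _ _ _ _ ((C + inorm w) ^+ 2 + 2 * C * inorm (v s))).
move=> h h1; have := hv h h1; set e := _ - _ *: _ => he.
have -> : v (s + h) = v s + (h%:C *: w + e).
  by rewrite /e addrA -(addrA (v (s + h))) -opprD addrC subrK.
set dl := _ + e; have dE : dl = h%:C *: w + e by [].
have -> : rin (v s + dl) (v s + dl) - rin (v s) (v s) - h * (2 * rin w (v s)) =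
    rin dl dl + 2 * rin e (v s).
  have dv : rin (v s) dl = h * rin w (v s) + rin e (v s).
    by rewrite dE rinDr rinZr (Re_innerC (v s) w) (Re_innerC (v s) e).
  rewrite Re_innerD dv; ring.
have hh : h ^+ 2 <= `|h|.
  by rewrite -(real_normK (num_real h)) expr2 ler_piMr.
have dn : inorm dl <= (C + inorm w) * `|h|.
  apply: le_trans (inormD _ _) _; rewrite inormZ.
  have := inorm_ge0 w; nra.
have d2 : inorm dl ^+ 2 <= (C + inorm w) ^+ 2 * h ^+ 2.
  rewrite -(real_normK (num_real h)) -exprMn ler_pXn2r ?nnegrE ?inorm_ge0 //.
  by rewrite mulr_ge0 // addr_ge0 // inorm_ge0.
have ev := rin_CS_abs e (v s); have vs0 := inorm_ge0 (v s).
rewrite -sqr_inorm; apply: le_trans (ler_normD _ _) _.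
rewrite ger0_norm ?sqr_ge0 // normrM (ger0_norm (ler0n R 2)); nra.
Qed.

(** The parameter enters only through the kernel, so Taylor's formula for [k] gives the expansion
    for any square-integrable [u]. *)
Lemma is_derive_avg k (c d s : R) u : smooth k -> c <= d ->
  (forall r, r \notin `[c, d] -> k r = 0) ->
  is_derive s 1 (fun r => rin (avg (reflect k r) u) (avg (reflect k r) u))
    (2 * rin (avg (reflect (derive1 k) s) u) (avg (reflect k s) u)).
Proof.
move=> sk cd k0.
have k0' := derive1_out sk k0.
have k0'' := derive1_out (smooth_derive1 sk) k0'.
have [M M0 kM] := smooth_bounded (smooth_derive1 (smooth_derive1 sk)) k0''.
have ck r := csupp_reflect r sk k0.
have ck' r := csupp_reflect r (smooth_derive1 sk) k0'.
apply: (@is_derive_sqnorm _ (fun r => avg (reflect k r) u) _ _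
  (inorm u * (M * Num.sqrt (d - c + 2)))) => h h1.
(* The Taylor remainder of the kernel: of size h^2, and supported for |h| <= 1 in a segment longer
   by 2 than that of the kernel, which explains d - c + 2. *)
pose psi t := reflect k (s + h) t + (-1) * reflect k s t + (- h) * reflect (derive1 k) s t.
have cpsi : csupp psi by apply: csuppD; [apply: csuppD => //|]; exact: csuppZ.
have -> : avg (reflect k (s + h)) u - avg (reflect k s) u -
    h%:C *: avg (reflect (derive1 k) s) u = avg psi u.
  rewrite avgDl; [|apply: csuppD => //; exact: csuppZ|exact: csuppZ].
  rewrite avgDl //; last exact: csuppZ.
  by rewrite !avgZl // !rmorphN scaleNr scale1r scaleNr.
have [l u'] : - h <= 1 /\ h <= 1 by move: h1; rewrite ler_norml => /andP[]; lra.
have -> : inorm u * (M * Num.sqrt (d - c + 2)) * h ^+ 2 =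
    inorm u * (M * h ^+ 2 * Num.sqrt (s - c + 1 - (s - d - 1))).
  by rewrite (_ : s - c + 1 - (s - d - 1) = d - c + 2); ring.
apply: inorm_avg_le => //.
- lra.
- by rewrite mulr_ge0 // sqr_ge0.
- move=> t; have := taylor1 (s - t) h sk kM; rewrite /psi /reflect.
  by rewrite (_ : s + h - t = s - t + h) ?mulN1r ?mulNr //; ring.
- move=> t tn; rewrite /psi.
  have tn1 : t \notin `[s - d, s - c].
    by apply: contra tn; rewrite !in_itv /= => /andP[? ?]; apply/andP; split; lra.
  have tn2 : t \notin `[s + h - d, s + h - c].
    by apply: contra tn; rewrite !in_itv /= => /andP[? ?]; apply/andP; split; lra.
  rewrite (reflect_out k0 tn1) (reflect_out k0 tn2) (reflect_out k0' tn1).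
  by rewrite !mulr0 !addr0.
Qed.

(** Differentiating k (s - t) in [s] is minus differentiating it in [t]; this sign turns the i g of
    [rin_avg_derive1] into - i g. *)
Lemma is_derive_evolution (A : set (H * H)) u g k (c d s : R) :
  selfadjoint A -> L_max A I (u, g) -> smooth k -> c <= d ->
  (forall r, r \notin `[c, d] -> k r = 0) -> `[s - d, s - c] `<=` D ->
  is_derive s 1 (fun r => rin (avg (reflect k r) u) (avg (reflect k r) u))
    (2 * rin (avg (reflect k s) (- 'i *: g)) (avg (reflect k s) u)).
Proof.
move=> sA ug sk cd k0 sD; have h := is_derive_avg s u sk cd k0.
apply: is_derive_eq h _; congr (_ * _).
have tk : testfn I (reflect k s).
  split; first exact: smooth_reflect.
  by exists (s - d), (s - c); split => // t; exact: reflect_out.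
have ck' := csupp_reflect s (smooth_derive1 sk) (derive1_out sk k0).
have := rin_avg_derive1 sA ug tk; rewrite derive1_reflect //.
have -> : avg (fun t => - reflect (derive1 k) s t) u = - avg (reflect (derive1 k) s) u.
  have := avgZl (-1) u ck'; rewrite rmorphN1 scaleN1r => <-.
  by congr avg; apply/funext => t; rewrite mulN1r.
rewrite rinNl => /eqP; rewrite eqr_oppLR => /eqP ->.
by rewrite avgZr ?scaleNr ?rinNl //; exact: csupp_reflect k0.
Qed.

End Average.

(** * Eigenfunctions of the maximal operator *)

Section IntegralLimits.
Context (R : realType).
Local Notation mu := (@lebesgue_measure R).
Local Notation RT := (measurableTypeR R).
Implicit Types (D E : set R) (m f : R -> R).

Lemma integrable_measurable D m : mu.-integrable D (EFin \o m) ->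
  measurable_fun (D : set RT) m.
Proof. by move=> /integrableP[/measurable_EFinP]. Qed.

Lemma integrable_bounded_mul D m f : measurable (D : set RT) ->
  mu.-integrable D (EFin \o m) -> measurable_fun (D : set RT) f ->
  (forall t, D t -> `|f t| <= 1) -> mu.-integrable D (EFin \o (fun t => m t * f t)).
Proof.
move=> mD im mf f1; apply: (le_integrable mD _ _ im).
  by apply/measurable_EFinP; exact: (measurable_funM (integrable_measurable im) mf).
by move=> t Dt /=; rewrite lee_fin normrM ler_piMr // f1.
Qed.

Lemma dct_bounded D m (f_ : nat -> R -> R) f : measurable (D : set RT) ->
  mu.-integrable D (EFin \o m) -> (forall n, measurable_fun (D : set RT) (f_ n)) ->
  (forall n t, D t -> `|f_ n t| <= 1) ->
  (forall t, D t -> f_ ^~ t @ \oo --> f t) ->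
  (fun n => \int[mu]_(t in D) (m t * f_ n t)) @ \oo --> \int[mu]_(t in D) (m t * f t).
Proof.
move=> mD im mf f1 ff.
have mf' : measurable_fun (D : set RT) f by exact: (measurable_fun_cvg mf ff).
have mm := integrable_measurable im.
have f1' t : D t -> `|f t| <= 1.
  move=> Dt; have h : (fun n => `|f_ n t|) @ \oo --> `|f t|.
    by apply: cvg_norm; exact: ff.
  rewrite -(cvg_lim (@Rhausdorff R) h); apply: limr_le; first by apply/cvg_ex; exists `|f t|.
  by apply: nearW => n; exact: f1.
have m1 n : measurable_fun D (fun t => (m t * f_ n t)%:E).
  by apply/measurable_EFinP; exact: (measurable_funM mm (mf n)).
have m2 : measurable_fun D (fun t => (m t * f t)%:E).
  by apply/measurable_EFinP; exact: (measurable_funM mm mf').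
have c1 t : D t -> (fun n => (m t * f_ n t)%:E) @ \oo --> (m t * f t)%:E.
  move=> Dt; apply: cvg_EFin; first exact: nearW.
  by apply: cvgM; [exact: cvg_cst|exact: ff].
have c2 t n : D t -> (`|(m t * f_ n t)%:E| <= `|(m t)%:E|)%E.
  by move=> Dt; rewrite lee_fin normrM ler_piMr // f1.
have ae1 : {ae mu, forall t, D t ->
    (fun n => (m t * f_ n t)%:E) @ \oo --> (m t * f t)%:E} by exact: aeW.
have ae2 : {ae mu, forall t n, D t ->
    (`|(m t * f_ n t)%:E| <= `|(m t)%:E|)%E} by exact: aeW.
have [i2 _ h] := dominated_convergence mD m1 m2 ae1 (integrable_abse im) ae2.
by apply: fine_cvg; rewrite fineK; [exact: h|exact: integrable_fin_num i2].
Qed.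

Lemma ae_le_norm_Rintegral D f g : measurable (D : set RT) ->
  mu.-integrable D (EFin \o f) -> mu.-integrable D (EFin \o g) ->
  (forall t, D t -> 0 <= g t) -> {ae mu, forall t, D t -> `|f t| <= g t} ->
  `|\int[mu]_(t in D) f t| <= \int[mu]_(t in D) g t.
Proof.
move=> mD fi gi g0 fg; apply: le_trans (le_normr_Rintegral mD fi) _.
have ni := integrable_norm fi.
apply: fine_le; [exact: integrable_fin_num ni|exact: integrable_fin_num gi|].
apply: ae_ge0_le_integral => //.
- exact: measurable_int ni.
- exact: measurable_int gi.

Qed.

Lemma Rintegral_indic D E m : measurable (D : set RT) -> measurable (E : set RT) ->
  \int[mu]_(t in D) (m t * \1_E t) = \int[mu]_(t in D `&` E) m t.
Proof.
move=> mD mE; rewrite [RHS]Rintegral_mkcondr; apply: eq_Rintegral => t _.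
by rewrite indicE patchE; case: (t \in E); rewrite ?mulr1 ?mulr0.
Qed.

Lemma dct_indic D m (E_ : nat -> set R) : measurable (D : set RT) ->
  mu.-integrable D (EFin \o m) -> (forall n, measurable (E_ n : set RT)) ->
  (forall t, D t -> exists N, forall n, (N <= n)%N -> E_ n t) ->
  (fun n => \int[mu]_(t in D `&` E_ n) m t) @ \oo --> \int[mu]_(t in D) m t.
Proof.
move=> mD im mE hE.
have -> : \int[mu]_(t in D) m t = \int[mu]_(t in D) (m t * (cst 1 : R -> R) t).
  by apply: eq_Rintegral => t _; rewrite mulr1.
under eq_fun do rewrite -Rintegral_indic //.
apply: (@dct_bounded D m (fun n => \1_(E_ n)) (cst 1)) => //.
- by move=> n t _; rewrite indicE; case: (_ \in _); rewrite /= ?normr1 ?normr0.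
- move=> t /hE[N hN]; apply/cvgrPdist_le => /= e e0.
  by exists N => // n /hN Et; rewrite indicE mem_set // subrr normr0 ltW.
Qed.

(** As [step] vanishes at 0, the limit at t = r is 0, whence the open half-line. *)
Lemma step_cvg (r t : R) : (fun n : nat => step ((r - t) * n.+1%:R)) @ \oo -->
  (\1_(`]-oo, r[%classic) t : R).
Proof.
apply/cvgrPdist_le => /= e e0; rewrite indicE.
have [tr|rt] := ltP t r.
  have rt0 : 0 < r - t by rewrite subr_gt0.
  have [N hN] := natSinv_lt rt0; exists N => // n /= /hN h.
  rewrite mem_set /= ?in_itv //= step_ge1 ?subrr ?normr0 ?ltW //.
  by move: h; rewrite -[X in X < _]mul1r ltr_pdivrMr ?ltr0n.
apply: nearW => n; rewrite memNset /= ?in_itv /= ?ltNge ?rt //.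
rewrite step_le0 ?subrr ?normr0 ?(ltW e0) //.
by rewrite mulr_le0_ge0 ?subr_le0 // ler0n.
Qed.

Lemma measurable_smooth D f : measurable (D : set RT) -> smooth f ->
  measurable_fun (D : set RT) f.
Proof.
move=> mD sf; apply: measurable_funTS; apply: continuous_measurable_fun.
exact: smooth_continuous.
Qed.

Lemma Rintegral_setD_null D E m : measurable (D : set RT) -> measurable (E : set RT) ->
  mu E = 0 -> mu.-integrable D (EFin \o m) ->
  \int[mu]_(t in D) m t = \int[mu]_(t in D `\` E) m t.
Proof. by move=> mD mE E0 im; rewrite /Rintegral (negligible_integral mE mD im E0). Qed.

Lemma norm_step (x : R) : `|step x| <= 1.
Proof. by rewrite ger0_norm ?step_ge0 // step_le1. Qed.

(* Lebesgue differentiation of the primitives based at the integers [-n]. *)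
Lemma ae_zero_of_itv D h : measurable (D : set RT) ->
  (forall n : nat, mu.-integrable (D `&` `[- n%:R, n%:R]) (EFin \o h)) ->
  (forall c d, \int[mu]_(t in D `&` `]c, d[) h t = 0) ->
  {ae mu, forall t, D t -> h t = 0}.
Proof.
move=> mD ih h0.
pose E (n : nat) : set R := D `&` `[- n%:R, n%:R].
have mE n : measurable (E n : set RT).
  by apply: measurableI => //; exact: measurable_itv.
pose f n := h \_ (E n).
have intf n : mu.-integrable setT (EFin \o f n).
  by rewrite /f -restrict_EFin; apply/integrable_restrict => //; rewrite setTI; exact: ih.
have zero n : {ae mu, forall t, - n%:R < t -> f n t = 0}.
  have lf : locally_integrable setT (f n) by exact: (open_integrable_locally openT (intf n)).
  have ify y : mu.-integrable [set` Interval (BLeft (- n%:R)) (BRight y)] (EFin \o f n).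
    by apply: integrableS (intf n) => //; exact: measurable_itv.
  apply: ae_imply (FTC1 ify lf) => t ft tn.
  have [] := ft; first by rewrite /= lte_fin.
  (* The primitive is an integral over a closed segment, the hypothesis is about open intervals;
     they differ by two points, so the primitive vanishes identically. *)
  rewrite (_ : (fun y => \int[mu]_(t in _) f n t) = cst 0); last first.
    apply/funext => y; rewrite /f -Rintegral_mkcondr /=.
    have -> : `[- n%:R, y] `&` E n = D `&` `[- n%:R, Num.min y n%:R].
      rewrite setIC /E -setIA; congr (_ `&` _); apply/seteqP; split => s /=;
        rewrite !in_itv /= le_min.
        by move=> [/andP[-> ->] /andP[_ ->]].
      by move=> /andP[-> /andP[-> ->]].
    set d := Num.min _ _.
    have dn : d <= n%:R by rewrite ge_min lexx orbT.
    have sub : D `&` `[- n%:R, d] `<=` E n.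
      move=> s [Ds] /=; rewrite in_itv /= => /andP[s1 s2]; split => //=.
      by rewrite in_itv /= s1 (le_trans s2).
    have mDd : measurable (D `&` `[- n%:R, d] : set RT).
      by apply: measurableI => //; exact: measurable_itv.
    rewrite (@Rintegral_setD_null _ [set - n%:R; d]) //; first last.
    - exact: (integrableS (mE n) mDd sub (ih n)).
    - by apply: countable_lebesgue_measure0; exact/finite_set_countable/finite_set2.
    - by apply: measurableU; exact: measurable_set1.
    rewrite -(h0 (- n%:R) d); congr (Rintegral _ _ _); apply/seteqP; split => s /=.
      move=> [[Ds]]; rewrite !in_itv /= => /andP[s1 s2] /not_orP[/eqP n1 /eqP n2].
      by split => //; rewrite !lt_neqAle s1 s2 n2 eq_sym n1.
    move=> [Ds]; rewrite !in_itv /= => /andP[s1 s2]; split.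
      by split => //; rewrite !ltW.
    by move=> [se|se]; move: s1 s2; rewrite se ltxx.
  by rewrite derive1E derive_cst => _ <-.
have zero' : {ae mu, forall t (n : nat), - n%:R < t -> f n t = 0}.
  exact: ae_foralln.
apply: ae_imply zero' => t ft Dt.
have [n tn] : exists n : nat, `|t| < n%:R.
  by exists (Num.bound `|t|); rewrite archi_boundP.
move: tn; rewrite ltr_norml => /andP[t1 t2].
have := ft n t1; rewrite /f patchE mem_set //; split => //=.
by rewrite in_itv /= !ltW.
Qed.

End IntegralLimits.

(** * Local averages and vanishing at infinity *)

Section Localization.
Local Open Scope quotient_scope.
Context (R : realType) (H : sepHilbertType R) (I : interval R).
Local Notation D := [set` I].
Local Notation mu := (@lebesgue_measure R).
Local Notation RT := (measurableTypeR R).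
Implicit Types (u g : L2 H I) (phi psi k : R -> R) (x y : H).

Let mD : measurable (D : set RT).
Proof. exact: measurable_itv. Qed.
Local Hint Resolve mD : core.

Lemma Rintegral_subset (E F : set R) (m : R -> R) : measurable (E : set RT) ->
  measurable (F : set RT) -> E `<=` F -> mu.-integrable F (EFin \o m) ->
  (forall t, F t -> 0 <= m t) -> \int[mu]_(t in E) m t <= \int[mu]_(t in F) m t.
Proof.
move=> mE mF EF im m0; have imE := integrableS mF mE EF im.
apply: fine_le; [exact: integrable_fin_num imE|exact: integrable_fin_num im|].
by apply: ge0_subset_integral => //; exact: measurable_int im.
Qed.

Lemma derive0_const (f : R -> R) (s t : R) :
  (forall r, (s <= r <= t) || (t <= r <= s) -> is_derive r 1 f 0) -> f s = f t.
Proof.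
wlog st : s t / s <= t.
  move=> hw hf; have [st|ts] := leP s t; first exact: hw.
  by apply/esym/hw; [exact: ltW|move=> r /orP[] h; apply: hf; rewrite h ?orbT].
move=> hf; have cf : {within `[s, t], continuous f}.
  apply: derivable_within_continuous => r; rewrite in_itv /= => rst.
  by have [] := hf r (introT orP (or_introl rst)).
have df r : r \in `]s, t[ -> is_derive r 1 f 0.
  by rewrite in_itv /= => /andP[a b]; apply: hf; rewrite (ltW a) (ltW b).
have [c _ /eqP] := MVT_segment st (df := cst 0) df cf.
by rewrite mul0r subr_eq0 => /eqP.
Qed.

(** A Cauchy-Schwarz inequality seeing only the part of [u] on [[c, d]]. With v the average and B0
    the constant, integrate |u - l phi v|^2 >= 0 for l = 1 / B0; the added 1 keeps B0 positive. *)
Lemma avg_local phi u (M c d : R) : csupp phi -> c <= d ->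
  (forall t, `|phi t| <= M) -> (forall t, t \notin `[c, d] -> phi t = 0) ->
  inorm (avg phi u) ^+ 2 <= (M ^+ 2 * (d - c) + 1) *
    \int[mu]_(t in D `&` `[c, d]) rin (repr u t) (repr u t).
Proof.
move=> cp cd pM p0; set v := avg phi u; set tau := Rintegral _ _ _.
have mE : measurable (D `&` `[c, d] : set RT).
  by apply: measurableI => //; exact: measurable_itv.
have ED : D `&` `[c, d] `<=` D by exact: subIsetl.
have iq : mu.-integrable (D `&` `[c, d]) (EFin \o (fun t => rin (repr u t) (repr u t))).
  exact: (integrableS mD mE ED (Re_int (repr u) (repr u))).
have ip : mu.-integrable (D `&` `[c, d]) (EFin \o (fun t => phi t * phi t)).
  by apply: csupp_integrable => //; exact: csuppM.
have iv : mu.-integrable (D `&` `[c, d]) (EFin \o (fun t => phi t * rin (repr u t) v)).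
  exact: (integrableS mD mE ED (integrable_tens v u cp)).
set B0 := _ + 1; pose l := B0^-1; pose q := inorm v ^+ 2.
have M0 : 0 <= M ^+ 2 * (d - c) by rewrite mulr_ge0 ?sqr_ge0 ?subr_ge0.
have B0p : 0 < B0 by rewrite /B0; lra.
have l0 : 0 < l by rewrite invr_gt0.
have q0 : 0 <= q by exact: sqr_ge0.
have qE : q = \int[mu]_(t in D `&` `[c, d]) (phi t * rin (repr u t) v).
  rewrite /q sqr_inorm; apply: (etrans (rin_avg_int u v cp)).
  by apply: Rintegral_restrict => // t Dt nE; rewrite p0 ?mul0r //;
    apply/negP => h; apply: nE.
have BB0 : \int[mu]_(t in D `&` `[c, d]) (phi t * phi t) <= B0.
  apply: le_trans (ler_norm _) _.
  apply: (@le_trans _ _ (M ^+ 2 * (d - c))); last by rewrite /B0; lra.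
  apply: Rintegral_norm_le => //; first by move=> t; rewrite normrM expr2; apply: ler_pM.
  by move=> t _ /p0 ->; rewrite mul0r.
have i1 : mu.-integrable (D `&` `[c, d])
    (EFin \o (fun t => (2 * l) * (phi t * rin (repr u t) v))).
  by apply: eq_integrable (integrableZl mE (2 * l) iv).
have i2 : mu.-integrable (D `&` `[c, d])
    (EFin \o (fun t => (l ^+ 2 * q) * (phi t * phi t))).
  by apply: eq_integrable (integrableZl mE (l ^+ 2 * q) ip).
have i3 : mu.-integrable (D `&` `[c, d])
    (EFin \o (fun t => rin (repr u t) (repr u t) + (l ^+ 2 * q) * (phi t * phi t))).
  by apply: eq_integrable (integrableD mE iq i2).
have key : 2 * l * q <= tau + l ^+ 2 * q * \int[mu]_(t in D `&` `[c, d]) (phi t * phi t).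
  rewrite {1}qE /tau -!RintegralZl // -RintegralD //; apply: le_Rintegral => // t _.
  have := Re_inner_ge0 (repr u t - (l * phi t)%:C *: v).
  rewrite rinBl !rinBr !rinZl !rinZr (Re_innerC v) /q sqr_inorm.
  by move: (rin (repr u t) v) (rin (repr u t) _) (rin v v) => a1 a2 a3; nra.
have lB : l * B0 = 1 by rewrite /l mulVf // gt_eqF.
have : l ^+ 2 * q * \int[mu]_(t in D `&` `[c, d]) (phi t * phi t) <= l * q.
  apply: (@le_trans _ _ (l ^+ 2 * q * B0)); first by rewrite ler_wpM2l // mulr_ge0 // sqr_ge0.
  have -> : l ^+ 2 * q * B0 = l * q * (l * B0) by ring.
  by rewrite lB mulr1.
move=> h; have : l * q <= tau by lra.
by rewrite /l ler_pdivrMl.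
Qed.

(** By dominated convergence the mass of |u|^2 outside some [-T, T] is at most [e]. *)
Lemma tail_small u (e : R) : 0 < e -> exists2 T : R, 0 <= T &
  forall c d, (forall t, c <= t <= d -> T < `|t|) ->
  \int[mu]_(t in D `&` `[c, d]) rin (repr u t) (repr u t) <= e.
Proof.
move=> e0; pose m t := rin (repr u t) (repr u t).
have im : mu.-integrable D (EFin \o m) := Re_int (repr u) (repr u).
pose E (n : nat) := `[- n%:R, n%:R : R]%classic.
have mI c d : measurable (`[c, d]%classic : set RT) by exact: measurable_itv.
have mE n : measurable (E n : set RT) by exact: mI.
have hE t : D t -> exists N, forall n, (N <= n)%N -> E n t.
  move=> _; exists (Num.bound `|t|) => n hn.
  have : `|t| <= n%:R.
    by apply: ltW; apply: lt_le_trans (archi_boundP (normr_ge0 t)) _; rewrite ler_nat.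
  by rewrite ler_norml /E /= in_itv /=.
have /cvgrPdist_le/(_ _ e0)[N _ /(_ N (leqnn N)) /= hN] := dct_indic mD im mE hE.
exists N%:R; first exact: ler0n.
move=> c d cdT; rewrite -/m.
have m0 t : 0 <= m t by exact: Re_inner_ge0.
have mDE : measurable (D `&` E N : set RT) by exact: measurableI.
have mDc : measurable (D `&` `[c, d] : set RT) by exact: measurableI.
have mU : measurable ((D `&` E N) `|` (D `&` `[c, d]) : set RT) by exact: measurableU.
have UD : (D `&` E N) `|` (D `&` `[c, d]) `<=` D by rewrite -setIUr; exact: subIsetl.
have := Rintegral_subset mU mD UD im (fun t _ => m0 t).
rewrite Rintegral_setU //; last 2 first.
- exact: (integrableS mD mU UD im).
- apply/disj_setPS => t /= [[_ tN] [_ tc]]; move: tN tc.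
  rewrite /E /= !in_itv /= -ler_norml => tN /cdT.
  by rewrite ltNge tN.
by move=> h; have := ler_norm (\int[mu]_(t in D) m t - \int[mu]_(t in D `&` E N) m t); lra.
Qed.

Lemma integrable_rin_bounded u x (E : set R) (c d : R) : measurable (E : set RT) ->
  E `<=` D -> E `<=` `[c, d] -> mu.-integrable E (EFin \o (fun t => rin (repr u t) x)).
Proof.
move=> mE ED Ecd; have iq := integrableS mD mE ED (Re_int (repr u) (repr u)).
have ic : mu.-integrable E (EFin \o cst (rin x x)).
  have mcd : measurable (`[c, d]%classic : set RT) by exact: measurable_itv.
  apply: (integrableS mcd mE Ecd); apply: measurable_bounded_integrable => //.
    by rewrite /= lebesgue_measure_itv /=; case: ifPn => _; rewrite ?ltry.
  exact: bounded_cst.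
have mr : measurable_fun D (fun t => rin (repr u t) x).
  apply: (@measurable_fun_Re_inner _ _ I _ (cst x)).
    by have /sqintP[] := L2funP (repr u).
  exact: (@measurable_cst _ _ RT (borel H)).
apply: (le_integrable mE _ _ (integrableD mE iq ic)).
  by apply/measurable_EFinP; exact: (measurable_funS mD ED mr).
move=> t _ /=; rewrite lee_fin; apply: le_trans (Re_inner_le _ _) _.
exact: ler_norm.
Qed.

(** Bumps tending to the indicator of an interval show that Re (u, x) has zero integral over every
    interval, hence vanishes almost everywhere. The null set depends on x, and separability reduces
    the choice to countably many x. *)
Lemma avg_eq0 u : (forall c d, exists c' d', D `&` `]c, d[ = `]c', d'[%classic) ->
  (forall phi, testfn I phi -> avg phi u = 0) -> u = 0.
Proof.
move=> oD u0.
have hx x : {ae mu, forall t, D t -> rin (repr u t) x = 0}.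
  apply: ae_zero_of_itv => // [n|c d].
    apply: (@integrable_rin_bounded u x _ (- n%:R) n%:R).
    - by apply: measurableI => //; exact: measurable_itv.
    - exact: subIsetl.
    - exact: subIsetr.
  have [c' [d' E]] := oD c d; rewrite E.
  have sub : `]c', d'[ `<=` D by rewrite -E; exact: subIsetl.
  have mE : measurable (`]c', d'[%classic : set RT) by exact: measurable_itv.
  have im : mu.-integrable `]c', d'[ (EFin \o (fun t => rin (repr u t) x)).
    apply: (@integrable_rin_bounded u x _ c' d') => // t /=.
    by rewrite !in_itv /= => /andP[a b]; rewrite !ltW.
  (* A bump rising from 0 to 1 at distances between 1/(n+1) and 2/(n+1) from the left endpoint, and
     falling likewise on the right; the shift by 1 keeps its support inside the open interval. *)
  pose phi (n : nat) t : R := step (n.+1%:R * t + (- (n.+1%:R * c') - 1)) *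
    step (- n.+1%:R * t + (n.+1%:R * d' - 1)).
  have n0 n : 0 < n.+1%:R :> R by rewrite ltr0n.
  have sphi n : smooth (phi n).
    have s1 := @smooth_affine R step n.+1%:R (- (n.+1%:R * c') - 1) (@smooth_step R).
    have s2 := @smooth_affine R step (- n.+1%:R) (n.+1%:R * d' - 1) (@smooth_step R).
    exact: (smoothM s1 s2).
  have phi0 n t : t \notin `[c' + n.+1%:R^-1, d' - n.+1%:R^-1] -> phi n t = 0.
    rewrite in_itv /= negb_and -!ltNge /phi => /orP[h|h].
      rewrite (@step_le0 _ (n.+1%:R * t + _)) ?mul0r //.
      have : n.+1%:R * (t - c') <= 1 by rewrite -ler_pdivlMl // mulr1 lerBlDl ltW.
      rewrite mulrBr; move: (n.+1%:R * t) (n.+1%:R * c') => p q; lra.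
    rewrite (@step_le0 _ (- n.+1%:R * t + _)) ?mulr0 //.
    have : n.+1%:R * (d' - t) <= 1.
      by rewrite -ler_pdivlMl // mulr1 lerBlDl -lerBlDr ltW.
    rewrite mulrBr mulNr; move: (n.+1%:R * t) (n.+1%:R * d') => p q; lra.
  have tphi n : testfn I (phi n).
    split=> //; exists (c' + n.+1%:R^-1), (d' - n.+1%:R^-1); split; first exact: phi0.
    apply: subset_trans sub => t /=; rewrite !in_itv /= => /andP[a b].
    have ni : 0 < n.+1%:R^-1 :> R by rewrite invr_gt0.
    by rewrite (lt_le_trans _ a) ?ltrDl //= (le_lt_trans b) // gtrBl.
  have int0 n : \int[mu]_(t in `]c', d'[) (rin (repr u t) x * phi n t) = 0.
    transitivity (rin (avg (phi n) u) x); last by rewrite (u0 _ (tphi n)) rin0l.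
    apply/esym; apply: (etrans (rin_avg_int u x (testfn_csupp (tphi n)))).
    rewrite (@Rintegral_restrict _ D `]c', d'[%classic) //; last first.
      move=> t _ nE; rewrite phi0 ?mul0r //; apply/negP; rewrite in_itv /= => /andP[a b].
      apply: nE; rewrite /= in_itv /=.
      have ni : 0 < n.+1%:R^-1 :> R by rewrite invr_gt0.
      by rewrite (lt_le_trans _ a) ?ltrDl //= (le_lt_trans b) // gtrBl.
    by apply: eq_Rintegral => t _; rewrite mulrC.
  have -> : \int[mu]_(t in `]c', d'[) rin (repr u t) x =
      \int[mu]_(t in `]c', d'[) (rin (repr u t) x * (cst 1 : R -> R) t).
    by apply: eq_Rintegral => t _; rewrite mulr1.
  have cv := @dct_bounded R `]c', d'[%classic _ phi (cst 1) mE im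
    (fun n => measurable_smooth mE (sphi n)).
  have cv1 : (fun n => \int[mu]_(t in `]c', d'[) (rin (repr u t) x * phi n t)) @ \oo -->
     \int[mu]_(t in `]c', d'[) (rin (repr u t) x * (cst 1 : R -> R) t).
    apply: cv => [n t _|t].
      by rewrite normrM mulr_ile1 // norm_step.
    rewrite /= in_itv /= => /andP[ct td].
    have e0 : 0 < Num.min (t - c') (d' - t) / 2.
      by rewrite divr_gt0 // lt_min !subr_gt0 ct td.
    have [N hN] := natSinv_lt e0.
    apply/cvgrPdist_le => /= e e1; exists N => // n /= /hN h.
    have [h1 h2] : n.+1%:R^-1 < (t - c') / 2 /\ n.+1%:R^-1 < (d' - t) / 2.
      by split; apply: lt_le_trans h _; rewrite ler_pM2r // ge_min lexx ?orbT.
    have g1 : 2 <= n.+1%:R * (t - c').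
      by move: h1; rewrite ltr_pdivlMr // ltr_pdivrMl // => /ltW.
    have g2 : 2 <= n.+1%:R * (d' - t).
      by move: h2; rewrite ltr_pdivlMr // ltr_pdivrMl // => /ltW.
    rewrite /phi !step_ge1 ?mulr1 ?subrr ?normr0 ?(ltW e1) //.
      by move: g2; rewrite mulrBr mulNr; lra.
    by move: g1; rewrite mulrBr; lra.
  rewrite -(cvg_lim (@Rhausdorff R) cv1) (_ : (fun n => _) = cst 0); last first.
    by apply/funext => n; exact: int0.
  exact: lim_cst.
(* Off one null set u(t) is orthogonal in the real sense to a countable dense set, and so to
   itself. *)
have [S cS dS] := @separable_space R H.
have aeS : {ae mu, forall t, D t -> forall x, S x -> rin (repr u t) x = 0}.
  have /pfcard_geP[->|[h]] := cS; first exact: aeW.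
  have hh : {ae mu, forall t n, D t -> rin (repr u t) (h n) = 0}.
    by apply: ae_foralln => n; exact: hx.
  apply: ae_imply hh => t ht Dt x Sx; have [n _ <-] := 'surj_h Sx.
  exact: ht.
rewrite -[u]reprK; apply/L2_eqP; apply: ae_imply aeS => t ht Dt.
apply: inner_eq0; apply: eq0_small => e e0.
set w := repr u t in ht *.
have w1 : 0 < inorm w + 1 by have := inorm_ge0 w; lra.
have [] := dS (ball w (e / (inorm w + 1))%:C).
- by exists w; apply: ballxx; rewrite ltcR divr_gt0.
- exact: ball_open.
- move=> x [wx Sx]; move: wx; rewrite -ball_normE /= normr_inorm ltcR.
  rewrite ltr_pdivlMr // => wx.
  have -> : rin w w = rin w (w - x) by rewrite rinBr (ht Dt x Sx) subr0.
  apply: le_trans (rin_CS_abs _ _) _; have := inorm_ge0 (w - x); nra.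
Qed.

(* A weak solution of [i u' + A u = lambda u] has constant norm after
   convolution in time, while square integrability forces it to vanish at
   infinity. *)
Lemma L_max_ker (A : set (H * H)) u (lambda : R) : selfadjoint A ->
  (forall c d, exists c' d', D `&` `]c, d[ = `]c', d'[%classic) ->
  (forall L T : R, 0 <= L -> exists c, `[c, c + L] `<=` D /\
    forall t, c <= t <= c + L -> T < `|t|) ->
  L_max A I (u, lambda%:C *: u) -> u = 0.
Proof.
move=> sA oD farD ug; apply: avg_eq0 => // phi [sp [c [d [p0 cdD]]]].
have [cd|dc] := leP c d; last first.
  have -> : phi = cst 0.
    apply/funext => t; apply: p0; rewrite in_itv /= negb_and -!ltNge.
    by have [//|h] := ltP t c; rewrite (lt_le_trans dc).
  apply: inner_eq0; apply: (etrans (rin_avg_int _ _ _)).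
    apply: (@csupp_smooth _ _ 0 0) => //; exact: smooth_cst.
  under eq_Rintegral do rewrite mul0r.
  by rewrite Rintegral_cst // mul0r.
(* Reflected so that the average against [phi] is the value at 0 of the convolution with [k]. *)
pose k t := phi (- t).
have sk : smooth k.
  have := @smooth_affine R phi (-1) 0 sp; congr smooth.
  by apply/funext => t; rewrite addr0 mulN1r.
have k0 r : r \notin `[- d, - c] -> k r = 0.
  move=> h; apply: p0; apply: contra h; rewrite !in_itv /= => /andP[a b].
  by apply/andP; split; lra.
have [M M0 kM] := smooth_bounded sk k0.
have ck s := csupp_reflect s sk k0.
pose v s := avg (reflect k s) u.
have phiE : phi = reflect k 0.
  by apply/funext => t; rewrite /reflect /k sub0r opprK.
have ndc : - d <= - c by rewrite lerN2.
(* With g = lambda u the rate is a real multiple of Re (i v, v) = 0; this is where [lambda] has to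
   be real. *)
have dN s : `[s + c, s + d] `<=` D -> is_derive s 1 (fun r => rin (v r) (v r)) 0.
  move=> sD; have h := @is_derive_evolution _ _ _ A u _ k _ _ s sA ug sk ndc k0.
  rewrite !opprK in h; have := h sD; rewrite scalerA => {}h.
  apply: is_derive_eq h _; rewrite (avgZr _ _ (ck s)).
  have -> : (- 'i * lambda%:C) *: avg (reflect k s) u =
      (- lambda)%:C *: ('i *: avg (reflect k s) u).
    by rewrite scalerA rmorphN mulNr [in RHS]mulNr [in RHS]mulrC.
  by rewrite rinZl rin_iu !mulr0.
rewrite phiE; apply: inner_eq0; apply: eq0_small => e e0.
set B := M ^+ 2 * (d - c) + 1.
have B0 : 0 < B.
  by have : 0 <= M ^+ 2 * (d - c); [rewrite mulr_ge0 ?sqr_ge0 ?subr_ge0|rewrite /B; lra].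
have [T T0 hT] := tail_small u (divr_gt0 e0 B0).
have dc0 : 0 <= d - c by rewrite subr_ge0.
have [c0 [c0D c0T]] := farD (d - c) T dc0.
pose s := c0 - c.
have sc : s + c = c0 by rewrite /s subrK.
have sd : s + d = c0 + (d - c) by rewrite /s; ring.
have itvD (p q z : R) : D p -> D q -> p <= z <= q -> D z.
  by move=> Dp Dq; exact: (interval_is_interval (i := I) Dp Dq).
have Dc : D c by apply: cdD; rewrite /= in_itv /= lexx cd.
have Dd : D d by apply: cdD; rewrite /= in_itv /= lexx cd.
have Dsc : D (s + c) by rewrite sc; apply: c0D; rewrite /= in_itv /= lexx lerDl.
have Dsd : D (s + d) by rewrite sd; apply: c0D; rewrite /= in_itv /= lexx lerDl dc0.
(* [D] is an interval, so every translate of the support between the initial and the final one stays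
   in [D], and the norm is carried unchanged to a region where [tail_small] applies. *)
have Ns : rin (v 0) (v 0) = rin (v s) (v s).
  apply: (@derive0_const (fun r => rin (v r) (v r))) => r hr; apply: dN => t /=.
  rewrite in_itv /= => /andP[t1 t2]; case/orP: hr => /andP[r1 r2].
    by apply: (itvD c (s + d)) => //; apply/andP; split; lra.
  by apply: (itvD (s + c) d) => //; apply/andP; split; lra.
rewrite -/(v 0) Ns ger0_norm ?Re_inner_ge0 // -sqr_inorm.
have scd : s + c <= s + d by rewrite lerD2l.
have := @avg_local (reflect k s) u M (s + c) (s + d) (ck s) scd (fun t => kM (s - t)).
have out t : t \notin `[s + c, s + d] -> reflect k s t = 0.
  by move=> h; apply: (reflect_out k0); rewrite !opprK.
move=> /(_ out) /le_trans; apply.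
have -> : s + d - (s + c) = d - c by ring.
rewrite -/B; have := hT (s + c) (s + d); rewrite sc sd => /(_ c0T) h.
by rewrite mulrC -ler_pdivlMr.
Qed.

End Localization.

(** * Boundary values and Green's formula *)

Section Continuity.
Context (R : realType) (H : sepHilbertType R).
Local Notation mu := (@lebesgue_measure R).
Local Notation RT := (measurableTypeR R).

Lemma within_continuous_inorm (S : set R) (f : R -> H) (x e : R) :
  {within S, continuous f} -> S x -> 0 < e ->
  exists2 r : R, 0 < r & forall y, S y -> `|y - x| < r -> inorm (f y - f x) < e.
Proof.
move=> /subspace_continuousP cf Sx e0.
have FF : Filter (within S (nbhs x)) by exact: within_filter.
have := (@inorm_cvgP R H R _ FF f (f x)).1 (cf x Sx) e e0.
rewrite /within /= => /nbhs_ballP[r /= r0 hr]; exists r => // y Sy yx.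
by apply: hr => //; rewrite -ball_normE /= distrC.
Qed.

Lemma unif_continuous_segment (c d : R) (f : R -> H) (e : R) :
  {within `[c, d], continuous f} -> 0 < e -> exists2 r : R, 0 < r &
  forall x y, x \in `[c, d] -> y \in `[c, d] -> `|x - y| < r -> inorm (f x - f y) < e.
Proof.
move=> cf e0; have e2 := divr_gt0 e0 (ltr0n R 2).
pose P (r x : R) := forall y, x \in `[c, d] -> y \in `[c, d] -> `|x - y| < r ->
  inorm (f x - f y) < e.
have := (compact_near_coveringP _).1 (@segment_compact R c d) _ 0^'+ P _.
move=> /(_ _)[].
  move=> x xcd; have [r r0 hr] := within_continuous_inorm cf xcd e2.
  exists (ball x (r / 2), [set s | s < r / 2]).
    split; first by apply: nbhsx_ballx; rewrite divr_gt0.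
    by apply: nbhs_right_lt; rewrite divr_gt0.
  move=> [z s] /= [xz sr] y zcd ycd zy; rewrite -ball_normE /= in xz.
  apply: le_lt_trans (inorm_dist (f x) _ _) _; rewrite (splitr e) (inormC (f x)).
  apply: ltrD; apply: hr => //.
    by rewrite distrC; apply: lt_trans xz _; rewrite ltr_pdivrMr // ltr_pMr // ltr1n.
  have := ler_normD (y - z) (z - x); rewrite subrKA (distrC y z) (distrC z x) => h.
  apply: le_lt_trans h _; rewrite (splitr r); apply: ltrD => //.
  exact: lt_trans zy sr.
move=> r /= r0 hr; exists (r / 2); first by rewrite divr_gt0.
move=> x y xcd ycd xy; apply: (hr (r / 2)) => //=.
- rewrite sub0r normrN ger0_norm ?divr_ge0 ?(ltW r0) //.
  by rewrite ltr_pdivrMr // ltr_pMr // ltr1n.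
- by rewrite divr_gt0.
Qed.

End Continuity.

(** * A one-sided approximate identity *)

Section Kernel.
Context (R : realType).
Local Notation mu := (@lebesgue_measure R).
Local Notation RT := (measurableTypeR R).

(** Supported in [0, 1/(n+1)], so the convolution at time r only sees times just before r. *)
Definition kernel (n : nat) (r : R) : R := n.+1%:R * mollifier (n.+1%:R * r).

Lemma smooth_kernel n : smooth (kernel n).
Proof.
apply: smoothM; first exact: smooth_cst.
have := @smooth_affine R mollifier n.+1%:R 0 (@smooth_mollifier R).
by congr smooth; apply/funext => x; rewrite addr0.
Qed.

Lemma kernel_out n r : r \notin `[0, n.+1%:R^-1] -> kernel n r = 0.
Proof.
have n0 : 0 < n.+1%:R :> R by rewrite ltr0n.
rewrite /kernel => h; rewrite mollifier_out ?mulr0 //; apply: contra h.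
rewrite !in_itv /= => /andP[a b]; apply/andP; split.
  by move: a; rewrite pmulr_rge0.
by rewrite -[_^-1]mulr1 ler_pdivlMl.
Qed.

Lemma kernel_ge0 n r : 0 <= kernel n r.
Proof. by rewrite mulr_ge0 ?ler0n // mollifier_ge0. Qed.

Lemma is_derive_step_kernel n (t r : R) :
  is_derive r 1 (fun r => step ((r - t) * n.+1%:R)) (reflect (kernel n) r t).
Proof.
have h := @is_derive_affine R step n.+1%:R (- (n.+1%:R * t)) r _ (is_derive_step _).
have E : (fun x => step (n.+1%:R * x - n.+1%:R * t)) = (fun r => step ((r - t) * n.+1%:R)).
  by apply/funext => x; congr step; ring.
rewrite E in h; apply: is_derive_eq h _.
by rewrite /reflect /kernel; congr (_ * mollifier _); ring.
Qed.

Lemma derive1_step_kernel n (r : R) : derive1 (fun t => step ((r - t) * n.+1%:R)) =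
  fun t => - reflect (kernel n) r t.
Proof.
apply: derive1_val => t.
have h := @is_derive_affine R step (- n.+1%:R) (n.+1%:R * r) t _ (is_derive_step _).
have E : (fun x => step (- n.+1%:R * x + n.+1%:R * r)) = (fun t => step ((r - t) * n.+1%:R)).
  by apply/funext => x; congr step; ring.
rewrite E in h; apply: is_derive_eq h _.
by rewrite /reflect /kernel mulNr; congr (- (_ * mollifier _)); ring.
Qed.

Lemma csupp_kernel n (r : R) : csupp (reflect (kernel n) r).
Proof. exact: (csupp_reflect r (@smooth_kernel n) (@kernel_out n)). Qed.

Lemma reflect_kernel_out n (r t : R) : t \notin `[r - n.+1%:R^-1, r] ->
  reflect (kernel n) r t = 0.
Proof. by move=> h; apply: (reflect_out (@kernel_out n)); rewrite subr0. Qed.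

Lemma Rintegral_kernel n (r : R) (D : set R) : measurable (D : set RT) ->
  `[r - n.+1%:R^-1, r] `<=` D -> \int[mu]_(t in D) reflect (kernel n) r t = 1.
Proof.
move=> mD sD; pose f t := step ((r - t) * n.+1%:R).
have n0 : 0 < n.+1%:R^-1 :> R by rewrite invr_gt0.
have sf : smooth f.
  have := @smooth_affine R step (- n.+1%:R) (n.+1%:R * r) (@smooth_step R).
  by congr smooth; apply/funext => x; congr step; ring.
have rr : r - n.+1%:R^-1 < r by rewrite gtrBl.
have f'0 x : x \notin `[r - n.+1%:R^-1, r] -> derive1 f x = 0.
  by move=> h; rewrite derive1_step_kernel reflect_kernel_out // oppr0.
have := Rintegral_derive1 mD sf rr f'0 sD; rewrite derive1_step_kernel.
rewrite /f subrr mul0r step_le0 // subKr mulVf // step_ge1 // sub0r.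
have ik := csupp_integrable mD (csupp_kernel n r).
under eq_Rintegral do rewrite -mulN1r.
by rewrite RintegralZl // mulN1r => /eqP; rewrite eqr_opp => /eqP.
Qed.

(** [step] being a primitive of [mollifier], the integral against the scaled step is a primitive of
    the convolution of [m] with the kernel. Differentiating it under the integral sign replaces an
    exchange of two integrations. *)
Lemma is_derive_step_integral n (J : set R) (m : R -> R) (r : R) :
  measurable (J : set RT) -> mu.-integrable J (EFin \o m) ->
  is_derive r 1 (fun r => \int[mu]_(t in J) (m t * step ((r - t) * n.+1%:R)))
    (\int[mu]_(t in J) (m t * reflect (kernel n) r t)).
Proof.
move=> mJ im.
pose f x t := m t * step ((x - t) * n.+1%:R).
have [B B0 kB] := smooth_bounded (@smooth_kernel n) (@kernel_out n).
have ms x : measurable_fun (J : set RT) (fun t => step ((x - t) * n.+1%:R)).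
  apply: measurable_smooth => //.
  have := @smooth_affine R step (- n.+1%:R) (n.+1%:R * x) (@smooth_step R).
  by congr smooth; apply/funext => z; congr step; ring.
have if_ x : mu.-integrable J (EFin \o f x).
  by apply: integrable_bounded_mul => // t _; exact: norm_step.
have df (x t : R) : is_derive x 1 (fun z : R => f z t) (m t * reflect (kernel n) x t).
  have h := is_deriveZ (m t) (is_derive_step_kernel n t x).
  exact: is_derive_eq h _.
have iG : mu.-integrable J (EFin \o (fun t => `|m t| * B)).
  have := integrableZr mJ B (integrable_norm im).
  by apply: eq_integrable => // t _ /=; rewrite EFinM.
have d1 (x t : R) : partial1of2 f x t = m t * reflect (kernel n) x t.
  by rewrite partial1of2E (derive_val (df := m t * reflect (kernel n) x t)).
have rI : `]r - 1, r + 1[%classic r by rewrite /= in_itv /= ltrBlDr ltrDl ltr01.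
have Gub (x t : R) : `]r - 1, r + 1[%classic x -> J t -> `|partial1of2 f x t| <= `|m t| * B.
  by move=> _ _; rewrite d1 normrM ler_wpM2l // kB.
have G0 t : 0 <= `|m t| * B by exact: mulr_ge0.
have if' (x : R) : `]r - 1, r + 1[%classic x -> mu.-integrable J (EFin \o f x) by [].
have df' (x t : R) : `]r - 1, r + 1[%classic x -> J t -> derivable (fun z : R => f z t) x 1.
  by move=> _ _; have [] := df x t.
have dF := @derivable_under_integral R _ RT mu f J mJ r (r - 1) (r + 1) rI if' df' _ G0 iG Gub.
have eF := @differentiation_under_integral R _ RT mu f J mJ r (r - 1) (r + 1) rI if' df' _ G0 iG Gub.
apply: DeriveDef; first exact: dF.
rewrite -derive1E; apply: (etrans eF); apply: eq_Rintegral => t _; exact: d1.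
Qed.

End Kernel.

Lemma derive_ge0_le (R : realType) (f df : R -> R) (s t : R) : s <= t ->
  (forall r, s <= r <= t -> is_derive r 1 f (df r)) ->
  (forall r, s <= r <= t -> 0 <= df r) -> f s <= f t.
Proof.
move=> st hf h0; have cf : {within `[s, t], continuous f}.
  apply: derivable_within_continuous => r; rewrite in_itv /= => rst.
  by have [] := hf r rst.
have df' r : r \in `]s, t[ -> is_derive r 1 f (df r).
  by rewrite in_itv /= => /andP[a b]; apply: hf; rewrite (ltW a) (ltW b).
have [c cst e] := MVT_segment st df' cf.
by rewrite -subr_ge0 e mulr_ge0 ?subr_ge0 // h0 //; move: cst; rewrite in_itv.
Qed.

(** Both g - f and g + f are nondecreasing; derivatives are compared without being integrated. *)
Lemma derive_norm_le (R : realType) (f df g dg : R -> R) (s t : R) : s <= t ->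
  (forall r, s <= r <= t -> is_derive r 1 f (df r)) ->
  (forall r, s <= r <= t -> is_derive r 1 g (dg r)) ->
  (forall r, s <= r <= t -> `|df r| <= dg r) -> `|f t - f s| <= g t - g s.
Proof.
move=> st hf hg h.
have h1 := @derive_ge0_le _ (g - f) (fun r => dg r - df r) s t st
  (fun r rst => is_deriveB (hg r rst) (hf r rst)).
have h2 := @derive_ge0_le _ (g + f) (fun r => dg r + df r) s t st
  (fun r rst => is_deriveD (hg r rst) (hf r rst)).
have {}h1 : g s - f s <= g t - f t.
  by apply: h1 => r /h; rewrite ler_norml => /andP[_]; rewrite subr_ge0.
have {}h2 : g s + f s <= g t + f t.
  by apply: h2 => r /h; rewrite ler_norml => /andP[]; lra.
by rewrite ler_norml; apply/andP; split; lra.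
Qed.

Lemma integrable_mul_kernel (R : realType) (J : set R) n (r : R) (h : R -> R) :
  measurable (J : set (measurableTypeR R)) ->
  (@lebesgue_measure R).-integrable J (EFin \o h) ->
  (@lebesgue_measure R).-integrable J (EFin \o (fun x => h x * reflect (kernel n) r x)).
Proof.
move=> mJ ih; have [C C0 kC] := smooth_bounded (@smooth_kernel R n) (@kernel_out R n).
have iC : (@lebesgue_measure R).-integrable J (EFin \o (fun x => h x * (C + 1))).
  by have := integrableZr mJ (C + 1) ih; apply: eq_integrable => // x _ /=; rewrite EFinM.
have C1 : 0 < C + 1 by lra.
have ms : measurable_fun (J : set (measurableTypeR R))
    (fun x => (C + 1)^-1 * reflect (kernel n) r x).
  apply: measurable_smooth => //; have sk := @smooth_reflect R _ r (@smooth_kernel R n).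
  have : smooth (fun x : R => (C + 1)^-1 * reflect (kernel n) r x).
    by apply: smoothM => //; exact: smooth_cst.
  exact.
have b1 x : J x -> `|(C + 1)^-1 * reflect (kernel n) r x| <= 1.
  move=> _; rewrite normrM normfV (gtr0_norm C1) ler_pdivrMl // mulr1.
  by have := kC (r - x); rewrite /reflect; lra.
have := integrable_bounded_mul mJ iC ms b1.
by apply: eq_integrable => // x _ /=; congr (_%:E); field; rewrite gt_eqF.
Qed.

(** * Green's formula by mollification *)

Section Green.
Local Open Scope quotient_scope.
Context (R : realType) (H : sepHilbertType R) (I : interval R).
Local Notation D := [set` I].
Local Notation mu := (@lebesgue_measure R).
Local Notation RT := (measurableTypeR R).
Implicit Types (u g : L2 H I).

Let mD : measurable (D : set RT).
Proof. exact: measurable_itv. Qed.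
Local Hint Resolve mD : core.

Section Mollify.
Context (u : L2 H I) (f : R -> H) (uf : represents u f) (n : nat).
Local Notation v r := (avg (reflect (kernel n) r) u).
Local Notation eps := (n.+1%:R^-1 : R).

Lemma avg_kernel_int g (r : R) (J : set R) x : measurable (J : set RT) -> J `<=` D ->
  `[r - eps, r] `<=` J ->
  rin (avg (reflect (kernel n) r) g) x =
  \int[mu]_(t in J) (reflect (kernel n) r t * rin (repr g t) x).
Proof.
move=> mJ JD sJ; apply: (etrans (rin_avg_int g x (csupp_kernel n r))).
apply: Rintegral_restrict => // t Dt nJ; rewrite reflect_kernel_out ?mul0r //.
by apply/negP => h; apply: nJ; exact: sJ.
Qed.

(** The reflected kernel is a probability density on [r - eps, r]. Pairing the difference x with
    itself writes |x|^2 as the mean of Re (f t - f r, x), which is at most d |x|. *)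
Lemma avg_kernel_close (r d : R) : `[r - eps, r] `<=` D -> 0 <= d ->
  (forall t, r - eps <= t <= r -> inorm (f t - f r) <= d) ->
  inorm (v r - f r) <= d.
Proof.
move=> sD d0 fd; set x := v r - f r; pose J := `[r - eps, r]%classic.
have mJ : measurable (J : set RT) by exact: measurable_itv.
have [x0|xn0] := eqVneq (inorm x) 0; first by rewrite x0.
have xp : 0 < inorm x by rewrite lt_neqAle eq_sym xn0 inorm_ge0.
pose ph := reflect (kernel n) r.
have ph0 t : 0 <= ph t by exact: kernel_ge0.
have ip : mu.-integrable J (EFin \o ph) by exact: csupp_integrable (csupp_kernel n r).
have iu : mu.-integrable J (EFin \o (fun t => ph t * rin (repr u t) x)).
  exact: (integrableS mD mJ sD (integrable_tens x u (csupp_kernel n r))).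
have if_ : mu.-integrable J (EFin \o (fun t => rin (f r) x * ph t)).
  by apply: eq_integrable (integrableZl mJ (rin (f r) x) ip).
have id_ : mu.-integrable J (EFin \o (fun t => (d * inorm x) * ph t)).
  by apply: eq_integrable (integrableZl mJ (d * inorm x) ip).
have p1 : \int[mu]_(t in J) ph t = 1 by apply: Rintegral_kernel.
have iB : mu.-integrable J (EFin \o (fun t => ph t * rin (repr u t) x - rin (f r) x * ph t)).
  by apply: eq_integrable (integrableB mJ iu if_).
have E : rin x x = \int[mu]_(t in J) (ph t * rin (repr u t) x - rin (f r) x * ph t).
  rewrite RintegralB // (RintegralZl _ mJ ip) p1 mulr1 {1}/x rinBl; congr (_ - _).
  exact: avg_kernel_int.
have : rin x x <= d * inorm x.
  rewrite E -[d * _]mulr1 -p1 -(RintegralZl _ mJ ip).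
  apply: le_trans (ler_norm _) _; apply: ae_le_norm_Rintegral => //.
    by move=> t _; exact: (mulr_ge0 (mulr_ge0 d0 (inorm_ge0 x)) (ph0 t)).
  apply: ae_imply uf => t ut Jt; rewrite (ut (sD t Jt)).
  rewrite mulrC -mulrBl -rinBl normrM (ger0_norm (ph0 t)).
  rewrite ler_wpM2r //; apply: le_trans (rin_CS_abs _ _) _.
  by rewrite ler_wpM2r ?inorm_ge0 // fd // -in_itv.
by rewrite -sqr_inorm expr2 ler_pM2r.
Qed.

End Mollify.

Definition energy_rate u g (t : R) : R := 2 * rin (repr ((- 'i) *: g) t) (repr u t).

Lemma integrable_energy_rate u g : mu.-integrable D (EFin \o energy_rate u g).
Proof.
exact: (integrableZl mD 2 (Re_int (repr ((- 'i) *: g)) (repr u))).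
Qed.

(* The [A]-terms cancel in [d/dt |u|^2], leaving [2 Re (- i g, u)]. *)
Theorem green_formula (A : set (H * H)) u g (f : R -> H) (c s t : R) :
  selfadjoint A -> L_max A I (u, g) -> represents u f -> c < s -> s <= t ->
  `[c, t] `<=` D -> {within `[c, t], continuous f} ->
  rin (f t) (f t) - rin (f s) (f s) = \int[mu]_(r in `[s, t]) energy_rate u g r.
Proof.
move=> sA ug uf cs st cD cf.
pose J := `[c, t]%classic; pose G := (- 'i) *: g.
have mJ : measurable (J : set RT) by exact: measurable_itv.
have im : mu.-integrable J (EFin \o energy_rate u g).
  exact: (integrableS mD mJ cD (integrable_energy_rate u g)).
(* An integrable majorant of |G| on a bounded segment, since |G| <= 1 + |G|^2. *)
pose q r := 1 + rin (repr G r) (repr G r).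
have q0 r : 0 <= q r by rewrite addr_ge0 // Re_inner_ge0.
have i1 : mu.-integrable J (EFin \o cst 1).
  apply: measurable_bounded_integrable => //; last exact: bounded_cst.
  by rewrite /= lebesgue_measure_itv /=; case: ifPn => _; rewrite ?ltry.
have iq : mu.-integrable J (EFin \o q).
  exact: (integrableD mJ i1 (integrableS mD mJ cD (Re_int (repr G) (repr G)))).
set m := energy_rate u g in im *.
(* [N n] is the squared norm of the mollified function and [M n] the mollified primitive of the
   energy rate; [K n], the mollified primitive of [q], will control the difference of their
   derivatives. *)
pose N n r := rin (avg (reflect (kernel n) r) u) (avg (reflect (kernel n) r) u).
pose M n (r : R) : R := \int[mu]_(x in J) (m x * step ((r - x) * n.+1%:R)).
pose K n (r : R) : R := \int[mu]_(x in J) (q x * step ((r - x) * n.+1%:R)).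
pose Kmax := \int[mu]_(x in J) q x.
pose P r := rin (f r) (f r).
pose ML (r : R) : R := \int[mu]_(x in J) (m x * \1_(`]-oo, r[%classic) x).
have ms n r : measurable_fun (J : set RT) (fun x => step ((r - x) * n.+1%:R)).
  apply: measurable_smooth => //.
  have := @smooth_affine R step (- n.+1%:R) (n.+1%:R * r) (@smooth_step R).
  by congr smooth; apply/funext => z; congr step; ring.
have cM r : (M ^~ r) @ \oo --> ML r.
  apply: dct_bounded => //; first by move=> n x _; exact: norm_step.
  by move=> x _; exact: step_cvg.
pose B := inorm (f s) + inorm (f t).
(* Replacing [N n] by [P] costs d (2 B + 1) at each of the two endpoints, and comparing the
   increments of [N n] and [M n] costs 4 d Kmax. *)
have main (d : R) : 0 < d -> d <= 1 -> exists N0, forall n, (N0 <= n)%N ->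
    `|(P t - P s) - (M n t - M n s)| <= d * (2 * (2 * B + 1) + 4 * Kmax).
  move=> d0 d1; have [r0 r00 hr0] := unif_continuous_segment cf d0.
  have e0 : 0 < Num.min r0 (s - c) by rewrite lt_min r00 subr_gt0.
  have [N0 hN0] := natSinv_lt e0; exists N0 => n /hN0.
  rewrite lt_min => /andP[er es].
  set eps := (n.+1%:R^-1 : R) in er es.
  have eps0 : 0 < eps by rewrite invr_gt0.
  pose v r := avg (reflect (kernel n) r) u.
  have sJ r : s <= r <= t -> `[r - eps, r] `<=` J.
    move=> /andP[sr rt] z; rewrite /= !in_itv /= => /andP[z1 z2].
    by rewrite /J /= in_itv /=; apply/andP; split; lra.
  have sD r : s <= r <= t -> `[r - eps, r] `<=` D.
    by move=> rst; exact: subset_trans (sJ r rst) cD.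
  have fclose r z : s <= r <= t -> r - eps <= z <= r -> inorm (f z - f r) <= d.
    move=> rst zr; have zJ : z \in `[c, t] by apply: (sJ r rst); rewrite /= in_itv.
    have rJ : r \in `[c, t].
      by apply: (sJ r rst); rewrite /= in_itv /= lexx gerBl ltW.
    apply: ltW; apply: hr0 => //; apply: le_lt_trans er.
    by move: zr => /andP[z1 z2]; rewrite ler_norml; apply/andP; split; lra.
  have vclose r : s <= r <= t -> inorm (v r - f r) <= d.
    move=> rst; apply: avg_kernel_close => //; first exact: sD.
      exact: ltW.
    by move=> z; exact: fclose.
  have dN r : s <= r <= t -> is_derive r 1 (N n)
      (2 * rin (avg (reflect (kernel n) r) G) (v r)).
    move=> rst; apply: (is_derive_evolution sA ug (@smooth_kernel R n) (ltW eps0)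
      (@kernel_out R n)).
    by rewrite subr0; exact: sD.
  have dM (r : R) : is_derive r (1:R) (M n) (\int[mu]_(x in J) (m x * reflect (kernel n) r x)).
    exact: is_derive_step_integral.
  have dK (r : R) : is_derive r (1:R) (K n) (\int[mu]_(x in J) (q x * reflect (kernel n) r x)).
    exact: is_derive_step_integral.
  have bnd (h : R -> R) r := @integrable_mul_kernel R J n r h mJ.
  (* The two derivatives are averages of 2 Re (G x, v r) and of 2 Re (G x, f x) against the same
     kernel, and |v r - f x| <= 2 d on its support. *)
  have dle r : s <= r <= t ->
      `|2 * rin (avg (reflect (kernel n) r) G) (v r) -
        \int[mu]_(x in J) (m x * reflect (kernel n) r x)| <=
      4 * d * \int[mu]_(x in J) (q x * reflect (kernel n) r x).
    move=> rst; set ph := reflect (kernel n) r.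
    have ph0 x : 0 <= ph x by exact: kernel_ge0.
    have iGv : mu.-integrable J (EFin \o (fun x => ph x * rin (repr G x) (v r))).
      exact: (integrableS mD mJ cD (integrable_tens (v r) G (csupp_kernel n r))).
    have i2Gv : mu.-integrable J (EFin \o (fun x => 2 * (ph x * rin (repr G x) (v r)))).
      by apply: eq_integrable (integrableZl mJ 2 iGv).
    have imp := bnd m r im; have iqp := bnd q r iq.
    have i4 : mu.-integrable J (EFin \o (fun x => 4 * d * (q x * ph x))).
      by apply: eq_integrable (integrableZl mJ (4 * d) iqp).
    rewrite (avg_kernel_int (n := n) G (v r) mJ cD (sJ r rst)).
    rewrite -(RintegralZl _ mJ iGv) -(RintegralZl _ mJ iqp) -RintegralB //.
    apply: ae_le_norm_Rintegral => //.
    - by apply: eq_integrable (integrableB mJ i2Gv imp).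
    - move=> x _; have d4 : 0 <= 4 * d by rewrite mulr_ge0 // (ltW d0).
      exact: (mulr_ge0 d4 (mulr_ge0 (q0 x) (ph0 x))).
    - apply: ae_imply uf => x ux Jx; rewrite /m /energy_rate -/G (ux (cD _ Jx)).
    have -> : 2 * (ph x * rin (repr G x) (v r)) - 2 * rin (repr G x) (f x) * ph x =
      2 * ph x * rin (repr G x) (v r - f x) by rewrite rinBr; ring.
    have [xr|xr] := boolP (x \in `[r - eps, r]); last first.
      by rewrite /ph reflect_kernel_out // !(mulr0, mul0r) normr0.
    have vf : inorm (v r - f x) <= 2 * d.
      apply: le_trans (inorm_dist (f r) _ _) _; rewrite (inormC (f r)).
      by have := vclose r rst; have := fclose r x rst xr; lra.
    have ph2 : 0 <= 2 * ph x by rewrite mulr_ge0 ?ph0.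
    rewrite normrM (ger0_norm ph2).
    have Gq : inorm (repr G x) <= q x.
      by rewrite /q -sqr_inorm; have := inorm_ge0 (repr G x); nra.
    have := rin_CS_abs (repr G x) (v r - f x).
    have : inorm (repr G x) * inorm (v r - f x) <= q x * (2 * d).
      by apply: ler_pM => //; exact: inorm_ge0.
    move=> h1 h2; apply: le_trans (ler_wpM2l ph2 (le_trans h2 h1)) _.
    have -> : 4 * d * (q x * ph x) = 2 * ph x * (q x * (2 * d)) by ring.
    exact: lexx.
  have h4 : `|(N n - M n) t - (N n - M n) s| <= 4 * d * K n t - 4 * d * K n s.
    apply: (@derive_norm_le _ _ _ (fun r => 4 * d * K n r) _ s t st
      (fun r rst => is_deriveB (dN r rst) (dM r))
      (fun r rst => is_deriveZ (4 * d) (dK r))) => r rst.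
    exact: dle.
  have step01 r x : 0 <= q x * step ((r - x) * n.+1%:R) <= q x.
    by rewrite mulr_ge0 ?step_ge0 //= ler_piMr // step_le1.
  have iqs r : mu.-integrable J (EFin \o (fun x => q x * step ((r - x) * n.+1%:R))).
    by apply: integrable_bounded_mul => // x _; exact: norm_step.
  have Kt : K n t <= Kmax.
    by apply: le_Rintegral => // x _; have /andP[] := step01 t x.
  have Ks : 0 <= K n s.
    by apply: Rintegral_ge0 => x _; have /andP[] := step01 s x.
  have NP r : s <= r <= t -> inorm (f r) <= B -> `|N n r - P r| <= d * (2 * B + 1).
    move=> rst fB; rewrite /N -/(v r) /P -!sqr_inorm subr_sqr normrM.
    have v1 := vclose r rst; have v2 := inorm_lerB (v r) (f r).
    have v3 := inorm_lerB (f r) (v r); rewrite inormC in v3.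
    have a1 : `|inorm (v r) - inorm (f r)| <= d.
      rewrite ler_norml lerNl opprB; apply/andP.
      by split; [exact: le_trans v3 v1|exact: le_trans v2 v1].
    have a2 : `|inorm (v r) + inorm (f r)| <= 2 * B + 1.
      rewrite ger0_norm ?addr_ge0 ?inorm_ge0 //.
      move: v1 v2 fB d1; move: (inorm (v r - f r)) (inorm (v r)) (inorm (f r)) B.
      by move=> p q' w B' v1 v2 fB d1; clear -v1 v2 fB d1; lra.
    exact: ler_pM.
  have Bs : inorm (f s) <= B by rewrite lerDl inorm_ge0.
  have Bt : inorm (f t) <= B by rewrite lerDr inorm_ge0.
  have NPs := NP s (introT andP (conj (lexx s) st)) Bs.
  have NPt := NP t (introT andP (conj st (lexx t))) Bt.
  move: h4 NPs NPt; rewrite !ler_norml => /andP[a1 a2] /andP[b1 b2] /andP[c1 c2].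
  have aE z : (N n - M n) z = N n z - M n z by [].
  rewrite !aE in a1 a2.
  have kk : 4 * d * K n t - 4 * d * K n s <= 4 * d * Kmax.
    rewrite -mulrBr ler_wpM2l ?mulr_ge0 ?(ltW d0) // lerBlDr.
    by apply: le_trans Kt _; rewrite lerDl.
  move: a1 a2 b1 b2 c1 c2 kk.
  move: (N n t) (N n s) (M n t) (M n s) (P t) (P s) (K n t) (K n s) (Kmax) (B).
  move=> Nt Ns Mt Ms Pt Ps Kt' Ks' Kmax' B' a1 a2 b1 b2 c1 c2 kk.
  clear -a1 a2 b1 b2 c1 c2 kk.
  by apply/andP; split; lra.
have limE : P t - P s = ML t - ML s.
  apply/eqP; rewrite -subr_eq0; apply/eqP/eq0_small => e e0.
  set C := 2 * (2 * B + 1) + 4 * Kmax.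
  have C0 : 0 <= C.
    rewrite /C addr_ge0 // mulr_ge0 ?addr_ge0 // ?mulr_ge0 ?addr_ge0 ?inorm_ge0 //.
    by apply: Rintegral_ge0 => x _.
  pose d := Num.min 1 (e / (2 * (C + 1))).
  have d0 : 0 < d by rewrite lt_min ltr01 divr_gt0 // mulr_gt0 //; lra.
  have d1 : d <= 1 by rewrite ge_min lexx.
  have d2 : d * (2 * (C + 1)) <= e.
    by rewrite -ler_pdivlMr ?ge_min ?lexx ?orbT // mulr_gt0 //; lra.
  have [N0 hN0] := main d d0 d1.
  have e4 : 0 < e / 4 by rewrite divr_gt0.
  have /cvgrPdist_le/(_ _ e4)[N1 _ hN1] := cM t.
  have /cvgrPdist_le/(_ _ e4)[N2 _ hN2] := cM s.
  pose n := maxn N0 (maxn N1 N2).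
  have h0 := hN0 n (leq_maxl _ _).
  have h1 := hN1 n (leq_trans (leq_maxl N1 N2) (leq_maxr N0 _)).
  have h2 := hN2 n (leq_trans (leq_maxr N1 N2) (leq_maxr N0 _)).
  have h3 : d * (2 * (2 * B + 1) + 4 * Kmax) <= e / 2.
    by rewrite -/C; clear -d0 d2 C0; nra.
  move: (le_trans h0 h3) h1 h2 => {h0 h3}.
  move: (P t) (P s) (M n t) (M n s) (ML t) (ML s) => Pt Ps Mt Ms lt ls.
  clear; rewrite !ler_norml => /andP[x1 x2] /andP[y1 y2] /andP[z1 z2].
  by apply/andP; split; lra.
rewrite -/(P t) -/(P s) limE.
have mlt r : measurable (`]-oo, r[%classic : set RT) by exact: measurable_itv.
(* The starting point [c] serves only to leave room for the mollification: its contribution cancels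
   in [ML t - ML s]. *)
have MLE r : r <= t -> ML r = \int[mu]_(x in `[c, r]) m x.
  move=> rt; rewrite /ML Rintegral_indic //.
  have -> : J `&` `]-oo, r[ = `[c, r[%classic.
    apply/seteqP; split => x.
      move=> [xJ xr]; have : x \in `[c, t] by exact: xJ.
      move: xr; rewrite /= !in_itv => xr /andP[cx _].
      by apply/andP; split.
    move=> xcr; have : x \in `[c, r[ by exact: xcr.
    rewrite in_itv => /andP[cx xr]; split; last by rewrite /= in_itv.
    by rewrite /J /= in_itv; apply/andP; split => //; exact: le_trans (ltW xr) rt.
  apply: Rintegral_itv_bndo_bndc; apply: (integrableS mJ _ _ im).
    exact: measurable_itv.
  by move=> x; rewrite /J /= !in_itv /= => /andP[-> xr] /=; rewrite (le_trans (ltW xr) rt).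
rewrite !MLE // (@Rintegral_itvB _ _ (BLeft c) (BRight t) s) //.
- apply: Rintegral_itv_obnd_cbnd; apply: (integrableS mJ _ _ im).
    exact: measurable_itv.
  by move=> x; rewrite /J /= !in_itv /= => /andP[sx ->]; rewrite (ltW (lt_trans cs sx)).
- by rewrite bnd_simp ltW.
Qed.

End Green.

(** * Energy estimates on a half-line *)

Section HalfLine.
Local Open Scope quotient_scope.
Context (R : realType) (H : sepHilbertType R) (I : interval R).
Local Notation D := [set` I].
Local Notation mu := (@lebesgue_measure R).
Local Notation RT := (measurableTypeR R).
Implicit Types (u g : L2 H I) (f : R -> H).

Let mD : measurable (D : set RT).
Proof. exact: measurable_itv. Qed.
Local Hint Resolve mD : core.

Hypothesis oD : open D.
Hypothesis farD : forall L T : R, 0 <= L ->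
  exists c, `[c, c + L] `<=` D /\ forall t, c <= t <= c + L -> T < `|t|.

Lemma itv_subset (s t : R) : D s -> D t -> `[s, t] `<=` D.
Proof.
by move=> Ds Dt z; rewrite /= in_itv => zst; exact: (interval_is_interval Ds Dt).
Qed.

(** Otherwise |f|^2 would exceed [e] on a far segment of length 1, where its integral is at most e /
    2. *)
Lemma far_small_point u f (e T : R) : represents u f -> 0 < e ->
  exists r, [/\ D r, T < `|r| & rin (f r) (f r) <= e].
Proof.
move=> uf e0; have e2 : 0 < e / 2 by rewrite divr_gt0.
have [T0 _ hT0] := tail_small u e2.
have [c [cD far]] := farD (Num.max T T0) (ler01).
have far1 t : c <= t <= c + 1 -> T < `|t| by move/far; rewrite gt_max => /andP[].
have far2 t : c <= t <= c + 1 -> T0 < `|t| by move/far; rewrite gt_max => /andP[].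
apply: contrapT => no; have big t : t \in `[c, c + 1] -> e < rin (f t) (f t).
  move=> tc; rewrite ltNge; apply/negP => le; apply: no; exists t.
  by split=> //; [exact: cD|by move: tc; rewrite in_itv => /far1].
pose J := `[c, c + 1]%classic.
have mJ : measurable (J : set RT) by exact: measurable_itv.
have DJ : D `&` J = J by apply/setIidr.
have muJ : mu J = 1%E.
  rewrite /J lebesgue_measure_itv /= lte_fin ltrDl ltr01 -EFinB; congr (_%:E); ring.
have ie : mu.-integrable J (EFin \o cst e).
  apply: measurable_bounded_integrable => //; last exact: bounded_cst.
  by change (mu J < +oo)%E; rewrite muJ ltry.
have ip : mu.-integrable J (EFin \o (fun t => rin (repr u t) (repr u t))).
  exact: (integrableS mD mJ cD (Re_int (repr u) (repr u))).
have h1 : `|\int[mu]_(t in J) e| <= \int[mu]_(t in J) rin (repr u t) (repr u t).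
  apply: (@ae_le_norm_Rintegral _ J (cst e) (fun t => rin (repr u t) (repr u t)) mJ ie ip).
    by move=> t _; exact: Re_inner_ge0.
  apply: ae_imply uf => t ut Jt; rewrite (ut (cD _ Jt)) gtr0_norm //.
  by apply: ltW; exact: big.
have h2 := hT0 c (c + 1) far2.
rewrite -/J DJ in h2; move: (le_trans h1 h2).
have muf : fine (mu J) = 1 by rewrite muJ.
rewrite Rintegral_cst // [fine _]muf mulr1 gtr0_norm //.
by move=> le; lra.
Qed.

Section Energy.
Context (A : set (H * H)) (u g : L2 H I) (f : R -> H).
Hypotheses (sA : selfadjoint A) (ug : L_max A I (u, g)) (uf : represents u f)
  (cf : {within D, continuous f}).

(** Openness of [D] provides the point to the left of [s] that the one-sided mollification
    requires. *)
Lemma green_interior (s t : R) : D s -> D t -> s <= t ->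
  rin (f t) (f t) - rin (f s) (f s) = \int[mu]_(r in `[s, t]) energy_rate u g r.
Proof.
move=> Ds Dt st; have [e /= e0 se] : \forall e \near 0^'+, D (s - e).
  have : nbhs s D by exact: open_nbhs_nbhs.
  move=> /nbhs_ballP[e /= e0 eD]; exists e => //= z /=; rewrite sub0r normrN => ze z0.
  by apply: eD; rewrite /ball /= opprB addrC subrK.
have Dc : D (s - e / 2).
  apply: (se (e / 2)); last by rewrite divr_gt0.
  by rewrite /= sub0r normrN gtr0_norm ?divr_gt0 //; lra.
have sub := itv_subset Dc Dt.
apply: (@green_formula _ _ _ A u g f (s - e / 2)) => //.
  by rewrite gtrBl divr_gt0.
exact: continuous_subspaceW cf.
Qed.

Lemma green_bound (s t : R) : D s -> D t -> s <= t ->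
  `|rin (f t) (f t) - rin (f s) (f s)| <= 2 * (rin u u + rin g g).
Proof.
move=> Ds Dt st; rewrite green_interior //; pose J := `[s, t]%classic.
have mJ : measurable (J : set RT) by exact: measurable_itv.
have JD : J `<=` D := itv_subset Ds Dt.
pose G := (- 'i) *: g.
have iu := Re_int (repr u) (repr u); have iG := Re_int (repr G) (repr G).
have iS := integrableD mD iu iG.
have i2 : mu.-integrable D
    (EFin \o (fun r => 2 * (rin (repr u r) (repr u r) + rin (repr G r) (repr G r)))).
  exact: (integrableZl mD 2 iS).
have GG : rin G G = rin g g by rewrite /G scaleNr rinNl rinNr opprK rin_ii.
have -> : 2 * (rin u u + rin g g) = \int[mu]_(r in D)
    (2 * (rin (repr u r) (repr u r) + rin (repr G r) (repr G r))).
  rewrite -GG RintegralZl //; congr (2 * _).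
  by rewrite RintegralD.
have pos r : 0 <= 2 * (rin (repr u r) (repr u r) + rin (repr G r) (repr G r)).
  by rewrite mulr_ge0 // addr_ge0 ?Re_inner_ge0.
apply: le_trans (Rintegral_subset mJ mD JD i2 (fun r _ => pos r)).
apply: ae_le_norm_Rintegral => //.
- exact: (integrableS mD mJ JD (integrable_energy_rate u g)).
- exact: (integrableS mD mJ JD i2).
apply: (@ae_imply _ (fun r => r \in I -> repr u r = f r)) uf => r _ _.
rewrite /energy_rate normrM ger0_norm // ler_wpM2l //.
by apply: le_trans (Re_inner_le _ _) _; rewrite addrC.
Qed.

(** The change of |f|^2 between [t] and a far point where it is arbitrarily small is bounded
    independently of both points. *)
Lemma trace_bound_interior (t : R) : D t ->
  rin (f t) (f t) <= 2 * (rin u u + rin g g).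
Proof.
move=> Dt; rewrite -subr_le0; apply/ler_addgt0Pl => e e0; rewrite addr0.
have [r [Dr _ Pr]] := far_small_point 0 uf e0.
have : `|rin (f t) (f t) - rin (f r) (f r)| <= 2 * (rin u u + rin g g).
  by have [rt|/ltW tr] := leP r t; [|rewrite distrC]; exact: green_bound.
rewrite ler_norml => /andP[_]; move: Pr.
move: (rin (f t) (f t)) (rin (f r) (f r)) (2 * _) => p q w; lra.
Qed.

(** Dominated convergence along segments exhausting [D]. Only convergence along the chosen endpoints
    is required, which suits a function known to be small merely at selected far points. *)
Lemma green_limit (lo hi : nat -> R) (l : R) :
  (forall n, [/\ D (lo n), D (hi n) & lo n <= hi n]) ->
  (forall t, D t -> exists N, forall n, (N <= n)%N -> t \in `[lo n, hi n]) ->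
  (fun n => rin (f (hi n)) (f (hi n)) - rin (f (lo n)) (f (lo n))) @ \oo --> l ->
  l = 2 * rin ((- 'i) *: g) u.
Proof.
move=> lohi cover cl.
have mE n : measurable (`[lo n, hi n]%classic : set RT) by exact: measurable_itv.
have := dct_indic mD (integrable_energy_rate u g) mE cover.
have -> : (fun n => \int[mu]_(t in D `&` `[lo n, hi n]) energy_rate u g t) =
    (fun n => rin (f (hi n)) (f (hi n)) - rin (f (lo n)) (f (lo n))).
  apply/funext => n; have [a b c] := lohi n; rewrite green_interior //.
  by congr (Rintegral _ _ _); apply/setIidr; exact: itv_subset.
move=> /(cvg_unique _ cl)->; last exact: Rhausdorff.
by rewrite RintegralZl //; exact: (Re_int (repr ((- 'i) *: g)) (repr u)).
Qed.

End Energy.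

Lemma inorm_le_closure f (E : set R) (C : R) : {within E, continuous f} ->
  D `<=` E -> E `<=` closure D -> (forall t, D t -> inorm (f t) <= C) ->
  forall t, E t -> inorm (f t) <= C.
Proof.
move=> cf DE Ecl fC t Et; apply/ler_addgt0Pl => e e0.
have [r r0 hr] := within_continuous_inorm cf Et e0.
have [z [Dz]] := Ecl t Et (ball t r) (nbhsx_ballx _ _ r0).
rewrite /ball /= => tz; have := hr z (DE z Dz).
rewrite distrC => /(_ tz) h; have := inorm_lerB (f t) (f z).
by rewrite inormC; move: (fC z Dz) h; lra.
Qed.

End HalfLine.

Section HalfLines.
Context (R : realType).
Implicit Types (a b c d t : R).

Lemma left_itv a c d :
  exists c' d', `]-oo, a[ `&` `]c, d[ = `]c', d'[%classic.
Proof.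
exists c, (Num.min a d); apply/seteqP; split=> t; rewrite /= !in_itv /= lt_min.
  by move=> [-> /andP[-> ->]].
by move=> /and3P[-> -> ->].
Qed.

Lemma right_itv b c d :
  exists c' d', `]b, +oo[ `&` `]c, d[ = `]c', d'[%classic.
Proof.
exists (Num.max b c), d; apply/seteqP; split=> t; rewrite /= !in_itv /= ?andbT gt_max.
  by move=> [-> /andP[-> ->]].
by move=> /andP[/andP[-> ->] ->].
Qed.

Lemma left_far a (L T : R) : 0 <= L ->
  exists c, `[c, c + L] `<=` `]-oo, a[%classic /\ forall t, c <= t <= c + L -> T < `|t|.
Proof.
move=> L0; exists (- (`|a| + `|T| + L + 1)); have Na := ler_norm (- a).
have NT := ler_norm T; have a0 := normr_ge0 a; have T0 := normr_ge0 T.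
rewrite normrN in Na; split=> t.
  by rewrite /= !in_itv /= => /andP[_ h]; lra.
by move=> /andP[_ h]; have := ler_norm (- t); rewrite normrN; lra.
Qed.

Lemma right_far b (L T : R) : 0 <= L ->
  exists c, `[c, c + L] `<=` `]b, +oo[%classic /\ forall t, c <= t <= c + L -> T < `|t|.
Proof.
move=> L0; exists (`|b| + `|T| + 1); have Nb := ler_norm b.
have NT := ler_norm T; have b0 := normr_ge0 b; have T0 := normr_ge0 T.
split=> t.
  by rewrite /= !in_itv /= andbT => /andP[h _]; lra.
by move=> /andP[h _]; have := ler_norm t; lra.
Qed.

Lemma left_closure a : `]-oo, a] `<=` closure `]-oo, a[%classic.
Proof.
move=> t; rewrite /= in_itv /= => ta U /nbhs_ballP[e /= e0 eU].
exists (t - e / 2); split; first by rewrite /= in_itv /=; lra.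
by apply: eU; rewrite /ball /= opprB addrC subrK gtr0_norm ?divr_gt0 //; lra.
Qed.

Lemma right_closure b : `[b, +oo[ `<=` closure `]b, +oo[%classic.
Proof.
move=> t; rewrite /= in_itv /= andbT => ta U /nbhs_ballP[e /= e0 eU].
exists (t + e / 2); split; first by rewrite /= in_itv /= andbT; lra.
by apply: eU; rewrite /ball /= opprD addNKr normrN gtr0_norm ?divr_gt0 //; lra.
Qed.

Lemma left_open a : open `]-oo, a[%classic. Proof. exact: interval_open. Qed.

Lemma right_open b : open `]b, +oo[%classic. Proof. exact: interval_open. Qed.

Lemma icvg_sqnorm (V : preHilbertType R) (x : nat -> V) l : icvg x l ->
  (fun n => rin (x n) (x n)) @ \oo --> rin l l.
Proof.
move=> xl; have cn : (fun n => inorm (x n)) @ \oo --> inorm l.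
  apply/cvgrPdist_lt => e e0; have [N hN] := xl e e0.
  exists N => // n /= /hN h; have h1 := inorm_lerB (x n) l.
  have h2 := inorm_lerB l (x n); rewrite inormC in h2.
  by rewrite ltr_norml; apply/andP; split; lra.
rewrite -sqr_inorm expr2.
have -> : (fun n => rin (x n) (x n)) = (fun n => inorm (x n) * inorm (x n)).
  by apply/funext => n; rewrite -sqr_inorm expr2.
exact: cvgM.
Qed.

Lemma cvg0_natSinv (p : nat -> R) : (forall n, 0 <= p n <= n.+1%:R^-1) ->
  p @ \oo --> 0.
Proof.
move=> hp; apply/cvgrPdist_lt => e e0; have [N hN] := natSinv_lt e0.
exists N => // n /= /hN h; rewrite sub0r normrN; have /andP[p0 p1] := hp n.
by rewrite ger0_norm // (le_lt_trans p1).
Qed.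

Section Trace.
Context (H : sepHilbertType R) (A : set (H * H)) (sA : selfadjoint A).

Lemma green_left a (u g : L2 H `]-oo, a[) (f : R -> H) :
  L_max A `]-oo, a[ (u, g) -> represents u f -> {within `]-oo, a], continuous f} ->
  rin (f a) (f a) = 2 * rin ((- 'i) *: g) u.
Proof.
move=> ug uf cf; have cf' : {within `]-oo, a[, continuous f}.
  by apply: continuous_subspaceW cf => t; rewrite /= !in_itv /=; exact: ltW.
(* A point below [a] of absolute value above |a| is negative, so these points tend to minus
   infinity; the extra 1 puts [lo n] below [hi n]. *)
have pt n : exists r, [/\ r < a, n%:R + `|a| + 1 < `|r| & rin (f r) (f r) <= n.+1%:R^-1].
  have e0 : 0 < n.+1%:R^-1 :> R by rewrite invr_gt0.
  have [r [Dr h1 h2]] := far_small_point (left_far a) (n%:R + `|a| + 1) uf e0.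
  by exists r; split=> //; move: Dr; rewrite /= in_itv.
have [lo hlo] := choice pt; pose hi n := a - n.+1%:R^-1.
have Sn n : 0 < (n.+1%:R^-1 : R) <= 1 by rewrite invr_gt0 ltr0n /= invf_le1 ?ler1n ?ltr0n.
have lolt (n : nat) : lo n < - (n%:R + `|a| + 1).
  have [h1 h2 _] := hlo n; have [l0|l0] := ltP (lo n) 0.
    by move: h2; rewrite (ltr0_norm l0); lra.
  have := ler_norm a; have n0 := ler0n R n.
  by move: h2; rewrite (ger0_norm l0); lra.
apply: (@green_limit _ _ _ (left_open (a:=a)) A u g f sA ug uf cf' lo hi).
- move=> n; have [h1 _ _] := hlo n; have /andP[s0 s1] := Sn n.
  have := lolt n; have := ler_norm (- a); have n0 := ler0n R n; rewrite normrN => h3 h4.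
  rewrite /= !in_itv /= /hi h1; move: (_^-1) s0 s1 => w s0 s1.
  by split=> //; lra.
- move=> t; rewrite /= in_itv /= => ta.
  have at0 : 0 < a - t by rewrite subr_gt0.
  have [N1 hN1] := natSinv_lt at0.
  exists (maxn N1 (Num.truncn `|t|).+1) => n; rewrite geq_max => /andP[/hN1 h1 h2].
  have tn : `|t| < n%:R.
    apply: (lt_le_trans (truncnS_gt _)); by rewrite ler_nat.
  have := ler_norm (- t); have := lolt n; have := normr_ge0 a; rewrite normrN => h3 h4 h5.
  rewrite in_itv /= /hi; move: (_^-1) h1 => w h1.
  by apply/andP; split; lra.
(* Along [lo] the squared norms tend to 0 by choice, along [hi] to the boundary value by continuity
   up to [a]. *)
- rewrite -[rin (f a) (f a)]subr0; apply: cvgB; last first.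
    by apply: cvg0_natSinv => n; have [_ _ h] := hlo n; rewrite Re_inner_ge0.
  apply: (icvg_sqnorm (x := f \o hi)) => e e0.
  have aE : `]-oo, a]%classic a by rewrite /= in_itv /=.
  have [r r0 hr] := within_continuous_inorm cf aE e0.
  have [N hN] := natSinv_lt r0; exists N => n /hN h; have /andP[s0 s1] := Sn n.
  apply: hr; rewrite /= /hi; first by rewrite in_itv /= gerBl ltW.
  by rewrite addrC addKr normrN gtr0_norm.
Qed.

(** The boundary point is now the lower limit of integration, whence the sign. *)
Lemma green_right b (u g : L2 H `]b, +oo[) (f : R -> H) :
  L_max A `]b, +oo[ (u, g) -> represents u f -> {within `[b, +oo[, continuous f} ->
  - rin (f b) (f b) = 2 * rin ((- 'i) *: g) u.
Proof.
move=> ug uf cf; have cf' : {within `]b, +oo[, continuous f}.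
  by apply: continuous_subspaceW cf => t; rewrite /= !in_itv /= !andbT; exact: ltW.
have pt n : exists r, [/\ b < r, n%:R + `|b| + 1 < `|r| & rin (f r) (f r) <= n.+1%:R^-1].
  have e0 : 0 < n.+1%:R^-1 :> R by rewrite invr_gt0.
  have [r [Dr h1 h2]] := far_small_point (right_far b) (n%:R + `|b| + 1) uf e0.
  by exists r; split=> //; move: Dr; rewrite /= in_itv /= andbT.
have [hi hhi] := choice pt; pose lo n := b + n.+1%:R^-1.
have Sn n : 0 < (n.+1%:R^-1 : R) <= 1 by rewrite invr_gt0 ltr0n /= invf_le1 ?ler1n ?ltr0n.
have higt (n : nat) : n%:R + `|b| + 1 < hi n.
  have [h1 h2 _] := hhi n; have [l0|l0] := ltP (hi n) 0.
    have := ler_norm (- b); have n0 := ler0n R n; rewrite normrN.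
    by move: h2; rewrite (ltr0_norm l0); lra.
  by move: h2; rewrite (ger0_norm l0).
apply: (@green_limit _ _ _ (right_open (b:=b)) A u g f sA ug uf cf' lo hi).
- move=> n; have [h1 _ _] := hhi n; have /andP[s0 s1] := Sn n.
  have := higt n; have := ler_norm b; have n0 := ler0n R n => h3 h4.
  rewrite /= !in_itv /= !andbT /lo h1; move: (_^-1) s0 s1 => w s0 s1.
  by split=> //; lra.
- move=> t; rewrite /= in_itv /= andbT => ta.
  have at0 : 0 < t - b by rewrite subr_gt0.
  have [N1 hN1] := natSinv_lt at0.
  exists (maxn N1 (Num.truncn `|t|).+1) => n; rewrite geq_max => /andP[/hN1 h1 h2].
  have tn : `|t| < n%:R.
    apply: (lt_le_trans (truncnS_gt _)); by rewrite ler_nat.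
  have := ler_norm t; have := higt n; have := normr_ge0 b => h3 h4 h5.
  rewrite in_itv /= /lo; move: (_^-1) h1 => w h1.
  by apply/andP; split; lra.
- rewrite -[- _]add0r; apply: cvgB.
    by apply: cvg0_natSinv => n; have [_ _ h] := hhi n; rewrite Re_inner_ge0.
  apply: (icvg_sqnorm (x := f \o lo)) => e e0.
  have aE : `[b, +oo[%classic b by rewrite /= in_itv /= lexx.
  have [r r0 hr] := within_continuous_inorm cf aE e0.
  have [N hN] := natSinv_lt r0; exists N => n /hN h; have /andP[s0 s1] := Sn n.
  apply: hr; rewrite /= /lo; first by rewrite in_itv /= andbT lerDl ltW.
  by rewrite addrC addKr gtr0_norm.
Qed.

End Trace.
End HalfLines.

Lemma within_continuous_comb (R : realType) (H : sepHilbertType R) (E : set R)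
    (a : R[i]) (f g : R -> H) : {within E, continuous f} ->
  {within E, continuous g} -> {within E, continuous (fun t => a *: f t + g t)}.
Proof.
move=> /subspace_continuousP cf /subspace_continuousP cg.
apply/subspace_continuousP => x Ex.
exact: (cvgD (cvgZl_tmp (k := a) (cf x Ex)) (cg x Ex)).
Qed.

(** * Convergence of continuous representatives *)

Section TraceLimit.
Local Open Scope quotient_scope.
Context (R : realType) (H : sepHilbertType R) (I : interval R) (E : set R).
Local Notation D := [set` I].
Local Notation mu := (@lebesgue_measure R).
Local Notation RT := (measurableTypeR R).

Hypothesis oD : open D.
Hypothesis farD : forall L T : R, 0 <= L ->
  exists c, `[c, c + L] `<=` D /\ forall t, c <= t <= c + L -> T < `|t|.
Hypotheses (DE : D `<=` E) (Ecl : E `<=` closure D).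
Variables (A : set (H * H)) (sA : selfadjoint A).

Lemma trace_bound (u g : L2 H I) (f : R -> H) : L_max A I (u, g) ->
  represents u f -> {within E, continuous f} ->
  forall t, E t -> inorm (f t) <= Num.sqrt (2 * (rin u u + rin g g)).
Proof.
move=> ug uf cf; apply: (inorm_le_closure cf DE Ecl) => t Dt.
rewrite /inorm ler_sqrt; last by rewrite mulr_ge0 // addr_ge0 ?Re_inner_ge0.
apply: (trace_bound_interior oD farD sA ug uf) => //.
exact: continuous_subspaceW cf.
Qed.

Lemma icvg_uniform_continuous (f_ : nat -> R -> H) (f : R -> H) :
  (forall n, {within E, continuous f_ n}) ->
  (forall e : R, 0 < e -> exists N, forall n, (N <= n)%N ->
     forall t, E t -> inorm (f_ n t - f t) <= e) ->
  {within E, continuous f}.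
Proof.
move=> cf uf; apply/subspace_continuousP => x Ex.
have FF : Filter (within E (nbhs x)) by exact: within_filter.
apply/(inorm_cvgP FF) => e e0; have e4 : 0 < e / 4 by rewrite divr_gt0.
have [N hN] := uf _ e4; have {}hN := hN N (leqnn N).
have /subspace_continuousP/(_ x Ex)/(inorm_cvgP FF)/(_ _ e4) := cf N.
rewrite !near_withinE; apply: filterS => t h Et; have {}h : inorm (f_ N t - f_ N x) < e / 4 := h Et.
have h1 := hN t Et; have h2 := hN x Ex.
have h3 := inorm_dist (f_ N t) (f t) (f x).
have h4 := inorm_dist (f_ N x) (f_ N t) (f x).
rewrite (inormC (f t) (f_ N t)) in h3; change (inorm (f t - f x) < e); lra.
Qed.

(** Applied to differences, [trace_bound] makes the continuous representatives uniformly Cauchy up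
    to the endpoint, so that the limit again has a continuous representative. *)
Lemma trace_limit (u g : nat -> L2 H I) (l h : L2 H I) (f_ : nat -> R -> H) :
  (forall n, [/\ L_max A I (u n, g n), represents (u n) (f_ n) &
     {within E, continuous f_ n}]) -> icvg u l -> icvg g h ->
  exists f, [/\ represents l f, {within E, continuous f} &
    forall t, E t -> icvg (f_ ^~ t) (f t)].
Proof.
move=> hf ul gh.
(* With both components of the difference below e / 2, the bound is less than the square root of 2
   (e^2/4 + e^2/4), which is [e]. *)
have cauchy (e : R) : 0 < e -> exists N, forall m n, (N <= m)%N -> (N <= n)%N ->
    forall t, E t -> inorm (f_ m t - f_ n t) < e.
  move=> e0; have e2 : 0 < e / 2 by rewrite divr_gt0.
  have [N1 h1] := icvg_cauchy ul e2; have [N2 h2] := icvg_cauchy gh e2.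
  exists (maxn N1 N2) => m n; rewrite !geq_max => /andP[m1 m2] /andP[n1 n2] t Et.
  have [a1 b1 c1] := hf m; have [a2 b2 c2] := hf n.
  have a3 : L_max A I ((-1) *: u n + u m, (-1) *: g n + g m).
    exact: (op_adjoint_linear (-1) a2 a1).
  have b3 := representsD (representsZ (-1) b2) b1.
  have c3 : {within E, continuous (fun t => (-1) *: f_ n t + f_ m t)}.
    exact: within_continuous_comb.
  have := trace_bound a3 b3 c3 Et; rewrite !scaleN1r ![- _ + _]addrC => le.
  apply: le_lt_trans le _; have {}h1 := h1 m n m1 n1; have {}h2 := h2 m n m2 n2.
  rewrite -!sqr_inorm; have := inorm_ge0 (u m - u n); have := inorm_ge0 (g m - g n).
  move: (inorm (u m - u n)) (inorm (g m - g n)) h1 h2 => p q h1 h2 q0 p0.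
  have -> : e = Num.sqrt (e ^+ 2) by rewrite sqrtr_sqr gtr0_norm.
  by rewrite ltr_sqrt ?exprn_gt0 //; nra.
have ptw t : exists x, E t -> icvg (f_ ^~ t) x.
  have [Et|nE] := pselect (E t); last by exists 0 => /nE.
  have [|x xl] := @hilbert_complete R H (f_ ^~ t); last by exists x.
  move=> e e0; have [N hN] := cauchy e e0; exists N => m n Nm Nn.
  exact: hN.
have [f hfl] := choice ptw; exists f; split=> //.
  (* A subsequence converges almost everywhere to the limit in the mean; it also converges to [f],
     so the two agree almost everywhere. *)
  have [l' [k [ul' kn hk]]] := L2_complete_ae (icvg_cauchy ul).
  have <- := icvg_unique ul' ul.
  have all : {ae mu, forall t, forall n, t \in I -> repr (u (k n)) t = f_ (k n) t}.
    by apply/ae_foralln => n; have [_ b _] := hf (k n).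
  apply: ae_imply2 hk all => t h1 h2 It; have Dt : D t by exact: It.
  have h3 : icvg (fun n => f_ (k n) t) (repr l' t).
    by have -> : (fun n => f_ (k n) t) = (fun n => repr (u (k n)) t);
      [apply/funext => n; rewrite h2|exact: h1].
  apply: icvg_unique h3 _ => e e0; have [N hN] := hfl t (DE Dt) e e0.
  by exists N => n Nn; apply: hN; exact: leq_trans Nn (kn n).
apply: icvg_uniform_continuous => [n|e e0]; first by have [_ _ c] := hf n.
have [N hN] := cauchy e e0; exists N => n Nn t Et.
rewrite inormC; apply: (icvg_le (hfl t Et) (N := N)) => m Nm.
by apply: ltW; exact: hN.
Qed.

End TraceLimit.

Lemma rin_Ni (R : realType) (V : preHilbertType R) (u v : V) :
  rin ((- 'i) *: u) v = - rin ('i *: u) v.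
Proof. by rewrite scaleNr rinNl. Qed.

Lemma op_adjoint_comb (R : realType) (V : preHilbertType R) (T : set (V * V))
    (c : R[i]) (u g v h : V) : op_adjoint T (u, g) -> op_adjoint T (v, h) ->
  op_adjoint T (c *: u + v, c *: g + h).
Proof. exact: op_adjoint_linear. Qed.

(** * The extension defined by a unitary operator *)

Section Extension.
Local Open Scope quotient_scope.
Context (R : realType) (H : sepHilbertType R) (A : set (H * H)) (a b : R)
  (W : {linear H -> H}).
Hypotheses (sA : selfadjoint A) (W_unitary : unitary W).
Local Notation IL := `]-oo, a[.
Local Notation IR := `]b, +oo[.
Local Notation V := (L2 H IL * L2 H IR)%type.
Implicit Types (u g v h w : V).

Lemma rin_W (x y : H) : rin (W x) (W y) = rin x y.
Proof. by have [-> _] := W_unitary. Qed.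

Lemma inorm_W (x : H) : inorm (W x) = inorm x.
Proof. by rewrite /inorm rin_W. Qed.

Lemma L_ext_max u g : L_ext A a b W (u, g) ->
  L_max A IL (u.1, g.1) /\ L_max A IR (u.2, g.2).
Proof. by case. Qed.

Lemma L_ext_lin (c : R[i]) u g v h : L_ext A a b W (u, g) ->
  L_ext A a b W (v, h) -> L_ext A a b W (c *: u + v, c *: g + h).
Proof.
move=> ug vh; have [u1 u2] := L_ext_max ug; have [v1 v2] := L_ext_max vh.
case: ug => _ [f1 [f2 [cf1 r1 cf2 r2 bc]]]; case: vh => _ [f1' [f2' [cf1' r1' cf2' r2' bc']]].
split; first by exact: (conj (op_adjoint_comb c u1 v1) (op_adjoint_comb c u2 v2)).
exists (fun t => c *: f1 t + f1' t), (fun t => c *: f2 t + f2' t); split.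
- exact: within_continuous_comb.
- exact: representsD (representsZ c r1) r1'.
- exact: within_continuous_comb.
- exact: representsD (representsZ c r2) r2'.
- by rewrite bc bc' linearD linearZ.
Qed.

Lemma L_max0 (I : interval R) : L_max A I (0, 0).
Proof.
by move=> q _; apply: (etrans (y := 0)); [|apply: esym]; exact: (linear0l (@inner R _) _).
Qed.

Lemma L_ext0 : L_ext A a b W (0, 0).
Proof.
split; first by split; exact: L_max0.
by exists (fun=> 0), (fun=> 0); split; [move=> t; exact: cvg_cst|exact: represents0|
  move=> t; exact: cvg_cst|exact: represents0|rewrite linear0].
Qed.

Lemma L_ext_symmetric u g : L_ext A a b W (u, g) -> rin ('i *: g) u = 0.
Proof.
have aux (p q r : R) : r = 2 * - p -> - r = 2 * - q -> p + q = 0 by lra.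
move=> ug; have [u1 u2] := L_ext_max ug.
case: ug => _ [f1 [f2 [cf1 r1 cf2 r2 bc]]].
have h1 := green_left sA u1 r1 cf1; have h2 := green_right sA u2 r2 cf2.
rewrite bc rin_W in h2.
apply: (etrans (rin_pair ('i *: g) u)).
apply: aux (etrans h1 (congr1 ( *%R 2) (rin_Ni g.1 u.1)))
  (etrans h2 (congr1 ( *%R 2) (rin_Ni g.2 u.2))).
Qed.

(** Adjoints are closed, and the boundary condition survives because the values at [a] and [b]
    converge and [W] is an isometry. *)
Lemma L_ext_closed (u g : nat -> V) l h : (forall n, L_ext A a b W (u n, g n)) ->
  icvg u l -> icvg g h -> L_ext A a b W (l, h).
Proof.
move=> ug ul gh.
have ul1 := icvg_fst ul; have ul2 := icvg_snd ul.
have gh1 := icvg_fst gh; have gh2 := icvg_snd gh.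
have /choice[f1 hf1] : forall n, exists f1, exists f2,
    [/\ {within `]-oo, a], continuous f1}, represents (u n).1 f1,
      {within `[b, +oo[, continuous f2}, represents (u n).2 f2 & f2 b = W (f1 a)].
  by move=> n; case: (ug n).
have /choice[f2 hf] := hf1.
have hL n : [/\ L_max A IL ((u n).1, (g n).1), represents (u n).1 (f1 n) &
    {within `]-oo, a], continuous f1 n}].
  by have [c1 r1 _ _ _] := hf n; have [m1 m2] := L_ext_max (ug n).
have hR n : [/\ L_max A IR ((u n).2, (g n).2), represents (u n).2 (f2 n) &
    {within `[b, +oo[, continuous f2 n}].
  by have [_ _ c2 r2 _] := hf n; have [m1 m2] := L_ext_max (ug n).
have subL : `]-oo, a[%classic `<=` `]-oo, a]%classic.
  by move=> t; rewrite /= !in_itv /=; exact: ltW.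
have subR : `]b, +oo[%classic `<=` `[b, +oo[%classic.
  by move=> t; rewrite /= !in_itv /= !andbT; exact: ltW.
have [F1 [rF1 cF1 lF1]] := trace_limit (left_open (a:=a)) (left_far a) subL
  (@left_closure R a) sA hL ul1 gh1.
have [F2 [rF2 cF2 lF2]] := trace_limit (right_open (b:=b)) (right_far b) subR
  (@right_closure R b) sA hR ul2 gh2.
split.
  have m1 n : op_adjoint (L_min A IL) ((fst \o u) n, (fst \o g) n).
    exact: (L_ext_max (ug n)).1.
  have m2 n : op_adjoint (L_min A IR) ((snd \o u) n, (snd \o g) n).
    exact: (L_ext_max (ug n)).2.
  exact: (conj (op_adjoint_closed m1 ul1 gh1) (op_adjoint_closed m2 ul2 gh2)).
exists F1, F2; split=> //.
have aE : `]-oo, a]%classic a by rewrite /= in_itv /=.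
have bE : `[b, +oo[%classic b by rewrite /= in_itv /= lexx.
apply: icvg_unique (lF2 b bE) _ => e e0.
have [N hN] := lF1 a aE e e0; exists N => n Nn.
have [_ _ _ _ ->] := hf n; rewrite -linearB inorm_W; exact: hN.
Qed.

Lemma tens_fun_continuous (E : set R) phi (x : H) : continuous phi ->
  {within E, continuous (tens_fun phi x)}.
Proof. by move=> cp; apply: continuous_subspaceT; exact: tens_continuous. Qed.

Lemma L_ext_tens_left phi x y : testfn IL phi -> A (x, y) ->
  L_ext A a b W ((tens IL phi x, 0), (tens_op IL phi x y, 0)).
Proof.
move=> tp Axy; have cp := testfn_csupp tp.
split; first by split; [exact: L_max_tens|exact: L_max0].
exists (tens_fun phi x), (fun=> 0); split.
- by apply: tens_fun_continuous; case: cp.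
- exact: represents_tens.
- by move=> t; exact: cvg_cst.
- exact: represents0.
(* The support lies in the open half-line, so the value at [a] is 0 and matches the zero function on
   the other side. *)
have [_ [c [d [out sub]]]] := tp.
rewrite /tens_fun out ?scale0r ?linear0 //; apply/negP => /sub.
by rewrite /= in_itv /= ltxx.
Qed.

Lemma L_ext_tens_right phi x y : testfn IR phi -> A (x, y) ->
  L_ext A a b W ((0, tens IR phi x), (0, tens_op IR phi x y)).
Proof.
move=> tp Axy; have cp := testfn_csupp tp.
split; first by split; [exact: L_max0|exact: L_max_tens].
exists (fun=> 0), (tens_fun phi x); split.
- by move=> t; exact: cvg_cst.
- exact: represents0.
- by apply: tens_fun_continuous; case: cp.
- exact: represents_tens.
have [_ [c [d [out sub]]]] := tp.
rewrite /tens_fun out ?scale0r ?linear0 //; apply/negP => /sub.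
by rewrite /= in_itv /= ltxx.
Qed.

End Extension.

(** * Quasi-modes *)

Section QuasiMode.
Local Open Scope quotient_scope.
Context (R : realType) (H : sepHilbertType R) (I : interval R).
Local Notation D := [set` I].
Local Notation mu := (@lebesgue_measure R).
Local Notation RT := (measurableTypeR R).
Implicit Types (phi psi : R -> R) (theta : R).

Let mD : measurable (D : set RT).
Proof. exact: measurable_itv. Qed.
Local Hint Resolve mD : core.

Lemma smooth_cosZ theta : smooth (fun t : R => cos (theta * t)).
Proof.
have := @smooth_trig R 1 0 theta.
by congr smooth; apply/funext => t; rewrite mul1r mul0r addr0.
Qed.

Lemma smooth_sinZ theta : smooth (fun t : R => sin (theta * t)).
Proof.
have := @smooth_trig R 0 1 theta.
by congr smooth; apply/funext => t; rewrite mul1r mul0r add0r.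
Qed.

(** [modc] and [mods] are the real and imaginary parts of phi t exp (i theta t), kept apart because
    [tens] takes real functions. *)
Definition modc phi theta (t : R) : R := phi t * cos (theta * t).
Definition mods phi theta (t : R) : R := phi t * sin (theta * t).

Lemma csupp_mulr phi psi : csupp phi -> continuous psi -> csupp (fun t => phi t * psi t).
Proof.
move=> [cf [c [d h]]] cg; split; last by exists c, d => t /h ->; rewrite mul0r.
by move=> t; apply: cvgM; [exact: cf|exact: cg].
Qed.

Lemma csupp_modc phi theta : csupp phi -> csupp (modc phi theta).
Proof. by move=> h; apply: csupp_mulr h _; exact: smooth_continuous (@smooth_cosZ theta). Qed.

Lemma csupp_mods phi theta : csupp phi -> csupp (mods phi theta).
Proof. by move=> h; apply: csupp_mulr h _; exact: smooth_continuous (@smooth_sinZ theta). Qed.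

Lemma derive1_modc phi theta : smooth phi ->
  derive1 (modc phi theta) = fun t => modc (derive1 phi) theta t + - theta * mods phi theta t.
Proof.
move=> sf; apply: derive1_val => t.
have h1 := smooth_is_derive sf t.
have h2 : is_derive t 1 (fun z : R => cos (theta * z + 0)) (theta * - sin (theta * t + 0)).
  by apply: is_derive_affine; exact: is_derive_cos.
have E : (fun z : R => cos (theta * z + 0)) = (fun z => cos (theta * z)).
  by apply/funext => z; rewrite addr0.
rewrite E addr0 in h2; apply: (is_derive_eq (is_deriveM h1 h2)).
rewrite /modc /mods /GRing.scale /=; ring.
Qed.

Lemma derive1_mods phi theta : smooth phi ->
  derive1 (mods phi theta) = fun t => mods (derive1 phi) theta t + theta * modc phi theta t.
Proof.
move=> sf; apply: derive1_val => t.
have h1 := smooth_is_derive sf t.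
have h2 : is_derive t 1 (fun z : R => sin (theta * z + 0)) (theta * cos (theta * t + 0)).
  by apply: is_derive_affine; exact: is_derive_sin.
have E : (fun z : R => sin (theta * z + 0)) = (fun z => sin (theta * z)).
  by apply/funext => z; rewrite addr0.
rewrite E addr0 in h2; apply: (is_derive_eq (is_deriveM h1 h2)).
rewrite /modc /mods /GRing.scale /=; ring.
Qed.

Lemma testfn_mulr phi psi : testfn I phi -> smooth psi ->
  testfn I (fun t => phi t * psi t).
Proof.
move=> [sf [c [d [h1 h2]]]] sp; split; first exact: smoothM.
by exists c, d; split=> // t /h1 ->; rewrite mul0r.
Qed.

(* The class of [t |-> phi t exp (i theta t) x]. *)
Definition mode phi theta (x : H) : L2 H I :=
  tens I (modc phi theta) x + 'i *: tens I (mods phi theta) x.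

(** The inner product of the cosine and sine parts is a real multiple of |x|^2, so the cross terms,
    being imaginary parts, vanish; the rest is cos^2 + sin^2 = 1. *)
Lemma inorm_mode phi theta x : csupp phi ->
  inorm (mode phi theta x) = Num.sqrt (\int[mu]_(t in D) phi t ^+ 2) * inorm x.
Proof.
move=> hp; have hc := csupp_modc theta hp; have hs := csupp_mods theta hp.
pose P := tens I (modc phi theta) x; pose Q := tens I (mods phi theta) x.
have ixx : Im (inner x x) = 0 by rewrite inner_real.
have PQ : Im (inner P Q) = 0.
  by rewrite /P /Q (inner_tens2 I x x hc hs) inner_real -rmorphM.
have QP : Im (inner Q P) = 0.
  by rewrite /P /Q (inner_tens2 I x x hs hc) inner_real -rmorphM.
have PP := rin_tens2 I x x hc hc; have QQ := rin_tens2 I x x hs hs.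
have ic := csupp_integrable mD (csuppM hc hc).
have is_ := csupp_integrable mD (csuppM hs hs).
have E : rin (mode phi theta x) (mode phi theta x) =
    (\int[mu]_(t in D) phi t ^+ 2) * rin x x.
  apply: (etrans (y := rin P P + rin Q Q)).
    apply: (etrans (rinDl P ('i *: Q) (P + 'i *: Q))).
    apply: (etrans (congr2 +%R (rinDr P ('i *: Q) P) (rinDr P ('i *: Q) ('i *: Q)))).
    apply: (etrans (congr2 +%R (congr2 +%R erefl (rin_ir P Q))
      (congr2 +%R (rin_il Q P) (rin_ii Q Q)))).
    by apply: (etrans (congr2 +%R (congr2 +%R erefl PQ)
      (congr2 +%R (congr1 -%R QP) erefl))); rewrite oppr0 addr0 add0r.
  apply: (etrans (congr2 +%R PP QQ)); rewrite -mulrDl; congr (_ * _).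
  rewrite -RintegralD //; apply: eq_Rintegral => t _.
  by rewrite /modc /mods -[RHS]mulr1 -(cos2Dsin2 (theta * t)); ring.
have p0 : 0 <= \int[mu]_(t in D) phi t ^+ 2.
  by apply: Rintegral_ge0 => t _; exact: sqr_ge0.
by rewrite [LHS]/inorm E sqrtrM.
Qed.

(** The frequency is chosen so that p and q disappear: both carry the factor m - theta - lambda. *)
Lemma mode_algebra (V : preHilbertType R) (a b p q P Q : V) (m theta lambda : R) :
  theta = m - lambda ->
  'i *: (a + (- theta)%:C *: q) + (P + m%:C *: p) +
  ('i *: ('i *: (b + theta%:C *: p)) + 'i *: (Q + m%:C *: q)) -
  lambda%:C *: (p + 'i *: q) = 'i *: (a + 'i *: b) + (P + 'i *: Q).
Proof.
move=> ->; apply: rin_ext => w.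
rewrite !(rinBl, rinDl, rinZl, rin_ii, rin_iC); ring.
Qed.

(** Two errors remain: the term in phi' is small for a slowly varying bump, the term in
    [y - m%:C *: x] for an approximate eigenvector. *)
Lemma mode_residual (A : set (H * H)) phi (m theta lambda : R) x y v h :
  selfadjoint A -> testfn I phi -> A (x, y) -> theta = m - lambda ->
  L_max A I (v, h) ->
  rin (h - lambda%:C *: v) (mode phi theta x) =
  rin v ('i *: mode (derive1 phi) theta x + mode phi theta (y - m%:C *: x)).
Proof.
move=> sA tphi Axy th vh.
have tc : testfn I (modc phi theta) by exact: testfn_mulr (@smooth_cosZ theta).
have ts : testfn I (mods phi theta) by exact: testfn_mulr (@smooth_sinZ theta).
have cc := testfn_csupp tc; have cs := testfn_csupp ts.
have cphi := testfn_csupp tphi; have cphi' := testfn_csupp (testfn_derive1 tphi).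
have L1 := (L_maxP v h sA).1 vh _ _ _ tc Axy.
have L2 := (L_maxP v h sA).1 vh _ _ _ ts (saZ sA 'i%R Axy).
set z := y - m%:C *: x.
have yz : y = z + m%:C *: x by rewrite subrK.
have T1 : tens_op I (modc phi theta) x y =
    'i *: (tens I (modc (derive1 phi) theta) x + (- theta)%:C *: tens I (mods phi theta) x) +
    (tens I (modc phi theta) z + m%:C *: tens I (modc phi theta) x).
  rewrite /tens_op derive1_modc; last by case: tphi.
  rewrite (tensDl I x (csupp_modc theta cphi') (csuppZ (- theta) cs)).
  by rewrite (tensZl I (- theta) x cs) yz (tensDr I _ _ cc) (tensZr I _ _ cc).
have T2 : tens_op I (mods phi theta) ('i *: x) ('i *: y) =
    'i *: ('i *: (tens I (mods (derive1 phi) theta) x + theta%:C *: tens I (modc phi theta) x)) +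
    'i *: (tens I (mods phi theta) z + m%:C *: tens I (mods phi theta) x).
  rewrite /tens_op derive1_mods; last by case: tphi.
  rewrite (tensDl I ('i *: x) (csupp_mods theta cphi') (csuppZ theta cc)).
  rewrite (tensZl I theta ('i *: x) cc).
  rewrite !(tensZr I 'i%R x cc) (tensZr I 'i%R x (csupp_mods theta cphi')).
  rewrite (tensZr I 'i%R y cs) yz (tensDr I _ _ cs) (tensZr I _ _ cs).
  congr (_ + _); congr ('i *: _); rewrite scalerDr; congr (_ + _).
  by rewrite !scalerA mulrC.
have L12 : rin h (mode phi theta x) =
    rin v (tens_op I (modc phi theta) x y + tens_op I (mods phi theta) ('i *: x) ('i *: y)).
  rewrite /mode -(tensZr I 'i%R x cs).
  apply: (etrans (rinDr _ _ h)); apply: esym; apply: (etrans (rinDr _ _ v)).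
  by congr (_ + _); [exact: (congr1 Re L1)|exact: (congr1 Re L2)].
have rl : rin (lambda%:C *: v) (mode phi theta x) =
    rin v (lambda%:C *: mode phi theta x).
  exact: (etrans (rinZl lambda v _) (esym (rinZr lambda v _))).
apply: (etrans (rinBl h (lambda%:C *: v) _)).
apply: (etrans (congr2 (fun r s => r - s) L12 rl)).
apply: (etrans (esym (rinBr _ _ v))); congr (Re (inner v _)).
by rewrite T1 T2 /mode; exact: mode_algebra.
Qed.

End QuasiMode.

(* [x] is an approximate eigenvector of [A] for some [m], modulated by a wide
   bump [phi] times [exp (i (m - lambda) t)]. *)
Lemma quasi_mode (R : realType) (H : sepHilbertType R) (I : interval R)
    (A : set (H * H)) (lambda e : R) : (exists x : H, x != 0) -> selfadjoint A ->
  (forall L T : R, 0 <= L ->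
    exists c, `[c, c + L] `<=` [set` I] /\ forall t, c <= t <= c + L -> T < `|t|) ->
  0 < e -> exists u r : L2 H I, [/\ inorm u = 1, inorm r <= e &
    forall v h, L_max A I (v, h) -> rin (h - lambda%:C *: v) u = rin v r].
Proof.
move=> H0 sA farD e0; have e2 : 0 < e / 2 by rewrite divr_gt0.
have [m hm] := selfadjoint_approx_eigenvalue (@hilbert_complete R H) H0 sA.
have [x [y [Axy x1 zle]]] := hm _ e2; set z := y - m%:C *: x in zle.
pose D := [set` I]; pose mu := @lebesgue_measure R.
have mD : measurable (D : set (measurableTypeR R)) by exact: measurable_itv.
have sm := @smooth_derive1 R mollifier (@smooth_mollifier R).
have out := @derive1_out R mollifier 0 1 (@smooth_mollifier R) (@mollifier_out R).
have [M M0 hM] := smooth_bounded sm out.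
(* The bump has width 1 / s, and [s * M] bounds its slope; half of [e] is spent here, the other half
   on the approximate eigenvector. *)
pose s := e / 2 / (M + 1); have M1 : 0 < M + 1 by rewrite ltr_wpDl.
have s0 : 0 < s by rewrite divr_gt0.
have sM : s * M <= e / 2 by rewrite /s -mulrA ler_piMr ?(ltW e2) // mulrC ler_pdivrMr // mul1r lerDl.
clearbody s; have w0 : 0 < s^-1 by rewrite invr_gt0.
have [c [cD _]] := farD s^-1 0 (ltW w0).
set d := c + s^-1 in cD; have cd : c < d by rewrite ltrDl.
have dc : d - c = s^-1 by rewrite /d addrAC subrr add0r.
have aff t : t \notin `[c, d] -> s * t + - (s * c) \notin `[0, 1].
  apply: contra; rewrite !in_itv /= -mulrBr => /andP[h1 h2].
  move: h1 h2; rewrite pmulr_rge0 // subr_ge0 => -> /=.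
  by rewrite -ler_pdivlMl // mulr1 lerBlDl.
pose phi (t : R) := mollifier (s * t + - (s * c)).
have sphi : smooth phi by exact: (@smooth_affine R mollifier s (- (s * c)) (@smooth_mollifier R)).
have phi0 t : t \notin `[c, d] -> phi t = 0 by move/aff; exact: mollifier_out.
have tphi : testfn I phi by split=> //; exists c, d.
have dphi : derive1 phi = fun t => s * derive1 mollifier (s * t + - (s * c)).
  apply: derive1_val => t; apply: is_derive_affine.
  exact: (smooth_is_derive (@smooth_mollifier R)).
have cphi := testfn_csupp tphi; have cphi' := testfn_csupp (testfn_derive1 tphi).
pose X := \int[mu]_(t in D) phi t ^+ 2; pose Y := \int[mu]_(t in D) derive1 phi t ^+ 2.
pose J := `[c, d]%classic.
have mJ : measurable (J : set (measurableTypeR R)) by exact: measurable_itv.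
have iphi : \int[mu]_(t in D) (s * phi t) = 1.
  pose st (t : R) := step (s * t + - (s * c)).
  have dst : derive1 st = fun t => s * phi t.
    by apply: derive1_val => t; apply: is_derive_affine; exact: is_derive_step.
  have sst : smooth st by exact: (@smooth_affine R step s (- (s * c)) (@smooth_step R)).
  have out' t : t \notin `[c, d] -> derive1 st t = 0.
    by rewrite dst => /phi0 ->; rewrite mulr0.
  have := Rintegral_derive1 mD sst cd out' cD; rewrite dst => ->.
  rewrite /st /d mulrDr mulfV ?gt_eqF // subrr addrAC subrr add0r.
  by rewrite step_ge1 // step_le0 // subr0.
have muJ : fine (mu J) = s^-1.
  by rewrite /mu /J lebesgue_measure_itv /= lte_fin cd /= -dc.
have i1 : mu.-integrable J (EFin \o cst 1).
  apply: measurable_bounded_integrable => //; last exact: bounded_cst.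
  by rewrite /= /J lebesgue_measure_itv /=; case: ifPn => _; rewrite ?ltry.
(* [phi] has integral 1 / s over a segment of length 1 / s; integrate phi^2 >= 2 phi - 1. *)
have X_ge : s^-1 <= X.
  have restr (h : R -> R) : (forall t, t \notin `[c, d] -> h t = 0) ->
      \int[mu]_(t in D) h t = \int[mu]_(t in J) h t.
    move=> h0; apply: Rintegral_restrict => // t _ nJ; apply: h0.
    by apply/negP => tJ; apply: nJ.
  have ip : mu.-integrable J (EFin \o (fun t => s * phi t)).
    exact: csupp_integrable mJ (csuppZ s cphi).
  have ip2 : mu.-integrable J (EFin \o (fun t => 2 * phi t)).
    exact: csupp_integrable mJ (csuppZ 2 cphi).
  have iq : mu.-integrable J (EFin \o (fun t => phi t ^+ 2)).
    by have := csupp_integrable mJ (csuppM cphi cphi); under eq_fun do rewrite -expr2.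
  have e1 : \int[mu]_(t in J) (2 * phi t) = 2 / s.
    have h : \int[mu]_(t in J) (s * phi t) = 1.
      by rewrite -iphi (restr (fun t => s * phi t)) // => t /phi0 ->; rewrite mulr0.
    have ipp : mu.-integrable J (EFin \o phi) by exact: csupp_integrable mJ cphi.
    move: h; rewrite !RintegralZl // => h.
    by apply: (mulfI (lt0r_neq0 s0)); rewrite mulrCA h mulr1 mulrCA mulfV ?gt_eqF // mulr1.
  rewrite /X (restr (fun t => phi t ^+ 2)); last by move=> t /phi0 ->; rewrite expr0n.
  have -> : s^-1 = \int[mu]_(t in J) (2 * phi t - 1).
    have := RintegralB mJ ip2 i1; rewrite /= => ->.
    by rewrite e1 Rintegral_cst // [fine _]muJ; field; rewrite gt_eqF.
  apply: le_Rintegral => //.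
    by apply: eq_integrable (integrableB mJ ip2 i1).
  by move=> t _ /=; have := sqr_ge0 (phi t - 1); nra.
(* The slope bound over a segment of length 1 / s, together with [X_ge]: relative to [phi], the
   derivative is of size [s * M] in the mean. *)
have Y_le : Y <= (s * M) ^+ 2 * X.
  apply: (le_trans (y := (s * M) ^+ 2 * s^-1)); last by rewrite ler_wpM2l ?sqr_ge0.
  rewrite -dc; apply: le_trans (ler_norm _) _.
  apply: Rintegral_norm_le => //; first exact: ltW.
  - by have := csupp_integrable mD (csuppM cphi' cphi'); under eq_fun do rewrite -expr2.
  - move=> t; rewrite dphi normrX ler_sqr ?nnegrE ?normr_ge0 ?mulr_ge0 ?(ltW s0) //.
    by rewrite normrM gtr0_norm // ler_wpM2l ?(ltW s0).
  - move=> t _ /aff h; rewrite dphi out // mulr0 expr0n //.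
have X0 : 0 < X by exact: lt_le_trans X_ge.
pose u0 := mode I phi (m - lambda) x.
pose r0 := 'i *: mode I (derive1 phi) (m - lambda) x + mode I phi (m - lambda) z.
have u0E : inorm u0 = Num.sqrt X by rewrite /u0 inorm_mode // x1 mulr1.
have N0 : 0 < Num.sqrt X by rewrite sqrtr_gt0.
have r0E : inorm r0 <= e * Num.sqrt X.
  apply: le_trans (inormD _ _) _; rewrite inorm_i !inorm_mode // x1 mulr1.
  have hY : Num.sqrt Y <= s * M * Num.sqrt X.
    have sM0 : 0 <= s * M by rewrite mulr_ge0 // ltW.
    have -> : s * M * Num.sqrt X = Num.sqrt ((s * M) ^+ 2 * X).
      by rewrite sqrtrM ?sqr_ge0 // sqrtr_sqr ger0_norm.
    by apply: ler_wsqrtr.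
  apply: (le_trans (lerD hY (ler_wpM2l (ltW N0) zle))).
  rewrite [Num.sqrt X * _]mulrC -mulrDl ler_pM2r //.
  by apply: le_trans (lerD sM (lexx _)) _; rewrite -splitr.
exists ((Num.sqrt X)^-1%:C *: u0), ((Num.sqrt X)^-1%:C *: r0); split.
- by rewrite inormZ u0E gtr0_norm ?invr_gt0 // mulVf // gt_eqF.
- by rewrite inormZ gtr0_norm ?invr_gt0 // mulrC ler_pdivrMr.
move=> v h vh; have E := mode_residual sA tphi Axy (erefl (m - lambda)) vh.
apply: (etrans (rinZr _ _ _)); apply: (etrans (congr1 _ E)).
exact: (esym (rinZr _ _ _)).
Qed.

(** * Closed symmetric operators off and on the real axis *)

Lemma scaleReIm (R : realType) (V : preHilbertType R) (c : R[i]) (u : V) :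
  c *: u = (Re c)%:C *: u + 'i *: ((Im c)%:C *: u).
Proof.
rewrite scalerA -scalerDl; congr (_ *: _); case: c => x y.
by apply/eqP; rewrite eq_complex /=; apply/andP; split; apply/eqP; ring.
Qed.

Lemma inormZ_le (R : realType) (V : preHilbertType R) (c : R[i]) (u : V) :
  inorm (c *: u) <= (`|Re c| + `|Im c|) * inorm u.
Proof.
by rewrite scaleReIm; apply: le_trans (inormD _ _) _; rewrite inorm_i !inormZ mulrDl.
Qed.

Lemma icvg_comb (R : realType) (V : preHilbertType R) (c : R[i]) (u g : nat -> V) l h :
  icvg u l -> icvg g h -> icvg (fun n => g n + c *: u n) (h + c *: l).
Proof.
move=> ul gh e e0; pose K := `|Re c| + `|Im c| + 1.
have K0 : 0 < K by rewrite ltr_wpDl ?addr_ge0.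
have e2 : 0 < e / 2 by rewrite divr_gt0.
have [N1 h1] := ul _ (divr_gt0 e2 K0); have [N2 h2] := gh _ e2.
exists (maxn N1 N2) => n; rewrite geq_max => /andP[/h1 {}h1 /h2 {}h2].
rewrite opprD addrACA -scalerBr.
have h3 := inormZ_le c (u n - l); have u0 := inorm_ge0 (u n - l).
have h4 : K * inorm (u n - l) < e / 2 by rewrite mulrC -ltr_pdivlMr.
apply: le_lt_trans (inormD _ _) _; rewrite [ltRHS]splitr; apply: ltrD => //.
apply: le_lt_trans h3 _; apply: le_lt_trans h4.
by rewrite ler_wpM2r // /K lerDl.
Qed.

Section ClosedSymmetric.
Context (R : realType) (V : preHilbertType R) (T : set (V * V)).
Hypothesis T_lin : forall (c : R[i]) u g v h, T (u, g) -> T (v, h) ->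
  T (c *: u + v, c *: g + h).
Implicit Type lambda : R[i].

Lemma shift_lin lambda (c : R[i]) u g v h : op_shift T lambda (u, g) ->
  op_shift T lambda (v, h) -> op_shift T lambda (c *: u + v, c *: g + h).
Proof.
rewrite /op_shift /= => ug vh; have := T_lin c ug vh.
by congr (T (_, _)); rewrite !scalerDr !scalerA mulrC addrACA.
Qed.

Lemma shiftB lambda u g v h : op_shift T lambda (u, g) ->
  op_shift T lambda (v, h) -> op_shift T lambda (u - v, g - h).
Proof.
move=> ug vh; have := shift_lin (-1) vh ug.
by rewrite !scaleN1r ![- _ + _]addrC.
Qed.

Lemma shift_injective lambda : (forall u, T (u, lambda *: u) -> u = 0) ->
  op_injective (op_shift T lambda).
Proof.
move=> ker u v g ug vg; apply/eqP; rewrite -subr_eq0; apply/eqP/ker.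
by have := shiftB ug vg; rewrite /op_shift /= subrr add0r.
Qed.

Lemma shift_range_subspace lambda : T (0, 0) ->
  linear_subspace (op_range (op_shift T lambda)).
Proof.
move=> T0; split; first by exists 0; rewrite /op_shift /= scaler0 addr0.
by move=> c g h [u ug] [v vh]; exists (c *: u + v); exact: shift_lin.
Qed.

Hypothesis T_sym : forall u g, T (u, g) -> rin ('i *: g) u = 0.
Hypothesis T_closed : forall (u g : nat -> V) l h,
  (forall n, T (u n, g n)) -> icvg u l -> icvg g h -> T (l, h).

(** Symmetry applied to g + lambda u leaves Re (i g, u) = Im lambda |u|^2, and Cauchy-Schwarz
    concludes. *)
Lemma shift_bound lambda u g : op_shift T lambda (u, g) ->
  `|Im lambda| * inorm u <= inorm g.
Proof.
move=> /T_sym /=; rewrite scaleReIm.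
have h1 : rin ('i *: ((Re lambda)%:C *: u)) u = 0.
  by rewrite rin_iC rinZl -[rin u _]opprK -rin_iC rin_iu oppr0 mulr0 oppr0.
have h2 : rin ('i *: ('i *: ((Im lambda)%:C *: u))) u = - (Im lambda * rin u u).
  by rewrite rin_iC rin_ii rinZl.
rewrite !scalerDr !rinDl h1 h2 add0r => /eqP; rewrite subr_eq0 -sqr_inorm => /eqP h.
have [->|u0] := eqVneq (inorm u) 0; first by rewrite mulr0 inorm_ge0.
have up : 0 < inorm u by rewrite lt_neqAle eq_sym u0 inorm_ge0.
have := rin_CS_abs ('i *: g) u; rewrite h inorm_i normrM normrX.
by rewrite (ger0_norm (inorm_ge0 u)) expr2 mulrA ler_pM2r.
Qed.

Lemma dense_range_full lambda : icomplete V -> Im lambda != 0 ->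
  inorm_dense (op_range (op_shift T lambda)) ->
  op_range (op_shift T lambda) = setT.
Proof.
move=> cV l0 dr; apply/seteqP; split=> // w _.
have Sn n : 0 < (n.+1%:R^-1 : R) by rewrite invr_gt0.
have /choice[u hu] : forall n, exists u, exists2 g,
    op_shift T lambda (u, g) & inorm (w - g) < n.+1%:R^-1.
  by move=> n; have [g [u ug] gw] := dr w _ (Sn n); exists u, g.
have /choice[g hg] : forall n, exists g,
    op_shift T lambda (u n, g) /\ inorm (w - g) < n.+1%:R^-1.
  by move=> n; have [g h1 h2] := hu n; exists g.
have gw : icvg g w.
  move=> e e0; have [N hN] := natSinv_lt e0; exists N => n /hN h.
  by have [_ h2] := hg n; rewrite inormC; exact: lt_trans h2 h.
have lp : 0 < `|Im lambda| by rewrite normr_gt0.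
have cu : icauchy u.
  move=> e e0; have [N hN] := icvg_cauchy gw (mulr_gt0 e0 lp).
  exists N => m n Nm Nn; have := hN m n Nm Nn.
  have [h1 _] := hg m; have [h2 _] := hg n.
  move=> h; rewrite -(ltr_pM2r lp) mulrC; apply: le_lt_trans h.
  exact: shift_bound (shiftB h1 h2).
have [l ul] := cV u cu; exists l; rewrite /op_shift /=.
apply: (T_closed _ ul (icvg_comb lambda ul gw)) => n.
by have [] := hg n.
Qed.

End ClosedSymmetric.

(** * The spectrum of the extension *)

Section Spectrum.
Local Open Scope quotient_scope.
Context (R : realType) (H : sepHilbertType R) (A : set (H * H)) (a b : R)
  (W : {linear H -> H}).
Hypotheses (sA : selfadjoint A) (W_unitary : unitary W)
  (H_neq0 : exists x : H, x != 0).
Local Notation IL := `]-oo, a[.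
Local Notation IR := `]b, +oo[.
Local Notation V := (L2 H IL * L2 H IR)%type.

Lemma ext_complete : icomplete V.
Proof. by apply: product_complete; exact: L2_complete. Qed.

Lemma L_ext_ker (x : R) (u : V) : L_ext A a b W (u, x%:C *: u) -> u = 0.
Proof.
move=> /L_ext_max[h1 h2]; case: u h1 h2 => u1 u2 /= h1 h2.
have -> := L_max_ker sA (left_itv a) (left_far a) h1.
by have -> := L_max_ker sA (right_itv b) (right_far b) h2.
Qed.

(** As [x] equals its conjugate, it moves to the other side of the form, and orthogonality becomes
    the weak eigenvalue equation. *)
Lemma L_max_of_orth (I : interval R) (w : L2 H I) (x : R) :
  (forall phi y z, testfn I phi -> A (y, z) ->
     inner w (tens_op I phi y z - x%:C *: tens I phi y) = 0) ->
  L_max A I (w, x%:C *: w).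
Proof.
move=> h; apply/(L_maxP _ _ sA) => phi y z tp Ayz.
have := h phi y z tp Ayz; move: (tens_op I phi y z) (tens I phi y) => p q.
move/eqP; rewrite linearBr /= subr_eq0 => /eqP ->.
apply: (etrans (innerZr _ _ _)); apply: (etrans _ (esym (innerZl _ _ _))).
by rewrite conjE /= oppr0.
Qed.

Lemma L_ext_dense (x : R) : inorm_dense (op_range (op_shift (L_ext A a b W) x%:C)).
Proof.
apply: (dense_of_orth ext_complete).
  apply: shift_range_subspace; last exact: L_ext0.
  by move=> *; exact: L_ext_lin.
move=> [w1 w2] orth; have -> : w1 = 0.
  apply: (L_max_ker sA (left_itv a) (left_far a) (lambda := x)).
  apply: L_max_of_orth => phi y z tp Ayz.
  have := orth (tens_op IL phi y z - x%:C *: tens IL phi y, 0).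
  (* Tensors vanish at the boundary, so with 0 on the other side they belong to the domain of the
     extension; this decouples the two components. *)
  have E : op_range (op_shift (L_ext A a b W) x%:C)
      (tens_op IL phi y z - x%:C *: tens IL phi y, 0).
    exists (tens IL phi y, 0); have := @L_ext_tens_left R H A a b W sA phi y z tp Ayz.
    rewrite /op_shift; congr (L_ext _ _ _ _ (_, _)).
    by congr (_, _); rewrite /= ?subrK // scaler0 addr0.
  move=> /(_ E) <-; apply: esym; apply: (etrans _ (addr0 _)).
  by congr (_ + _); exact: (linear0r (@inner R _) _).
have -> // : w2 = 0.
apply: (L_max_ker sA (right_itv b) (right_far b) (lambda := x)).
apply: L_max_of_orth => phi y z tp Ayz.
have := orth (0, tens_op IR phi y z - x%:C *: tens IR phi y).
have E : op_range (op_shift (L_ext A a b W) x%:C)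
    (0, tens_op IR phi y z - x%:C *: tens IR phi y).
  exists (0, tens IR phi y); have := @L_ext_tens_right R H A a b W sA phi y z tp Ayz.
  rewrite /op_shift; congr (L_ext _ _ _ _ (_, _)).
  by congr (_, _); rewrite /= ?subrK // scaler0 addr0.
move=> /(_ E) <-; apply: esym; apply: (etrans _ (add0r _)).
by congr (_ + _); exact: (linear0r (@inner R _) _).
Qed.

(* Otherwise [g] would be [(T - x) v], and its pairing with the [n]-th quasi-mode
   would be [O(9^-n)] instead of at least [3^-n / 2]. *)
Lemma L_ext_not_full (x : R) : op_range (op_shift (L_ext A a b W) x%:C) <> setT.
Proof.
move=> full.
(* The square of the hump size, so that the factor |v2| is beaten for large n; the halves on both
   sides cancel. *)
have e0 n : 0 < (3^-1 ^+ n) ^+ 2 / 2 :> R.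
  by rewrite divr_gt0 // exprn_gt0 // exprn_gt0 // invr_gt0.
have /choice[u hu] : forall n, exists u : L2 H IR, exists r : L2 H IR,
    [/\ inorm u = 1, inorm r <= (3^-1 ^+ n) ^+ 2 / 2 &
      forall v h, L_max A IR (v, h) -> rin (h - x%:C *: v) u = rin v r].
  by move=> n; exact: (quasi_mode x H_neq0 sA (right_far b) (e0 n)).
have /choice[r hr] := hu.
have u1 n : inorm (u n) = 1 by have [] := hr n.
have [g hg] := gliding_hump (@L2_complete R H IR) u1.
have [[v1 v2] vg] : op_range (op_shift (L_ext A a b W) x%:C) (0, g) by rewrite full.
have [_ m2] := L_ext_max vg; rewrite /= in m2.
have bound n : 1 <= inorm v2 * 3^-1 ^+ n.
  have [_ rn hn] := hr n; have E := hn _ _ m2.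
  have E' : rin g (u n) = rin v2 (r n).
    by apply: etrans E; congr (Re (inner _ _)); rewrite addrK.
  have h1 := hg n; rewrite Re_innerC E' in h1.
  have h2 := le_trans h1 (rin_CS_abs v2 (r n)).
  have h3 := le_trans h2 (ler_wpM2l (inorm_ge0 v2) rn).
  have q0 : 0 < 3^-1 ^+ n :> R by rewrite exprn_gt0 // invr_gt0.
  move: h3 q0; move: (3^-1 ^+ n) (inorm v2) => q N h3 q0.
  have {}h3 : 1 * q <= N * q * q.
    by rewrite mul1r; move: h3; rewrite expr2; lra.
  by rewrite -(ler_pM2r q0).
have N1 : 0 < (inorm v2 + 1)^-1 by rewrite invr_gt0 ltr_wpDl // inorm_ge0.
have [n hn] := natSinv_lt N1; have {}hn := hn n (leqnn n).
have := bound n.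
(* From n + 1 <= 3^n, so that the choice of [n] through 1/(n+1) suffices. *)
have p3 : 3^-1 ^+ n <= n.+1%:R^-1 :> R.
  rewrite exprVn lef_pV2 ?posrE ?exprn_gt0 ?ltr0n //.
  rewrite -natrX ler_nat; elim: n {hn} => // n IH; rewrite expnS.
  by apply: leq_trans (leq_mul (leqnn 3) IH); exact: ltn_Pmull.
have v0 := inorm_ge0 v2; rewrite leNgt => /negP [].
apply: le_lt_trans (ler_wpM2l v0 p3) _.
apply: le_lt_trans (ler_wpM2l v0 (ltW hn)) _.
by rewrite ltr_pdivrMr ?mul1r ?ltrDl // ltr_wpDl.
Qed.

End Spectrum.

Theorem theorem3p3 (R : realType) (H : sepHilbertType R)
    (H_neq0 : exists x : H, x != 0) (a b : R) (ltab : a < b)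
    (A : set (H * H)) (A_selfadjoint : selfadjoint A)
    (W : {linear H -> H}) (W_unitary : unitary W) :
  continuous_spectrum (L_ext A a b W) = [set x%:C | x in [set: R]].
Proof.
apply/seteqP; split=> [lambda [_ _ dense nfull]|_ [x _ <-]].
  (* For nonreal [lambda] a dense range is full, against the last condition in the definition of the
     continuous spectrum. *)
  exists (Re lambda) => //; have [im0|im] := eqVneq (Im lambda) 0.
    by case: lambda im0 {dense nfull} => p q /= ->.
  case: nfull; exact: (@dense_range_full R _ (L_ext A a b W)
    (@L_ext_lin R H A a b W) (@L_ext_symmetric R H A a b W A_selfadjoint W_unitary)
    (@L_ext_closed R H A a b W A_selfadjoint W_unitary) lambda
    (@ext_complete R H a b) im dense).
have nfull := @L_ext_not_full R H A a b W A_selfadjoint H_neq0 x.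
(* The failure of surjectivity alone excludes [x] from the resolvent set. *)
split=> //; first by move=> [_ full _]; exact: nfull full.
  apply: (@shift_injective R _ _ (@L_ext_lin R H A a b W)).
  by move=> u; exact: (@L_ext_ker R H A a b W A_selfadjoint x u).
exact: (@L_ext_dense R H A a b W A_selfadjoint x).
Qed.
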